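(* Let $G_\theta$ be any of the quantum groups $GL_\theta(m,\mathbb{R})$, $SL_\theta(m,\mathbb{R})$, $O_\theta(m)$, $SO_\theta(m)$ ($m=2n$ or $m=2n+1$), or $GL_\theta(n,\mathbb{C})$, $GL_{(1),\theta}(n,\mathbb{C})$, $U_\theta(n)$ (with $m=2n$). Then the differential algebra $\Omega_{\mathrm{alg}}(G_\theta)$ is a graded-involutive differential Hopf algebra, and $\Omega_{\mathrm{alg}}(\mathbb{R}^m_\theta)$ is a graded-involutive differential comodule over $\Omega_{\mathrm{alg}}(G_\theta)$.
   Context: Setting. $n\ge2$, $\theta\in M_n(\mathbb{R})$ antisymmetric, $\lambda^{\mu\nu}=e^{i\theta_{\mu\nu}}$. A graded-involutive differential algebra is a graded complex algebra with an antilinear involution $\omega\mapsto\bar\omega$, $\overline{\omega\omega'}=(-1)^{pp'}\bar\omega'\bar\omega$ for degrees $p,p'$, and a differential $d$ (degree-one antiderivation, $d^2=0$) with $d\bar\omega=\overline{d\omega}$. $\otimes_{\mathrm{gr}}$ is the graded tensor product: $(x'\otimes x'')(y'\otimes y'')=(-1)^{|x''||y'|}x'y'\otimes x''y''$, with differential $d\otimes I+(-I)^{\mathrm{gr}}\otimes d$ (where $(-I)^{\mathrm{gr}}=(-1)^p$ in degree $p$) and involution $\overline{\omega'\otimes\omega''}=\bar\omega'\otimes\bar\omega''$. Index notation. $I_{2n}=\{1,\dots,n,\bar1,\dots,\bar n\}$, $I_{2n+1}=I_{2n}\cup\{0\}$, involution $\mu\leftrightarrow\bar\mu$, $\bar0=0$.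 $\Lambda^{\mu\nu}=\Lambda^{\bar\mu\bar\nu}=\lambda^{\mu\nu}$, $\Lambda^{\bar\mu\nu}=\Lambda^{\mu\bar\nu}=\lambda^{\nu\mu}$, $\Lambda^{0i}=\Lambda^{i0}=1$. $\xi^\mu=z^\mu$, $\xi^{\bar\mu}=\bar z^\mu$, $\xi^0=x$. $\Omega_{\mathrm{alg}}(\mathbb{R}^m_\theta)$: graded unital algebra generated by $\xi^i$ (degree 0), $d\xi^i$ (degree 1), $i\in I_m$, with $\xi^i\xi^j=\Lambda^{ij}\xi^j\xi^i$, $\xi^id\xi^j=\Lambda^{ij}d\xi^j\,\xi^i$, $d\xi^id\xi^j=-\Lambda^{ij}d\xi^jd\xi^i$, differential $\xi^i\mapsto d\xi^i$, involution $\overline{\xi^i}=\xi^{\bar i}$, $\overline{d\xi^i}=d\xi^{\bar i}$; degree-0 part $C_{\mathrm{alg}}(\mathbb{R}^m_\theta)$. $M_\theta(m,\mathbb{R})$: unital $*$-algebra generated by $t^i_j$ ($i,j\in I_m$) with $t^i_jt^k_l=\Lambda^{ik}\Lambda^{lj}t^k_lt^i_j$, $(t^i_j)^*=t^{\bar i}_{\bar j}$; a $*$-bialgebra with $\Delta t^i_j=\sum_kt^i_k\otimes t^k_j$, $\varepsilon(t^i_j)=\delta^i_j$, coacting on $\Omega_{\mathrm{alg}}(\mathbb{R}^m_\theta)$ by the algebra homomorphism $\delta_0:\xi^i\mapsto\sum_jt^i_j\otimes\xi^j$, $d\xi^i\mapsto\sum_jt^i_j\otimes d\xi^j$. $\det_\theta\in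 M_\theta(m,\mathbb{R})$ is the (hermitian, central) element with $\delta_0(\Omega_0)=\det_\theta\otimes\Omega_0$, $\Omega_0=\prod_{\mu=1}^nd\bar z^\mu dz^\mu$ (times $dx$ if $m=2n+1$). $C_{\mathrm{alg}}(GL_\theta(m,\mathbb{R}))$: the $*$-Hopf algebra obtained by adding a hermitian central inverse $\det_\theta^{-1}$, with $\Delta\det_\theta^{-1}=\det_\theta^{-1}\otimes\det_\theta^{-1}$, $\varepsilon(\det_\theta^{-1})=1$. The other quantum groups are defined by $*$-Hopf algebras $C_{\mathrm{alg}}(G_\theta)$ which are quotients of $C_{\mathrm{alg}}(GL_\theta(m,\mathbb{R}))$: - $SL_\theta(m,\mathbb{R})$: impose $\det_\theta=\mathbf 1$. - $O_\theta(m)$: impose the relations on the $t^i_j$ expressing that $\delta_0(Q)=\mathbf 1\otimes Q$ for $Q=\sum_\mu\bar z^\mu z^\mu$ (plus $x^2$ if $m=2n+1$). For $m=2n$, writing $a^\mu_\nu=t^\mu_\nu$, $b^\mu_\nu=t^\mu_{\bar\nu}$, $\bar a^\mu_\nu=t^{\bar\mu}_{\bar\nu}$, $\bar b^\mu_\nu=t^{\bar\mu}_\nu$, these are $\sum_\mu(\bar a^\mu_\alpha a^\mu_\beta+b^\mu_\alpha\bar b^\mu_\beta)=\delta_{\alpha\beta}\mathbf 1$, $\sum_\mu(\bar a^\mu_\alpha b^\mu_\beta+b^\mu_\alpha\bar a^\mu_\beta)=0$, $\sum_\mu(\bar b^\mu_\alpha a^\mu_\beta+a^\mu_\alpha\bar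 b^\mu_\beta)=0$ for $1\le\alpha,\beta\le n$. In the quotient $(\det_\theta)^2=\mathbf 1$, so $\det_\theta^{-1}=\det_\theta$. - $SO_\theta(m)$: in addition $\det_\theta=\mathbf 1$. - $GL_\theta(n,\mathbb{C})$: quotient of $C_{\mathrm{alg}}(GL_\theta(2n,\mathbb{R}))$ by the ideal generated by the $b^\mu_\nu,\bar b^\mu_\nu$; $GL_{(1),\theta}(n,\mathbb{C})$ (deformation of matrices with determinant of modulus one): in addition $\det_\theta=\mathbf 1$. - $U_\theta(n)$: quotient of $C_{\mathrm{alg}}(O_\theta(2n))$ by the ideal generated by the images of the $b^\mu_\nu,\bar b^\mu_\nu$. $I(G_\theta)$ denotes the kernel of $C_{\mathrm{alg}}(GL_\theta(m,\mathbb{R}))\to C_{\mathrm{alg}}(G_\theta)$. $\Omega_{\mathrm{alg}}(GL_\theta(m,\mathbb{R}))$: graded-involutive differential algebra generated by the $t^i_j$ (degree 0) and $dt^i_j$ (degree 1), $i,j\in I_m$, with the relations $t^i_jt^k_l=\Lambda^{ik}\Lambda^{lj}t^k_lt^i_j$ (no summation), $\overline{t^i_j}=(t^i_j)^*=t^{\bar i}_{\bar j}$ and $t^i_jdt^k_l=\Lambda^{ik}\Lambda^{lj}dt^k_l\,t^i_j$, $dt^i_jdt^k_l=-\Lambda^{ik}\Lambda^{lj}dt^k_ldt^i_j$, $\overline{dt^i_j}=dt^{\bar i}_{\bar j}$, with $\det_\theta^{-1}$ added in degree 0, hermitian, inverse to $\det_\theta$, commuting with everything, $d(\det_\theta^{-1})=-(\det_\theta^{-1})^2d(\det_\theta)$.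 $\Omega_{\mathrm{alg}}(G_\theta)$ is the quotient of $\Omega_{\mathrm{alg}}(GL_\theta(m,\mathbb{R}))$ by the closed (i.e. $d$-stable) graded two-sided ideal generated by $I(G_\theta)$. A graded-involutive differential Hopf algebra is a graded-involutive differential algebra $\Omega$ with a coassociative coproduct $\Delta:\Omega\to\Omega\otimes_{\mathrm{gr}}\Omega$ which is a homomorphism of graded-involutive differential algebras, a counit $\varepsilon:\Omega\to\mathbb{C}$ which is a real algebra homomorphism with $\varepsilon\circ d=0$, and an antipode; here these extend the structures of $C_{\mathrm{alg}}(G_\theta)$. A graded-involutive differential comodule over $\Omega$ is a graded-involutive differential algebra $\Omega'$ with a homomorphism of graded-involutive differential algebras $\delta:\Omega'\to\Omega\otimes_{\mathrm{gr}}\Omega'$ such that $(\Delta\otimes I)\circ\delta=(I\otimes\delta)\circ\delta$, $(\varepsilon\otimes I)\circ\delta=I$; here $\delta\xi^i=\sum_j[t^i_j]\otimes\xi^j$. *)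

(* Defs.v *)
From HB Require Import structures.
From mathcomp Require Import all_boot all_order all_algebra.
From mathcomp Require Import generic_quotient ring_quotient.
From mathcomp Require Import boolp classical_sets fsbigop reals trigo.
From mathcomp Require Import complex finmap monalg.

Set Implicit Arguments.
Unset Strict Implicit.
Unset Printing Implicit Defensive.

Import Order.TTheory GRing.Theory Num.Theory.
Local Open Scope ring_scope.
Local Open Scope classical_set_scope.

(* Unital associative C-algebras.  The library's algType also demands 1 != 0, *)
(* which is not available for an algebra given by generators and relations.   *)
Record pzAlg (C : pzRingType) := PzAlg {
  pa_mod : lmodType C;
  pa_one : pa_mod;
  pa_mul : pa_mod -> pa_mod -> pa_mod;
  pa_mulA : associative pa_mul;
  pa_mul1 : left_id pa_one pa_mul;
  pa_mulr1 : right_id pa_one pa_mul;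
  pa_mulDl : left_distributive pa_mul +%R;
  pa_mulDr : right_distributive pa_mul +%R;
  pa_mulZl : forall (a : C) x y, a *: pa_mul x y = pa_mul (a *: x) y;
  pa_mulZr : forall (a : C) x y, a *: pa_mul x y = pa_mul x (a *: y) }.

Definition pa_sort (C : pzRingType) (A : pzAlg C) : Type := pa_mod A.
Coercion pa_sort : pzAlg >-> Sortclass.
HB.instance Definition _ (C : pzRingType) (A : pzAlg C) :=
  GRing.Lmodule.on (pa_sort A).
HB.instance Definition _ (C : pzRingType) (A : pzAlg C) :=
  GRing.Zmodule_isPzRing.Build (pa_sort A) (@pa_mulA C A) (@pa_mul1 C A)
    (@pa_mulr1 C A) (@pa_mulDl C A) (@pa_mulDr C A).

Lemma pzscalerAl (C : pzRingType) (A : pzAlg C) (a : C) (x y : A) :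
  a *: (x * y) = (a *: x) * y.
Proof. exact: pa_mulZl. Qed.
Lemma pzscalerAr (C : pzRingType) (A : pzAlg C) (a : C) (x y : A) :
  a *: (x * y) = x * (a *: y).
Proof. exact: pa_mulZr. Qed.

Record is_submodule (R : pzRingType) (V : lmodType R) (W : set V) : Prop := {
  sub0 : W 0;
  subP : forall a x y, W x -> W y -> W (a *: x + y) }.

Record submodule (R : pzRingType) (V : lmodType R) := Submodule {
  sub_set :> V -> Prop;
  sub_ax : is_submodule sub_set }.

Section QuotientModule.
Context (R : pzRingType) (V : lmodType R) (W : submodule V).

Definition sub_pred : pred V := fun x => `[< W x >].

Lemma sub_predP x : reflect (W x) (x \in sub_pred).
Proof. exact: asboolP. Qed.

Lemma subD x y : W x -> W y -> W (x + y).
Proof. move=> Wx Wy; rewrite -[x]scale1r; by apply: (subP (sub_ax W)). Qed.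

Lemma subZ a x : W x -> W (a *: x).
Proof.
move=> Wx; rewrite -[_ *: _]addr0.
by apply: (subP (sub_ax W)) => //; apply: sub0 (sub_ax W).
Qed.

Lemma subN x : W x -> W (- x).
Proof. by move=> Wx; rewrite -scaleN1r; apply: subZ. Qed.

Lemma sub_zmod_closed : zmod_closed sub_pred.
Proof.
split; first by apply/sub_predP; apply: sub0 (sub_ax W).
move=> x y /sub_predP Wx /sub_predP Wy; apply/sub_predP.
by apply: subD => //; apply: subN.
Qed.

HB.instance Definition _ := GRing.isZmodClosed.Build V sub_pred sub_zmod_closed.

Definition sub_zmod : zmodClosed V := GRing.ZmodClosed.clone V sub_pred _.

Definition qmod : Type := Quotient.quot sub_zmod.
HB.instance Definition _ := GRing.Zmodule.on qmod.

End QuotientModule.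

HB.lock Definition qproj (R : pzRingType) (V : lmodType R) (W : submodule V)
  (x : V) : qmod W := (\pi_(Quotient.quot (sub_zmod W)) x)%qT.

HB.lock Definition qrepr (R : pzRingType) (V : lmodType R) (W : submodule V)
  (x : qmod W) : V := repr (x : Quotient.quot (sub_zmod W)).

Section QuotientModuleTheory.
Context (R : pzRingType) (V : lmodType R) (W : submodule V).
Local Notation qproj := (@qproj R V W).
Local Notation qmod := (qmod W).

Lemma qreprK x : qproj (qrepr x) = x.
Proof. by rewrite qproj.unlock qrepr.unlock; apply: reprK. Qed.

Lemma qprojP x y : qproj x = qproj y <-> W (x - y).
Proof.
split=> [/eqP|Wxy].
  by rewrite qproj.unlock -Quotient.idealrBE => /sub_predP.
by apply/eqP; rewrite qproj.unlock -Quotient.idealrBE; apply/sub_predP.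
Qed.

Lemma qproj0 : qproj 0 = 0. Proof. by rewrite qproj.unlock raddf0. Qed.
Lemma qprojD x y : qproj (x + y) = qproj x + qproj y.
Proof. by rewrite qproj.unlock raddfD. Qed.
Lemma qprojN x : qproj (- x) = - qproj x.
Proof. by rewrite qproj.unlock raddfN. Qed.

Lemma qrepr_proj x : W (qrepr (qproj x) - x).
Proof. by apply/qprojP; rewrite qreprK. Qed.

Definition qscale (a : R) (x : qmod) : qmod := qproj (a *: qrepr x).

Lemma qscaleE a x : qscale a (qproj x) = qproj (a *: x).
Proof. by apply/qprojP; rewrite -scalerBr; apply: subZ; apply: qrepr_proj. Qed.

Fact qscaleA a b x : qscale a (qscale b x) = qscale (a * b) x.
Proof. by rewrite -[x]qreprK !qscaleE scalerA. Qed.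
Fact qscale1 : left_id 1 qscale.
Proof. by move=> x; rewrite -[x]qreprK qscaleE scale1r. Qed.
Fact qscaleDr : right_distributive qscale +%R.
Proof.
move=> a x y; rewrite -[x]qreprK -[y]qreprK.
by rewrite -qprojD !qscaleE -qprojD scalerDr.
Qed.
Fact qscaleDl x : {morph qscale^~ x : a b / a + b}.
Proof. by move=> a b; rewrite -[x]qreprK !qscaleE -qprojD scalerDl. Qed.

HB.instance Definition _ := GRing.Zmodule_isLmodule.Build R qmod
  qscaleA qscale1 qscaleDr qscaleDl.

Lemma qprojZ a x : qproj (a *: x) = a *: qproj x.
Proof. by rewrite -qscaleE. Qed.

Lemma qproj_eq0 x : qproj x = 0 <-> W x.
Proof. by rewrite -qproj0 qprojP subr0. Qed.

End QuotientModuleTheory.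

(* The map induced on quotients by f; it is independent of the choice of      *)
(* representatives as soon as f is additive and maps W into W' (lemma below). *)
Definition qmap (R : pzRingType) (V V' : lmodType R)
    (W : submodule V) (W' : submodule V') (f : V -> V') : qmod W -> qmod W' :=
  fun x => qproj W' (f (qrepr x)).

Lemma qmapE (R : pzRingType) (V V' : lmodType R)
    (W : submodule V) (W' : submodule V') (f : V -> V') :
    zmod_morphism f -> (forall x, W x -> W' (f x)) ->
  forall x, qmap W' f (qproj W x) = qproj W' (f x).
Proof. by move=> fB fW x; apply/qprojP; rewrite -fB; apply/fW/qrepr_proj. Qed.

Record is_ideal (R : pzRingType) (A : pzAlg R) (J : set A) : Prop := {
  ideal_sub : is_submodule J;
  idealMl : forall a x, J x -> J (a * x);
  idealMr : forall a x, J x -> J (x * a) }.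

Record ideal (R : pzRingType) (A : pzAlg R) := Ideal {
  ideal_set : set A;
  ideal_ax : is_ideal ideal_set }.

Definition submodule_of_ideal (R : pzRingType) (A : pzAlg R) (J : ideal A) :
  submodule A := Submodule (ideal_sub (ideal_ax J)).
Coercion submodule_of_ideal : ideal >-> submodule.

Section QuotientAlgebra.
Context (R : pzRingType) (A : pzAlg R) (J : ideal A).

Definition qmul (x y : qmod J) : qmod J := qproj J ((qrepr x : A) * qrepr y).

Lemma qmulE (x y : A) : qmul (qproj J x) (qproj J y) = qproj J (x * y).
Proof.
apply/qprojP; set x' : A := qrepr _; set y' : A := qrepr _.
have -> : x' * y' - x * y = (x' - x) * y' + x * (y' - y).
  by rewrite mulrBl mulrBr addrA subrK.
apply: subD; first exact/(idealMr (ideal_ax J))/qrepr_proj.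
exact/(idealMl (ideal_ax J))/qrepr_proj.
Qed.

Fact qmulA : associative qmul.
Proof.
move=> x y z; rewrite -[x]qreprK -[y]qreprK -[z]qreprK.
by rewrite !qmulE mulrA.
Qed.
Fact qmul1 : left_id (qproj J (1 : A)) qmul.
Proof. by move=> x; rewrite -[x]qreprK qmulE mul1r. Qed.
Fact qmulr1 : right_id (qproj J (1 : A)) qmul.
Proof. by move=> x; rewrite -[x]qreprK qmulE mulr1. Qed.
Fact qmulDl : left_distributive qmul +%R.
Proof.
move=> x y z; rewrite -[x]qreprK -[y]qreprK -[z]qreprK.
by rewrite -qprojD !qmulE -qprojD mulrDl.
Qed.
Fact qmulDr : right_distributive qmul +%R.
Proof.
move=> x y z; rewrite -[x]qreprK -[y]qreprK -[z]qreprK.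
by rewrite -qprojD !qmulE -qprojD mulrDr.
Qed.
Fact qmulZl (a : R) (x y : qmod J) : a *: qmul x y = qmul (a *: x) y.
Proof.
by rewrite -[x]qreprK -[y]qreprK qmulE -!qprojZ qmulE pzscalerAl.
Qed.
Fact qmulZr (a : R) (x y : qmod J) : a *: qmul x y = qmul x (a *: y).
Proof.
by rewrite -[x]qreprK -[y]qreprK qmulE -!qprojZ qmulE pzscalerAr.
Qed.

Definition qalg : pzAlg R :=
  PzAlg qmulA qmul1 qmulr1 qmulDl qmulDr qmulZl qmulZr.

Lemma qprojM (x y : A) :
  qproj J (x * y) = (qproj J x : qalg) * (qproj J y : qalg).
Proof. by rewrite -qmulE. Qed.

End QuotientAlgebra.

(* Graded algebras A = \oplus_(p : nat) A_p, given by the projections         *)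
(* gcomp p : A -> A onto the A_p.                                             *)
Record gradedAlg (C : pzRingType) := GradedAlg {
  gcar :> pzAlg C;
  gcomp : nat -> gcar -> gcar;
  gcomp_linear : forall p, linear (gcomp p);
  gcompK : forall p q x, gcomp p (gcomp q x) = if p == q then gcomp q x else 0;
  gcomp_sum : forall x, exists N, x = \sum_(p < N) gcomp p x;
  gcomp1 : gcomp 0 1 = 1;
  gcompM : forall p q x y,
    gcomp (p + q) (gcomp p x * gcomp q y) = gcomp p x * gcomp q y }.

Definition homog (C : pzRingType) (A : gradedAlg C) (p : nat) (x : A) : Prop :=
  gcomp p x = x.

(* The operator (-I)^gr, equal to (-1)^p in degree p (a finite sum).          *)
Definition gsign (C : pzRingType) (A : gradedAlg C) (x : A) : A :=
  \sum_(p \in [set: nat]) (-1) ^+ p *: gcomp p x.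

Section GradedTheory.
Context (C : pzRingType) (A : gradedAlg C).
Implicit Types (x y : A) (p q : nat).

Lemma gcompZD p a x y : gcomp p (a *: x + y) = a *: gcomp p x + gcomp p y.
Proof. exact: gcomp_linear. Qed.
Lemma gcompD p x y : gcomp p (x + y) = gcomp p x + gcomp p y.
Proof. by rewrite -[x]scale1r gcompZD !scale1r. Qed.
Lemma gcomp0 p : gcomp p (0 : A) = 0.
Proof. by apply: (addrI (gcomp p 0)); rewrite -gcompD !addr0. Qed.
Lemma gcompZ p a x : gcomp p (a *: x) = a *: gcomp p x.
Proof. by rewrite -[_ *: x]addr0 gcompZD gcomp0 addr0. Qed.
Lemma gcompN p x : gcomp p (- x) = - gcomp p x.
Proof. by rewrite -!scaleN1r gcompZ. Qed.
Lemma gcomp_bigsum p (I : Type) (r : seq I) (P : pred I) (F : I -> A) :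
  gcomp p (\sum_(i <- r | P i) F i) = \sum_(i <- r | P i) gcomp p (F i).
Proof. exact: (big_morph _ (gcompD p) (gcomp0 p)). Qed.

Lemma homog_gcomp p x : homog p (gcomp p x).
Proof. by rewrite /homog gcompK eqxx. Qed.

Lemma homogE p q x : homog q x -> gcomp p x = if p == q then x else 0.
Proof. by move=> h; rewrite -{1}h gcompK h. Qed.

Lemma homogM p q x y : homog p x -> homog q y -> homog (p + q) (x * y).
Proof. by move=> <- <-; apply: gcompM. Qed.

Lemma homog0 p : homog p (0 : A). Proof. exact: gcomp0. Qed.
Lemma homogD p x y : homog p x -> homog p y -> homog p (x + y).
Proof. by rewrite /homog gcompD => -> ->. Qed.
Lemma homogZ p a x : homog p x -> homog p (a *: x).
Proof. by rewrite /homog gcompZ => ->. Qed.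

Lemma gcomp_bound x : exists N, forall p, (N <= p)%N -> gcomp p x = 0.
Proof.
have [N ->] := gcomp_sum x; exists N => p Np.
rewrite gcomp_bigsum big1 // => i _; rewrite gcompK.
by case: eqP => // e; move: (ltn_ord i); rewrite -e ltnNge Np.
Qed.

Lemma gcomp_ind (P : A -> Prop) :
    P 0 -> (forall x y, P x -> P y -> P (x + y)) ->
    (forall p x, homog p x -> P x) ->
  forall x, P x.
Proof.
move=> P0 PD Ph x; have [N ->] := gcomp_sum x.
by apply: (big_ind P) => // i _; apply: Ph; apply: homog_gcomp.
Qed.

End GradedTheory.

Lemma fsum_ord (V : nmodType) (F : nat -> V) (N : nat) :
    (forall p, (N <= p)%N -> F p = 0) ->
  \sum_(p \in [set: nat]) F p = \sum_(p < N) F p.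
Proof.
move=> FN; rewrite fsbig_ord.
rewrite [LHS]fsbig_supp [RHS]fsbig_supp; apply: eq_fsbigl.
apply/seteqP; split=> p /= [h1 h2]; split => //.
by rewrite ltnNge; apply/negP => /FN.
Qed.

Lemma fsum_delta (V : nmodType) (F : nat -> V) (N : nat) :
    (forall p, p != N -> F p = 0) ->
  \sum_(p \in [set: nat]) F p = F N.
Proof.
move=> h; rewrite (@fsum_ord _ F N.+1); last first.
  by move=> p Np; apply: h; rewrite neq_ltn Np orbT.
rewrite big_ord_recr /= big1 ?add0r // => i _; apply: h.
by rewrite neq_ltn ltn_ord.
Qed.

Record is_graded_ideal (C : pzRingType) (A : gradedAlg C) (J : set A) : Prop := {
  gideal_ideal : is_ideal J;
  gideal_comp : forall p x, J x -> J (gcomp p x) }.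

Record gideal (C : pzRingType) (A : gradedAlg C) := GIdeal {
  gideal_set : set A;
  gideal_ax : is_graded_ideal gideal_set }.

Definition ideal_of_gideal (C : pzRingType) (A : gradedAlg C) (J : gideal A) :
  ideal A := Ideal (gideal_ideal (gideal_ax J)).
Coercion ideal_of_gideal : gideal >-> ideal.

Section GradedQuotient.
Context (C : pzRingType) (A : gradedAlg C) (J : gideal A).

Definition gqcomp (p : nat) : qalg J -> qalg J := qmap J (gcomp p).

Lemma gqcompE p x : gqcomp p (qproj J x) = qproj J (gcomp p x).
Proof.
apply: qmapE; first by move=> u v; rewrite gcompD gcompN.
by move=> u; apply: (gideal_comp (gideal_ax J)).
Qed.

Fact gqcomp_linear p : linear (gqcomp p).
Proof.
move=> a x y; rewrite -[x]qreprK -[y]qreprK.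
by rewrite -qprojZ -qprojD !gqcompE gcompZD qprojD qprojZ.
Qed.
Fact gqcompK p q x :
  gqcomp p (gqcomp q x) = if p == q then gqcomp q x else 0.
Proof.
rewrite -[x]qreprK !gqcompE gcompK; case: ifP => _; last exact: qproj0.
by [].
Qed.
Fact gqcomp_sum x : exists N, x = \sum_(p < N) gqcomp p x.
Proof.
rewrite -[x]qreprK; have [N hN] := gcomp_sum (qrepr x); exists N.
rewrite {1}hN (big_morph _ (qprojD J) (qproj0 J)).
by apply: eq_bigr => i _; rewrite gqcompE.
Qed.
Fact gqcomp1 : gqcomp 0 1 = 1.
Proof. by rewrite -[LHS]/(gqcomp 0 (qproj J (1 : A))) gqcompE gcomp1. Qed.
Fact gqcompM p q x y :
  gqcomp (p + q) (gqcomp p x * gqcomp q y) = gqcomp p x * gqcomp q y.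
Proof.
by rewrite -[x]qreprK -[y]qreprK 2!gqcompE -qprojM gqcompE gcompM.
Qed.

Definition gquot : gradedAlg C :=
  GradedAlg gqcomp_linear gqcompK gqcomp_sum gqcomp1 gqcompM.

End GradedQuotient.

Section GeneratedIdeals.
Context (C : pzRingType) (A : gradedAlg C).

Lemma graded_ideal_inter (P : set A -> Prop) :
    (forall J, P J -> is_graded_ideal J) ->
  is_graded_ideal [set x | forall J, P J -> J x].
Proof.
move=> PJ; split; first split; first split.
- by move=> J hJ; have [[[h _] _ _] _] := PJ J hJ.
- move=> a x y hx hy J hJ; have [[[_ h] _ _] _] := PJ J hJ.
  by apply: h; [apply: hx|apply: hy].
- by move=> a x hx J hJ; have [[_ h _] _] := PJ J hJ; apply: h; apply: hx.
- by move=> a x hx J hJ; have [[_ _ h] _] := PJ J hJ; apply: h; apply: hx.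
by move=> p x hx J hJ; have [_ h] := PJ J hJ; apply: h; apply: hx.
Qed.

Definition gideal_gen (S : set A) : gideal A :=
  GIdeal (@graded_ideal_inter (fun J => is_graded_ideal J /\ S `<=` J)
    (fun J => @proj1 _ _)).

Definition closed_gideal_gen (d : A -> A) (S : set A) : gideal A :=
  GIdeal (@graded_ideal_inter
    (fun J => is_graded_ideal J /\ ((forall x, J x -> J (d x)) /\ S `<=` J))
    (fun J => @proj1 _ _)).

End GeneratedIdeals.

(* The extension of phi : K -> V to the free module on K, linear when s is    *)
(* the identity and antilinear when s is the complex conjugation.             *)
HB.lock Definition mext (C : nzRingType) (K : choiceType) (V : lmodType C)
    (s : C -> C) (phi : K -> V) (g : {malg C[K]}) : V :=
  \sum_(k <- msupp g) s g@_k *: phi k.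

Section FreeModule.
Context (C : nzRingType) (K : choiceType) (V : lmodType C).
Context (s : {rmorphism C -> C}).
Implicit Types (phi : K -> V) (g h : {malg C[K]}).

Lemma mextEw phi (D : {fset K}) g : (msupp g `<=` D)%fset ->
  mext s phi g = \sum_(k <- D) s g@_k *: phi k.
Proof.
move=> le; rewrite mext.unlock [LHS](big_fset_incl _ le) //= => k _ /mcoeff_outdom ->.
by rewrite rmorph0 scale0r.
Qed.

Lemma mextP phi a g h :
  mext s phi (a *: g + h) = s a *: mext s phi g + mext s phi h.
Proof.
pose D := (msupp g `|` msupp h `|` msupp (a *: g + h))%fset.
rewrite (@mextEw phi D) ?(@mextEw phi D g) ?(@mextEw phi D h).
- rewrite scaler_sumr -big_split /=; apply: eq_bigr => k _.
  by rewrite mcoeffD mcoeffZ rmorphD rmorphM scalerDl scalerA.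
- by rewrite /D -fsetUA fsetUCA fsubsetUl.
- by rewrite /D -fsetUA fsubsetUl.
by rewrite fsubsetUr.
Qed.

Lemma mextU phi k : mext s phi << k >> = phi k.
Proof. by rewrite mext.unlock msuppU oner_eq0 big_seq_fset1 mcoeffUU rmorph1 scale1r. Qed.

Lemma mextD phi g h : mext s phi (g + h) = mext s phi g + mext s phi h.
Proof. by rewrite -[g]scale1r mextP rmorph1 !scale1r. Qed.

Lemma mext0 phi : mext s phi 0 = 0.
Proof. by rewrite mext.unlock msupp0 big_seq_fset0. Qed.

Lemma mextZ phi a g : mext s phi (a *: g) = s a *: mext s phi g.
Proof. by rewrite -[_ *: g]addr0 mextP mext0 addr0. Qed.

End FreeModule.

Lemma malg_ind (C : nzRingType) (K : choiceType) (P : {malg C[K]} -> Prop) :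
    P 0 -> (forall x y, P x -> P y -> P (x + y)) ->
    (forall a k, P (a *: << k >>)) ->
  forall x, P x.
Proof.
move=> P0 PD PU x; rewrite [x]monalgE.
apply: (big_ind P) => // k _.
suff -> : << x@_k *g k >> = x@_k *: << k >> :> {malg C[K]} by [].
by apply/malgP => k'; rewrite mcoeffZ !mcoeffU mulrnAr mulr1.
Qed.

Section MonoidAlgebra.
Context (C : comNzRingType) (M : monomType).

Local Notation F := {malg C[M]}.

Local Lemma malgF_ind (P : F -> Prop) :
    P 0 -> (forall x y : F, P x -> P y -> P (x + y)) ->
    (forall (a : C) (w : M), P (a *: (<< w >> : F))) ->
  forall x, P x.
Proof. exact: malg_ind. Qed.

Fact monalg_scalerAr (a : C) (x y : F) : a *: (x * y) = x * (a *: y).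
Proof.
elim/malgF_ind: x => [|u v hu hv|b k]; first by rewrite !mul0r scaler0.
  by rewrite !mulrDl scalerDr hu hv.
elim/malgF_ind: y => [|u v hu hv|c l].
- by rewrite !(mulr0, scaler0).
- by rewrite !(mulrDr, scalerDr) hu hv.
have E e : << k >> * (e *: << l >>) = e *: (<< k >> * << l >>) :> F.
  have -> : e *: << l >> = << e *g l >> :> F.
    by apply/malgP => k'; rewrite mcoeffZ !mcoeffU mulrnAr mulr1.
  rewrite !malgM_def !fgmulUU.
  by apply/malgP => k'; rewrite mcoeffZ !mcoeffU mul1r mulrnAr !mulr1.
by rewrite -!fgscaleAl !scalerA !E !scalerA; congr (_ *: _); rewrite mulrCA mulrA.
Qed.

Definition monalg : pzAlg C :=
  @PzAlg C F 1 *%R (@mulrA F) (@mul1r F) (@mulr1 F)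
    (@mulrDl F) (@mulrDr F) (@fgscaleAl M C) monalg_scalerAr.

Definition monalg_word (w : M) : monalg := << w >> : F.

Lemma monalg_wordM (v w : M) :
  monalg_word v * monalg_word w = monalg_word (mmul v w).
Proof. by apply: etrans (fgmulUU 1 1 v w) _; rewrite mulr1. Qed.

Lemma monalg_ind (P : monalg -> Prop) :
    P 0 -> (forall x y, P x -> P y -> P (x + y)) ->
    (forall a w, P (a *: monalg_word w)) ->
  forall x, P x.
Proof. exact: (@malg_ind C M P). Qed.

Context (deg : M -> nat) (deg1 : deg mone = 0%N).
Hypothesis degM : forall v w, deg (mmul v w) = (deg v + deg w)%N.

Definition monalg_comp (p : nat) : monalg -> monalg :=
  mext idfun (fun w : M => if p == deg w then monalg_word w else 0).

Lemma monalg_compU p w :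
  monalg_comp p (monalg_word w) = if p == deg w then monalg_word w else 0.
Proof. exact: mextU. Qed.

Fact monalg_comp_linear p : linear (monalg_comp p).
Proof. by move=> a x y; apply: mextP. Qed.

Lemma monalg_compD p x y :
  monalg_comp p (x + y) = monalg_comp p x + monalg_comp p y.
Proof. exact: mextD. Qed.
Lemma monalg_comp0 p : monalg_comp p 0 = 0. Proof. exact: mext0. Qed.
Lemma monalg_compZ p a x : monalg_comp p (a *: x) = a *: monalg_comp p x.
Proof. exact: mextZ. Qed.

Fact monalg_compK p q x :
  monalg_comp p (monalg_comp q x) = if p == q then monalg_comp q x else 0.
Proof.
elim/monalg_ind: x => [|u v hu hv|a w].
- by rewrite !monalg_comp0 if_same.
- by rewrite !monalg_compD hu hv; case: ifP => _; rewrite ?addr0.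
rewrite !monalg_compZ monalg_compU (fun_if (monalg_comp p)).
rewrite monalg_comp0 monalg_compU.
case: (eqVneq q (deg w)) => [->|_]; first by case: ifP => _; rewrite ?scaler0.
by rewrite scaler0 if_same.
Qed.

Fact monalg_comp_bound x : exists N, forall m, (N <= m)%N ->
  x = \sum_(p < m) monalg_comp p x.
Proof.
elim/monalg_ind: x => [|u v [N hN] [N' hN']|a w].
- by exists 0%N => m _; rewrite big1 // => i _; rewrite monalg_comp0.
- exists (maxn N N') => m; rewrite geq_max => /andP[h h'].
  rewrite {1}(hN _ h) {1}(hN' _ h') -big_split /=.
  by apply: eq_bigr => i _; rewrite monalg_compD.
exists (deg w).+1 => m hm; rewrite (bigD1 (Ordinal hm)) //= big1 ?addr0.
  by rewrite monalg_compZ monalg_compU eqxx.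
move=> i hi; rewrite monalg_compZ monalg_compU ifF ?scaler0 //.
by apply/negbTE; apply: contra hi => /eqP e; apply/eqP/val_inj.
Qed.
Fact monalg_comp_sum x : exists N, x = \sum_(p < N) monalg_comp p x.
Proof. by have [N h] := monalg_comp_bound x; exists N; apply: h. Qed.

Fact monalg_comp1 : monalg_comp 0 1 = 1.
Proof. by rewrite -[1]/(monalg_word mone) monalg_compU deg1. Qed.

Fact monalg_compM p q x y :
  monalg_comp (p + q) (monalg_comp p x * monalg_comp q y) =
  monalg_comp p x * monalg_comp q y.
Proof.
elim/monalg_ind: x => [|u v hu hv|a w].
- by rewrite monalg_comp0 mul0r monalg_comp0.
- by rewrite monalg_compD mulrDl monalg_compD hu hv.
elim/monalg_ind: y => [|u v hu hv|b z].
- by rewrite monalg_comp0 mulr0 monalg_comp0.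
- by rewrite (monalg_compD q) mulrDr monalg_compD hu hv.
rewrite !monalg_compZ -pzscalerAl -pzscalerAr !monalg_compZ.
do 2!congr (_ *: _).
rewrite !monalg_compU; case: eqP => [->|_]; last by rewrite mul0r monalg_comp0.
case: eqP => [->|_]; last by rewrite mulr0 monalg_comp0.
by rewrite monalg_wordM monalg_compU degM eqxx.
Qed.

Definition gmonalg : gradedAlg C :=
  GradedAlg monalg_comp_linear monalg_compK monalg_comp_sum monalg_comp1
    monalg_compM.

End MonoidAlgebra.

Section FreeAlgebra.
Context (C : comNzRingType) (X : choiceType).

Definition free : pzAlg C := monalg C (fmonom X).
Definition fgen (x : X) : free := monalg_word C (fmu x).

Context (deg : X -> nat).

Definition wdeg (w : seq X) : nat := (\sum_(x <- w) deg x)%N.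

Fact wdeg1 : wdeg (mone : fmonom X) = 0%N.
Proof. by rewrite fm1 /wdeg big_nil. Qed.
Fact wdegM (v w : fmonom X) : wdeg (mmul v w) = (wdeg v + wdeg w)%N.
Proof. by rewrite fmM /wdeg big_cat. Qed.

Definition gfree : gradedAlg C :=
  @gmonalg C (fmonom X) (fun w => wdeg w) wdeg1 wdegM.

End FreeAlgebra.

(* The algebra homomorphism sending each generator x to f x.                  *)
Definition free_eval (C : comNzRingType) (X : choiceType) (A : pzAlg C)
    (f : X -> A) : free C X -> A :=
  mext idfun (fun w : {fmonom X} => \prod_(x <- (w : seq X)) f x).

(* The antiderivation sending each generator x to dx x.                       *)
Fixpoint word_dif (C : comNzRingType) (X : choiceType) (deg : X -> nat)
    (dx : X -> free C X) (w : seq X) : free C X :=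
  if w is x :: v then
    dx x * (\prod_(y <- v) fgen C y)
      + (-1) ^+ deg x *: (fgen C x * word_dif deg dx v)
  else 0.

Definition free_dif (C : comNzRingType) (X : choiceType) (deg : X -> nat)
    (dx : X -> free C X) : free C X -> free C X :=
  mext idfun (fun w : {fmonom X} => word_dif deg dx w).

(* The antilinear graded antimultiplicative map sending each generator x to   *)
(* the generator bx x.                                                        *)
Fixpoint word_bar (C : comNzRingType) (X : choiceType) (deg : X -> nat)
    (bx : X -> X) (w : seq X) : free C X :=
  if w is x :: v then
    (-1) ^+ (deg x * wdeg deg v) *: (word_bar C deg bx v * fgen C (bx x))
  else 1.

Definition free_bar (C : numClosedFieldType) (X : choiceType) (deg : X -> nat)
    (bx : X -> X) : free C X -> free C X :=
  mext Num.conj (fun w : {fmonom X} => word_bar C deg bx w).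

Section Presentation.
Context (C : comNzRingType) (X : choiceType) (deg : X -> nat).
Context (rel : set (gfree C deg)).

Definition pres : gradedAlg C := gquot (gideal_gen rel).
Definition pproj (x : free C X) : pres := qproj (gideal_gen rel) x.
Definition prepr (x : pres) : free C X := @qrepr _ _ (gideal_gen rel) x.
Definition pgen (x : X) : pres := pproj (fgen C x).

(* The homomorphism sending each generator x to f x; it is well defined as    *)
(* soon as the f x satisfy the relations.                                     *)
Definition plift (A : pzAlg C) (f : X -> A) : pres -> A :=
  fun x => free_eval f (prepr x).

End Presentation.

Section Tensor.
Context (C : comNzRingType) (U V : lmodType C).

Local Notation F := {malg C[(U * V)%type]}.

Inductive tens_rel : F -> Prop :=
| TensRelL a u u' v :
    tens_rel (<< (a *: u + u', v) >> - a *: << (u, v) >> - << (u', v) >>)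
| TensRelR a u v v' :
    tens_rel (<< (u, a *: v + v') >> - a *: << (u, v) >> - << (u, v') >>).

Definition tens_span : set F :=
  [set x | forall W : set F, is_submodule W -> tens_rel `<=` W -> W x].

Fact tens_span_sub : is_submodule tens_span.
Proof.
split=> [W [] //|a x y hx hy W hW hr]; have [_ h] := hW.
by apply: h; [apply: hx|apply: hy].
Qed.

Definition tens : Type := qmod (Submodule tens_span_sub).
HB.instance Definition _ := GRing.Lmodule.on tens.

End Tensor.

HB.lock Definition tensor (C : comNzRingType) (U V : lmodType C)
  (u : U) (v : V) : tens U V :=
  qproj (Submodule (tens_span_sub U V)) (<< (u, v) >> : {malg C[(U * V)%type]}).

Notation "u ⊗ v" := (tensor u v) (at level 38, left associativity).

(* The map U ⊗ V -> W induced by a map f : U -> V -> W that is bilinear, if   *)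
(* s is the identity, or antilinear in both arguments, if s is the complex    *)
(* conjugation; see tens_liftP and tens_liftE.                                *)
HB.lock Definition tens_lift (C : comNzRingType) (U V : lmodType C)
    (s : C -> C) (W : lmodType C) (f : U -> V -> W) (x : tens U V) : W :=
  mext s (fun k => f k.1 k.2) (@qrepr _ _ (Submodule (tens_span_sub U V)) x).

Section TensorTheory.
Context (C : comNzRingType) (U V : lmodType C).

Implicit Types (a : C) (u : U) (v : V).

Local Notation W0 := (Submodule (tens_span_sub U V)).

Lemma tens_relE x : @tens_rel C U V x -> qproj W0 x = 0.
Proof. by move=> h; apply/qproj_eq0 => W _; apply. Qed.

Lemma tensorPl a u u' v : (a *: u + u') ⊗ v = a *: (u ⊗ v) + u' ⊗ v.
Proof.
rewrite tensor.unlock; have := tens_relE (TensRelL a u u' v).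
rewrite !(qprojD, qprojN, qprojZ) => /eqP.
by rewrite -addrA -opprD subr_eq0 => /eqP.
Qed.
Lemma tensorPr a u v v' : u ⊗ (a *: v + v') = a *: (u ⊗ v) + u ⊗ v'.
Proof.
rewrite tensor.unlock; have := tens_relE (TensRelR a u v v').
rewrite !(qprojD, qprojN, qprojZ) => /eqP.
by rewrite -addrA -opprD subr_eq0 => /eqP.
Qed.

Lemma tensorDl u u' v : (u + u') ⊗ v = u ⊗ v + u' ⊗ v.
Proof. by rewrite -[u]scale1r tensorPl !scale1r. Qed.
Lemma tensorDr u v v' : u ⊗ (v + v') = u ⊗ v + u ⊗ v'.
Proof. by rewrite -[v]scale1r tensorPr !scale1r. Qed.
Lemma tensor0l v : (0 : U) ⊗ v = 0.
Proof. by apply: (addrI ((0 : U) ⊗ v)); rewrite -tensorDl !addr0. Qed.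
Lemma tensor0r u : u ⊗ (0 : V) = 0.
Proof. by apply: (addrI (u ⊗ (0 : V))); rewrite -tensorDr !addr0. Qed.
Lemma tensorZl a u v : (a *: u) ⊗ v = a *: (u ⊗ v).
Proof. by rewrite -[_ *: u]addr0 tensorPl tensor0l addr0. Qed.
Lemma tensorZr a u v : u ⊗ (a *: v) = a *: (u ⊗ v).
Proof. by rewrite -[_ *: v]addr0 tensorPr tensor0r addr0. Qed.

Lemma tens_ind (P : tens U V -> Prop) :
    P 0 -> (forall x y, P x -> P y -> P (x + y)) -> (forall u v, P (u ⊗ v)) ->
  forall x, P x.
Proof.
move=> P0 PD Pt x; rewrite -[x]qreprK; elim/malg_ind: (qrepr x).
- by rewrite qproj0.
- by move=> y z hy hz; rewrite qprojD; apply: PD.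
move=> a [u v]; have -> : qproj W0 (a *: << (u, v) >>) = (a *: u) ⊗ v.
  by rewrite tensorZl tensor.unlock qprojZ.
exact: Pt.
Qed.

Section Lift.
Context (s : {rmorphism C -> C}) (W : lmodType C) (f : U -> V -> W).
Hypothesis fl : forall a u u' v, f (a *: u + u') v = s a *: f u v + f u' v.
Hypothesis fr : forall a u v v', f u (a *: v + v') = s a *: f u v + f u v'.

Lemma tens_lift_proj x :
  tens_lift s f (qproj W0 x) =
  mext s (fun k => f k.1 k.2) x.
Proof.
rewrite tens_lift.unlock; set g := mext _ _.
have gP a y z : g (a *: y + z) = s a *: g y + g z by apply: mextP.
have gB y z : g (y - z) = g y - g z.
  by rewrite [y - z]addrC -[- z]scaleN1r gP rmorphN1 scaleN1r addrC.
have gZ a y : g (a *: y) = s a *: g y by apply: mextZ.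
apply/eqP; rewrite -subr_eq0 -gB; apply/eqP.
apply: (@qrepr_proj _ _ W0 x [set y | g y = 0]).
  split; first exact: mext0.
  by move=> a y z /= gy gz; rewrite gP gy gz scaler0 addr0.
move=> _ /= [] *; rewrite !gB gZ /g !mextU /=.
  by rewrite fl -addrA -opprD subrr.
by rewrite fr -addrA -opprD subrr.
Qed.

Lemma tens_liftE u v : tens_lift s f (u ⊗ v) = f u v.
Proof. by rewrite tensor.unlock tens_lift_proj mextU. Qed.

Lemma tens_liftP a x y :
  tens_lift s f (a *: x + y) = s a *: tens_lift s f x + tens_lift s f y.
Proof.
rewrite -[x]qreprK -[y]qreprK -qprojZ -qprojD !tens_lift_proj.
by rewrite mextP.
Qed.

Lemma tens_liftD x y :
  tens_lift s f (x + y) = tens_lift s f x + tens_lift s f y.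
Proof. by rewrite -[x]scale1r tens_liftP rmorph1 !scale1r. Qed.
Lemma tens_lift0 : tens_lift s f 0 = 0.
Proof. by apply: (addrI (tens_lift s f 0)); rewrite -tens_liftD !addr0. Qed.
Lemma tens_liftZ a x : tens_lift s f (a *: x) = s a *: tens_lift s f x.
Proof. by rewrite -[_ *: x]addr0 tens_liftP tens_lift0 addr0. Qed.

End Lift.

End TensorTheory.

(* (a ⊗ b)(c ⊗ d) = (-1)^(|b||c|) ac ⊗ bd, extended to sums of homogeneous    *)
(* elements (the sums over the degrees q of b and p of c are finite).         *)
Definition tmul1 (C : comNzRingType) (A B : gradedAlg C) (a : A) (b : B)
    (c : A) (d : B) : tens A B :=
  \sum_(q \in [set: nat]) \sum_(p \in [set: nat])
    (-1) ^+ (q * p) *: ((a * gcomp p c) ⊗ (gcomp q b * d)).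

HB.lock Definition tmul (C : comNzRingType) (A B : gradedAlg C)
    (x y : tens A B) : tens A B :=
  tens_lift idfun (fun a b => tens_lift idfun (tmul1 a b) y) x.

Section GradedTensor.
Context (C : comNzRingType) (A B : gradedAlg C).
Implicit Types (a c : A) (b d : B) (x y z : tens A B).

Local Notation tmul := (@tmul C A B).

Lemma tmul1_ord a b c d N :
    (forall q, (N <= q)%N -> gcomp q b = 0) ->
    (forall p, (N <= p)%N -> gcomp p c = 0) ->
  tmul1 a b c d = \sum_(q < N) \sum_(p < N)
    (-1) ^+ (q * p) *: ((a * gcomp p c) ⊗ (gcomp q b * d)).
Proof.
move=> hb hc; rewrite /tmul1.
rewrite (@fsum_ord _ (fun q => \sum_(p \in [set: nat]) _) N).
  apply: eq_bigr => q _; apply: (@fsum_ord _ (fun p => _)) => p /hc ->.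
  by rewrite mulr0 tensor0l scaler0.
move=> q /hb ->; apply: fsbig1 => p _.
by rewrite mul0r tensor0r scaler0.
Qed.

Lemma bound2 b b' c c' : exists N,
  [/\ forall q, (N <= q)%N -> gcomp q b = 0,
      forall q, (N <= q)%N -> gcomp q b' = 0,
      forall p, (N <= p)%N -> gcomp p c = 0 &
      forall p, (N <= p)%N -> gcomp p c' = 0].
Proof.
have [N1 h1] := gcomp_bound b; have [N2 h2] := gcomp_bound b'.
have [N3 h3] := gcomp_bound c; have [N4 h4] := gcomp_bound c'.
exists (maxn (maxn N1 N2) (maxn N3 N4)).
by split=> q; rewrite !geq_max => /andP[/andP[? ?] /andP[? ?]];
  [apply: h1|apply: h2|apply: h3|apply: h4].
Qed.

Lemma tmul1_a s a a' b c d :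
  tmul1 (s *: a + a') b c d = s *: tmul1 a b c d + tmul1 a' b c d.
Proof.
have [N [hb _ hc _]] := bound2 b b c c; rewrite !(@tmul1_ord _ b c d N) //.
rewrite scaler_sumr -big_split; apply: eq_bigr => q _ /=.
rewrite scaler_sumr -big_split; apply: eq_bigr => p _ /=.
by rewrite mulrDl -pzscalerAl tensorPl scalerDr !scalerA mulrC.
Qed.

Lemma tmul1_b s a b b' c d :
  tmul1 a (s *: b + b') c d = s *: tmul1 a b c d + tmul1 a b' c d.
Proof.
have [N [hb hb' hc _]] := bound2 b b' c c.
rewrite !(@tmul1_ord _ _ c d N) //; last first.
  by move=> q Nq; rewrite gcompZD hb // hb' // scaler0 addr0.
rewrite scaler_sumr -big_split; apply: eq_bigr => q _ /=.
rewrite scaler_sumr -big_split; apply: eq_bigr => p _ /=.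
by rewrite gcompZD mulrDl -pzscalerAl tensorPr scalerDr !scalerA mulrC.
Qed.

Lemma tmul1_c s a b c c' d :
  tmul1 a b (s *: c + c') d = s *: tmul1 a b c d + tmul1 a b c' d.
Proof.
have [N [hb _ hc hc']] := bound2 b b c c'.
rewrite !(@tmul1_ord _ b _ d N) //; last first.
  by move=> q Nq; rewrite gcompZD hc // hc' // scaler0 addr0.
rewrite scaler_sumr -big_split; apply: eq_bigr => q _ /=.
rewrite scaler_sumr -big_split; apply: eq_bigr => p _ /=.
by rewrite gcompZD mulrDr -pzscalerAr tensorPl scalerDr !scalerA mulrC.
Qed.

Lemma tmul1_d s a b c d d' :
  tmul1 a b c (s *: d + d') = s *: tmul1 a b c d + tmul1 a b c d'.
Proof.
have [N [hb _ hc _]] := bound2 b b c c; rewrite !(@tmul1_ord _ b c _ N) //.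
rewrite scaler_sumr -big_split; apply: eq_bigr => q _ /=.
rewrite scaler_sumr -big_split; apply: eq_bigr => p _ /=.
by rewrite mulrDr -pzscalerAr tensorPr scalerDr !scalerA mulrC.
Qed.

Let tmul2 a b y := tens_lift idfun (tmul1 a b) y.

Let tmul2P a b s y z : tmul2 a b (s *: y + z) = s *: tmul2 a b y + tmul2 a b z.
Proof.
by apply: (tens_liftP (s := idfun)) => *; [apply: tmul1_c|apply: tmul1_d].
Qed.
Let tmul2D a b y z : tmul2 a b (y + z) = tmul2 a b y + tmul2 a b z.
Proof. by rewrite -[y]scale1r tmul2P !scale1r. Qed.
Let tmul20 a b : tmul2 a b 0 = 0.
Proof. by apply: (addrI (tmul2 a b 0)); rewrite -tmul2D !addr0. Qed.

Let tmul2E a b c d : tmul2 a b (c ⊗ d) = tmul1 a b c d.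
Proof.
by apply: (tens_liftE (s := idfun)) => *; [apply: tmul1_c|apply: tmul1_d].
Qed.

Let tmul2_a s a a' b y : tmul2 (s *: a + a') b y = s *: tmul2 a b y + tmul2 a' b y.
Proof.
elim/tens_ind: y => [|y z hy hz|c d]; first by rewrite !tmul20 scaler0 addr0.
  by rewrite !tmul2D hy hz scalerDr addrACA.
by rewrite !tmul2E tmul1_a.
Qed.
Let tmul2_b s a b b' y : tmul2 a (s *: b + b') y = s *: tmul2 a b y + tmul2 a b' y.
Proof.
elim/tens_ind: y => [|y z hy hz|c d]; first by rewrite !tmul20 scaler0 addr0.
  by rewrite !tmul2D hy hz scalerDr addrACA.
by rewrite !tmul2E tmul1_b.
Qed.

Lemma tmulPl s x y z : tmul (s *: x + y) z = s *: tmul x z + tmul y z.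
Proof.
rewrite tmul.unlock.
by apply: (tens_liftP (s := idfun)) => *; [apply: tmul2_a|apply: tmul2_b].
Qed.

Let tmul_tl a b y : tmul (a ⊗ b) y = tmul2 a b y.
Proof.
rewrite tmul.unlock.
by apply: (tens_liftE (s := idfun)) => *; [apply: tmul2_a|apply: tmul2_b].
Qed.

Fact tmulDl : left_distributive tmul +%R.
Proof. by move=> x y z; rewrite -[x]scale1r tmulPl !scale1r. Qed.
Let tmul0t y : tmul 0 y = 0.
Proof. by apply: (addrI (tmul 0 y)); rewrite -tmulDl !addr0. Qed.
Fact tmulZl (s : C) x y : s *: tmul x y = tmul (s *: x) y.
Proof. by rewrite -[s *: x]addr0 tmulPl tmul0t addr0. Qed.

Lemma tmulPr s x y z : tmul z (s *: x + y) = s *: tmul z x + tmul z y.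
Proof.
elim/tens_ind: z => [|z z' hz hz'|a b]; first by rewrite !tmul0t scaler0 addr0.
  by rewrite !tmulDl hz hz' scalerDr addrACA.
by rewrite !tmul_tl tmul2P.
Qed.
Fact tmulDr : right_distributive tmul +%R.
Proof. by move=> z x y; rewrite -[x]scale1r tmulPr !scale1r. Qed.
Let tmult0 y : tmul y 0 = 0.
Proof. by apply: (addrI (tmul y 0)); rewrite -tmulDr !addr0. Qed.
Fact tmulZr (s : C) x y : s *: tmul x y = tmul x (s *: y).
Proof. by rewrite -[s *: y]addr0 tmulPr tmult0 addr0. Qed.

Lemma tmulE a b c d p q : homog q b -> homog p c ->
  tmul (a ⊗ b) (c ⊗ d) = (-1) ^+ (q * p) *: ((a * c) ⊗ (b * d)).
Proof.
move=> hb hc; rewrite tmul_tl tmul2E /tmul1 (fsum_delta (N := q)).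
  rewrite (fsum_delta (N := p)); first by rewrite hb hc.
  move=> i ip; rewrite (homogE _ hc) (negbTE ip).
  by rewrite mulr0 tensor0l scaler0.
move=> i iq; apply: fsbig1 => j _; rewrite (homogE _ hb) (negbTE iq).
by rewrite mul0r tensor0r scaler0.
Qed.

Lemma tens_hind (P : tens A B -> Prop) :
    P 0 -> (forall x y, P x -> P y -> P (x + y)) ->
    (forall p q a b, homog p a -> homog q b -> P (a ⊗ b)) ->
  forall x, P x.
Proof.
move=> P0 PD Ph; apply: tens_ind => // a b.
elim/gcomp_ind: a => [|a a' ha ha'|p a ha]; first by rewrite tensor0l.
  by rewrite tensorDl; apply: PD.
elim/gcomp_ind: b => [|b b' hb hb'|q b hb]; first by rewrite tensor0r.
  by rewrite tensorDr; apply: PD.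
exact: Ph ha hb.
Qed.

Fact tmulA : associative tmul.
Proof.
move=> x y z.
elim/tens_hind: x => [|x x' h h'|p1 q1 a1 b1 ha1 hb1].
- by rewrite !tmul0t.
- by rewrite !tmulDl h h'.
elim/tens_hind: y => [|y y' h h'|p2 q2 a2 b2 ha2 hb2].
- by rewrite !(tmul0t, tmult0).
- by rewrite !(tmulDl, tmulDr) h h'.
elim/tens_hind: z => [|z z' h h'|p3 q3 a3 b3 ha3 hb3].
- by rewrite !tmult0.
- by rewrite !tmulDr h h'.
rewrite (tmulE _ _ hb2 ha3) (tmulE _ _ hb1 ha2) -tmulZl -tmulZr.
rewrite (tmulE _ _ hb1 (homogM ha2 ha3)) (tmulE _ _ (homogM hb1 hb2) ha3).
rewrite !scalerA -!exprD !mulrA; congr (_ ^+ _ *: _).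
by rewrite mulnDr mulnDl addnCA [(q2 * p3 + _)%N]addnC.
Qed.

Let homog1 (D : gradedAlg C) : homog 0 (1 : D).
Proof. exact: gcomp1. Qed.

Fact tmul1t : left_id ((1 : A) ⊗ (1 : B)) tmul.
Proof.
move=> x; elim/tens_hind: x => [|x y hx hy|p q a b ha hb].
- exact: tmult0.
- by rewrite tmulDr hx hy.
by rewrite (tmulE _ _ (homog1 B) ha) scale1r !mul1r.
Qed.
Fact tmult1 : right_id ((1 : A) ⊗ (1 : B)) tmul.
Proof.
move=> x; elim/tens_hind: x => [|x y hx hy|p q a b ha hb].
- exact: tmul0t.
- by rewrite tmulDl hx hy.
by rewrite (tmulE _ _ hb (homog1 A)) muln0 scale1r !mulr1.
Qed.

Definition tens_alg : pzAlg C :=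
  PzAlg tmulA tmul1t tmult1 tmulDl tmulDr tmulZl tmulZr.

Definition tcomp (n : nat) : tens_alg -> tens_alg :=
  tens_lift idfun (fun a b => \sum_(p < n.+1) gcomp p a ⊗ gcomp (n - p) b).

Let tcomp_l n s a a' b :
  \sum_(p < n.+1) gcomp p (s *: a + a') ⊗ gcomp (n - p) b =
  s *: (\sum_(p < n.+1) gcomp p a ⊗ gcomp (n - p) b)
  + \sum_(p < n.+1) gcomp p a' ⊗ gcomp (n - p) b.
Proof.
rewrite scaler_sumr -big_split; apply: eq_bigr => p _ /=.
by rewrite gcompZD tensorPl.
Qed.
Let tcomp_r n s a b b' :
  \sum_(p < n.+1) gcomp p a ⊗ gcomp (n - p) (s *: b + b') =
  s *: (\sum_(p < n.+1) gcomp p a ⊗ gcomp (n - p) b)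
  + \sum_(p < n.+1) gcomp p a ⊗ gcomp (n - p) b'.
Proof.
rewrite scaler_sumr -big_split; apply: eq_bigr => p _ /=.
by rewrite gcompZD tensorPr.
Qed.

Fact tcomp_linear n : linear (tcomp n).
Proof.
move=> s x y.
by apply: (tens_liftP (s := idfun)) => *; [apply: tcomp_l|apply: tcomp_r].
Qed.

Let tcompD n x y : tcomp n (x + y) = tcomp n x + tcomp n y.
Proof. by rewrite -[x]scale1r; apply: etrans (tcomp_linear n 1 x y) _; rewrite !scale1r. Qed.
Let tcomp0 n : tcomp n 0 = 0.
Proof. by apply: (addrI (tcomp n 0)); rewrite -tcompD !addr0. Qed.
Let tcompZ n s x : tcomp n (s *: x) = s *: tcomp n x.
Proof. by rewrite -[s *: x]addr0; apply: etrans (tcomp_linear n s x 0) _; rewrite tcomp0 addr0. Qed.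

Lemma tcompE n p q a b : homog p a -> homog q b ->
  tcomp n (a ⊗ b) = if n == (p + q)%N then a ⊗ b else 0.
Proof.
move=> ha hb.
have -> : tcomp n (a ⊗ b) = \sum_(p < n.+1) gcomp p a ⊗ gcomp (n - p) b.
  by apply: (tens_liftE (s := idfun)) => *; [apply: tcomp_l|apply: tcomp_r].
have [->|npq] := eqVneq n (p + q)%N.
  have hp : (p < (p + q).+1)%N by rewrite ltnS leq_addr.
  rewrite (bigD1 (Ordinal hp)) //= ha addKn hb big1 ?addr0 // => i ip.
  rewrite (homogE _ ha) ifF ?tensor0l //.
  by apply/negbTE; apply: contra ip => /eqP e; apply/eqP/val_inj.
apply: big1 => i _; rewrite (homogE _ ha) (homogE _ hb).
case: eqP => [ip|_]; last by rewrite tensor0l.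
case: eqP => [iq|_]; last by rewrite tensor0r.
by case/eqP: npq; rewrite -iq -ip subnKC // -ltnS.
Qed.

Fact tcompK m n x : tcomp m (tcomp n x) = if m == n then tcomp n x else 0.
Proof.
elim/tens_hind: x => [|x y hx hy|p q a b ha hb].
- by rewrite !tcomp0 if_same.
- by rewrite !tcompD hx hy; case: ifP => _; rewrite ?addr0.
rewrite (tcompE n ha hb) (fun_if (tcomp m)) tcomp0 (tcompE m ha hb).
have [->|_] := eqVneq n (p + q)%N; last by rewrite if_same.
by [].
Qed.

Fact tcomp_sum x : exists N, x = \sum_(n < N) tcomp n x.
Proof.
suff [N h] : exists N, forall m, (N <= m)%N -> x = \sum_(n < m) tcomp n x.
  by exists N; apply: h.
elim/tens_hind: x => [|u v [N hN] [N' hN']|p q a b ha hb].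
- by exists 0%N => m _; rewrite big1 // => i _; rewrite tcomp0.
- exists (maxn N N') => m; rewrite geq_max => /andP[h h'].
  rewrite {1}(hN _ h) {1}(hN' _ h') -big_split /=.
  by apply: eq_bigr => i _; rewrite tcompD.
exists (p + q).+1 => m hm; rewrite (bigD1 (Ordinal hm)) //= big1 ?addr0.
  by rewrite (tcompE _ ha hb) eqxx.
move=> i hi; rewrite (tcompE _ ha hb) ifF //.
by apply/negbTE; apply: contra hi => /eqP e; apply/eqP/val_inj.
Qed.

Fact tcomp1 : tcomp 0 1 = 1.
Proof. exact: (tcompE 0 (homog1 A) (homog1 B)). Qed.

Fact tcompM m n (x y : tens_alg) :
  tcomp (m + n) (tcomp m x * tcomp n y) = tcomp m x * tcomp n y.
Proof.
change (tcomp (m + n) (tmul (tcomp m x) (tcomp n y))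
  = tmul (tcomp m x) (tcomp n y)).
elim/tens_hind: x => [|u v hu hv|p q a b ha hb].
- by rewrite tcomp0 tmul0t tcomp0.
- by rewrite (tcompD m) tmulDl tcompD hu hv.
elim/tens_hind: y => [|u v hu hv|p' q' a' b' ha' hb'].
- by rewrite tcomp0 tmult0 tcomp0.
- by rewrite (tcompD n) tmulDr tcompD hu hv.
rewrite (tcompE m ha hb) (tcompE n ha' hb').
case: eqP => [->|_]; last by rewrite tmul0t tcomp0.
case: eqP => [->|_]; last by rewrite tmult0 tcomp0.
rewrite (tmulE _ _ hb ha') tcompZ (tcompE _ (homogM ha ha') (homogM hb hb')).
by rewrite addnACA eqxx.
Qed.

Definition gtens : gradedAlg C :=
  GradedAlg tcomp_linear tcompK tcomp_sum tcomp1 tcompM.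

End GradedTensor.

Record gida_data (C : numClosedFieldType) := GidaData {
  gida_alg :> gradedAlg C;
  gbar : gida_alg -> gida_alg;
  gdif : gida_alg -> gida_alg }.

Record is_gida (C : numClosedFieldType) (A : gida_data C) : Prop := {
  gbar_antilinear : forall (s : C) (x y : A),
    gbar (s *: x + y) = s^* *: gbar x + gbar y;
  gbarK : involutive (@gbar C A);
  gbar_homog : forall p (x : A), homog p x -> homog p (gbar x);
  gbarM : forall p q (x y : A), homog p x -> homog q y ->
    gbar (x * y) = (-1) ^+ (p * q) *: (gbar y * gbar x);
  gdif_linear : linear (@gdif C A);
  gdif_homog : forall p (x : A), homog p x -> homog p.+1 (gdif x);
  gdifM : forall p (x y : A), homog p x ->
    gdif (x * y) = gdif x * y + (-1) ^+ p *: (x * gdif y);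
  gdif2 : forall x : A, gdif (gdif x) = 0;
  gdif_bar : forall x : A, gdif (gbar x) = gbar (gdif x) }.

Record is_gida_hom (C : numClosedFieldType) (A B : gida_data C) (f : A -> B) :
    Prop := {
  gida_hom_linear : linear f;
  gida_hom_mul : monoid_morphism f;
  gida_hom_homog : forall p x, homog p x -> homog p (f x);
  gida_hom_bar : {morph f : x / gbar x};
  gida_hom_dif : {morph f : x / gdif x} }.

Definition gida_tens (C : numClosedFieldType) (A B : gida_data C) :
    gida_data C :=
  @GidaData C (gtens A B)
    (tens_lift Num.conj (fun a b => gbar a ⊗ gbar b))
    (tens_lift idfun (fun a b => gdif a ⊗ b + gsign a ⊗ gdif b)).

(* f ⊗ g, for linear f and g.                                                 *)
Definition tens_map (C : comNzRingType) (U V U' V' : lmodType C)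
    (f : U -> U') (g : V -> V') : tens U V -> tens U' V' :=
  tens_lift idfun (fun u v => f u ⊗ g v).

Definition tens_assoc (C : comNzRingType) (U V W : lmodType C) :
    tens (tens U V) W -> tens U (tens V W) :=
  tens_lift idfun (fun uv w => tens_lift idfun (fun u v => u ⊗ (v ⊗ w)) uv).

Record gid_hopf (C : numClosedFieldType) (A : gida_data C) := GidHopf {
  hopf_gida : is_gida A;
  comul : A -> gida_tens A A;
  comul_hom : is_gida_hom comul;
  comulA : forall x,
    tens_assoc (tens_map comul id (comul x)) = tens_map id comul (comul x);
  counit : A -> C;
  counit_linear : scalar counit;
  counit_mul : monoid_morphism counit;
  counit_bar : forall x, counit (gbar x) = (counit x)^*;
  counit_dif : forall x, counit (gdif x) = 0;
  counitl : forall x, tens_lift idfun (fun a b : A => counit a *: b) (comul x) = x;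
  counitr : forall x, tens_lift idfun (fun a b : A => counit b *: a) (comul x) = x;
  antipode : A -> A;
  antipode_linear : linear antipode;
  antipodel : forall x,
    tens_lift idfun (fun a b : A => antipode a * b) (comul x) = counit x *: (1 : A);
  antipoder : forall x,
    tens_lift idfun (fun a b : A => a * antipode b) (comul x) = counit x *: (1 : A) }.

Record gid_comodule (C : numClosedFieldType) (A : gida_data C) (H : gid_hopf A)
    (M : gida_data C) := GidComodule {
  comod_gida : is_gida M;
  coaction : M -> gida_tens A M;
  coaction_hom : is_gida_hom coaction;
  coactionA : forall x,
    tens_assoc (tens_map (comul H) id (coaction x)) =
    tens_map id coaction (coaction x);
  coaction_counit : forall x,
    tens_lift idfun (fun (a : A) (m : M) => counit H a *: m) (coaction x) = x }.

(* The structure induced on the quotient by a graded ideal that is stable     *)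
(* under the involution and the differential.                                 *)
Definition gida_quot (C : numClosedFieldType) (A : gida_data C) (J : gideal A) :
    gida_data C :=
  @GidaData C (gquot J) (qmap J (@gbar C A)) (qmap J (@gdif C A)).

(* The graded algebra with generators x : X of degree deg x and relations     *)
(* rel, with the involution x |-> bx x and the differential x |-> dx x.       *)
Definition gida_pres (C : numClosedFieldType) (X : choiceType) (deg : X -> nat)
    (rel : set (gfree C deg)) (bx : X -> X) (dx : X -> free C X) :
    gida_data C :=
  gida_quot (A := @GidaData C (gfree C deg) (free_bar deg bx) (free_dif deg dx))
    (gideal_gen rel).

(* The index set I_m for m = 2n + b: the indices mu, \bar mu and 0 are        *)
(* inl (inl mu), inl (inr mu) and inr ord0.                                   *)
Definition idx (n : nat) (b : bool) : finType := ('I_n + 'I_n + 'I_b)%type.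

Definition ix (n : nat) (b : bool) (mu : 'I_n) : idx n b := inl (inl mu).
Definition ixb (n : nat) (b : bool) (mu : 'I_n) : idx n b := inl (inr mu).

Definition ibar (n : nat) (b : bool) (i : idx n b) : idx n b :=
  match i with
  | inl (inl mu) => inl (inr mu)
  | inl (inr mu) => inl (inl mu)
  | inr o => inr o
  end.

Section ThetaDeformation.
Context (R : realType) (n : nat) (theta : 'M[R]_n) (b : bool).

Local Notation C := (R[i]).
Local Notation I := (idx n b).

(* lambda^{mu nu} = exp (i theta_{mu nu})                                     *)
Definition lam (mu nu : 'I_n) : C :=
  (cos (theta mu nu) +i* sin (theta mu nu))%C.

Definition Lam (i j : I) : C :=
  match i, j with
  | inl (inl mu), inl (inl nu) | inl (inr mu), inl (inr nu) => lam mu nu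
  | inl (inl mu), inl (inr nu) | inl (inr mu), inl (inl nu) => lam nu mu
  | _, _ => 1
  end.

(* Omega_alg(R^m_theta): xi^i is the generator (false, i), d xi^i the         *)
(* generator (true, i).                                                       *)
Definition degR (x : bool * I) : nat := x.1.

Local Notation fR := (free C (bool * I)%type).
Definition fxi (i : I) : fR := fgen C (false, i).
Definition fdxi (i : I) : fR := fgen C (true, i).

Inductive relR : fR -> Prop :=
| RelR00 i j : relR (fxi i * fxi j - Lam i j *: (fxi j * fxi i))
| RelR01 i j : relR (fxi i * fdxi j - Lam i j *: (fdxi j * fxi i))
| RelR11 i j : relR (fdxi i * fdxi j + Lam i j *: (fdxi j * fdxi i)).

Definition Omega_R : gida_data C :=
  gida_pres (deg := degR) relR (fun x => (x.1, ibar x.2))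
    (fun x => if x.1 then 0 else fdxi x.2).

Definition genR (x : bool * I) : Omega_R := pgen (deg := degR) relR x.
Definition xi (i : I) : Omega_R := genR (false, i).
Definition dxi (i : I) : Omega_R := genR (true, i).

(* The homomorphism xi^i |-> sum_j t^i_j ⊗ xi^j,                              *)
(* d xi^i |-> sum_j t^i_j ⊗ d xi^j.                                           *)
Definition delta0 (A : gradedAlg C) (t : I -> I -> A) :
    Omega_R -> gtens A Omega_R :=
  plift (rel := relR)
    (fun x => \sum_(j : I) (t x.2 j ⊗ genR (x.1, j) : gtens A Omega_R)).

(* M_theta(m, R): t^i_j is the generator (i, j).                              *)
Definition commM (i j k l : I) : C := Lam i k * Lam l j.

Local Notation fM := (free C (I * I)%type).
Definition fMt (i j : I) : fM := fgen C (i, j).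

Inductive relM : fM -> Prop :=
| RelM i j k l :
    relM (fMt i j * fMt k l - commM i j k l *: (fMt k l * fMt i j)).

Definition M_theta : gradedAlg C := pres (deg := fun _ : I * I => 0%N) relM.
Definition tM (i j : I) : M_theta := pgen (deg := fun=> 0%N) relM (i, j).

Definition Omega0 : Omega_R :=
  (\prod_(mu < n) (dxi (ixb b mu) * dxi (ix b mu)))
  * \prod_(o < b) dxi (inr o).

(* The element det_theta such that delta0 Omega0 = det_theta ⊗ Omega0.        *)
Definition det_theta : M_theta :=
  xget 0 [set D : M_theta | delta0 tM Omega0 = D ⊗ Omega0].

(* C_alg(GL_theta(m, R)): t^i_j is the generator Some (i, j), and the         *)
(* inverse of det_theta is the generator None.                                *)
Local Notation fGL := (free C (option (I * I))).
Definition fGLt (i j : I) : fGL := fgen C (Some (i, j)).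
Definition fGLdetV : fGL := fgen C None.
Definition fGLdet : fGL :=
  free_eval (fun x : I * I => fGLt x.1 x.2)
    (prepr (det_theta : pres (deg := fun=> 0%N) relM)).

Inductive relGL : fGL -> Prop :=
| RelGLt i j k l :
    relGL (fGLt i j * fGLt k l - commM i j k l *: (fGLt k l * fGLt i j))
| RelGLdetV : relGL (fGLdet * fGLdetV - 1)
| RelGLcentral i j : relGL (fGLdetV * fGLt i j - fGLt i j * fGLdetV).

Definition C_GL : gradedAlg C :=
  pres (deg := fun _ : option (I * I) => 0%N) relGL.
Definition genGL (x : option (I * I)) : C_GL := pgen (deg := fun=> 0%N) relGL x.
Definition tGL (i j : I) : C_GL := genGL (Some (i, j)).
Definition detGL : C_GL := plift (fun x => tGL x.1 x.2) det_theta.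

(* Omega_alg(GL_theta(m, R)): t^i_j is the generator Some (false, i, j),      *)
(* d t^i_j the generator Some (true, i, j), and the inverse of det_theta the  *)
(* generator None.                                                            *)
Definition degGL (x : option (bool * I * I)) : nat :=
  if x is Some (e, _, _) then e else 0%N.

Local Notation fOmega := (free C (option (bool * I * I))).
Definition ft (i j : I) : fOmega := fgen C (Some (false, i, j)).
Definition fdt (i j : I) : fOmega := fgen C (Some (true, i, j)).
Definition fdetV : fOmega := fgen C None.
Definition fdet : fOmega :=
  free_eval (fun x : I * I => ft x.1 x.2)
    (prepr (det_theta : pres (deg := fun=> 0%N) relM)).

Inductive relOmega : fOmega -> Prop :=
| RelOmega00 i j k l :
    relOmega (ft i j * ft k l - commM i j k l *: (ft k l * ft i j))
| RelOmega01 i j k l :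
    relOmega (ft i j * fdt k l - commM i j k l *: (fdt k l * ft i j))
| RelOmega11 i j k l :
    relOmega (fdt i j * fdt k l + commM i j k l *: (fdt k l * fdt i j))
| RelOmegaDetV : relOmega (fdet * fdetV - 1)
| RelOmegaCentral x : relOmega (fdetV * fgen C x - fgen C x * fdetV).

Definition barOmega (x : option (bool * I * I)) : option (bool * I * I) :=
  if x is Some (e, i, j) then Some (e, ibar i, ibar j) else None.

Definition difOmega_t (x : option (bool * I * I)) : fOmega :=
  if x is Some (false, i, j) then fdt i j else 0.

(* d (det^-1) = - (det^-1)^2 d (det); no det^-1 occurs in fdet.               *)
Definition difOmega (x : option (bool * I * I)) : fOmega :=
  if x is None then - (fdetV ^+ 2 * free_dif degGL difOmega_t fdet)
  else difOmega_t x.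

Definition Omega_GL : gida_data C :=
  gida_pres (deg := degGL) relOmega barOmega difOmega.

Definition genOmega (x : option (bool * I * I)) : Omega_GL :=
  pgen (deg := degGL) relOmega x.

(* The inclusion of C_alg(GL_theta(m, R)) in Omega_alg(GL_theta(m, R)).       *)
Definition incl_GL : C_GL -> Omega_GL :=
  plift (rel := relGL)
    (fun x => genOmega (omap (fun ij => (false, ij.1, ij.2)) x)).

End ThetaDeformation.

Inductive qgroup : bool -> Type :=
| GL_R b : qgroup b
| SL_R b : qgroup b
| O_R b : qgroup b
| SO_R b : qgroup b
| GL_C : qgroup false
| GL1_C : qgroup false
| U_C : qgroup false.

Section QuantumGroups.
Context (R : realType) (n : nat) (theta : 'M[R]_n) (b : bool) (G : qgroup b).

Local Notation C := (R[i]).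
Local Notation I := (idx n b).

Definition rel_det : set (C_GL theta b) := [set detGL theta b - 1].

Definition Q_R : Omega_R theta b :=
  \sum_(mu < n) xi theta (ixb b mu) * xi theta (ix b mu)
  + \sum_(o < b) xi theta (inr o : I) ^+ 2.

(* The relations expressing that delta0 Q = 1 ⊗ Q: the coefficients           *)
(* (I ⊗ phi)(delta0 Q - 1 ⊗ Q), phi a linear form.                            *)
Definition rel_Q : set (C_GL theta b) :=
  [set a | exists2 phi : Omega_R theta b -> C, scalar phi &
     a = tens_lift idfun (fun c w => phi w *: c)
           (delta0 (@tGL R n theta b) Q_R - (1 : C_GL theta b) ⊗ Q_R)].

(* b^mu_nu = t^mu_(\bar nu) and \bar b^mu_nu = t^(\bar mu)_nu.                *)
Definition rel_b : set (C_GL theta b) :=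
  [set a | exists mu nu, a = tGL theta (ix b mu) (ixb b nu) \/
                         a = tGL theta (ixb b mu) (ix b nu)].

Definition rel_group : set (C_GL theta b) :=
  match G with
  | GL_R _ => set0
  | SL_R _ => rel_det
  | O_R _ => rel_Q
  | SO_R _ => rel_Q `|` rel_det
  | GL_C => rel_b
  | GL1_C => rel_b `|` rel_det
  | U_C => rel_Q `|` rel_b
  end.

(* C_GL is concentrated in degree 0, so the graded two-sided ideals of C_GL   *)
(* are its two-sided ideals.                                                  *)
Definition C_alg : gradedAlg C := gquot (gideal_gen rel_group).
Definition I_group : set (C_GL theta b) :=
  [set a | (qproj (gideal_gen rel_group) a : C_alg) = 0].

Definition Omega_ideal : gideal (Omega_GL theta b) :=
  closed_gideal_gen (@gdif _ (Omega_GL theta b))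
    (@incl_GL _ _ theta b @` I_group).

Definition Omega_alg : gida_data C := gida_quot Omega_ideal.

(* The classes [t^i_j] and [det_theta^-1].                                    *)
Definition tG (i j : I) : Omega_alg :=
  qproj Omega_ideal (genOmega theta (Some (false, i, j))).
Definition detVG : Omega_alg := qproj Omega_ideal (genOmega theta None).

End QuantumGroups.

(* Main.v *)
(* The differential algebra of each of these quantum groups is universal among  *)
(* the differential graded algebras with a matrix T in degree 0 such that T and *)
(* dT commute up to the weights Lambda, det T has a central inverse, and T      *)
(* satisfies the relations of the group. These conditions pass from T to the    *)
(* product sum_k T^i_k ⊗ T^k_j in the tensor square, to the unit matrix over C, *)
(* and to the inverse of T in the opposite algebra; universality then yields    *)
(* the coproduct, the counit and the antipode, and the Hopf axioms need only be *)
(* checked on the generators. The coaction on the quantum space is obtained in  *)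
(* the same way from sum_j T^i_j ⊗ xi^j.                                        *)
(* The inverse of T comes from the Laplace expansion of det T. In degree 2 the  *)
(* relation delta0 Q = 1 ⊗ Q amounts to sum_i h_i T^(bar i)_j T^i_l =           *)
(* h_l [j = bar l] with h_0 = 2 and h_i = 1 otherwise, a form of T^t H T = H,   *)
(* which is visibly stable under products and inverses.                         *)
Require Import Defs.
From HB Require Import structures.
From mathcomp Require Import all_boot all_order all_algebra.
From mathcomp Require Import boolp classical_sets fsbigop reals trigo complex.
From mathcomp Require Import finmap monalg ring zify.

Set Implicit Arguments.
Unset Strict Implicit.
Unset Printing Implicit Defensive.

Import Order.TTheory GRing.Theory Num.Theory.
Local Open Scope ring_scope.

Local Notation free := Defs.free.

(** * Homomorphisms and generators *)

(** Everything rests on the universal property [Omega_G_lift]. To map [Omega_alg theta G] into a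
    differential graded algebra it suffices to give a degree-0 matrix T such that T and dT satisfy
    the color relations [gcolor (mcolor L) (dmx d T)], such that det T has an inverse v of degree 0
    commuting with T and dT, and such that [group_rel] holds. The value of d on the inverse
    determinant is forced by det T v = 1 ([dif_detV]), and a map commuting with d kills the closed
    ideal of the group once it kills the degree-0 relations ([closed_ideal_ker]).

    Three matrices must satisfy these conditions. For sum_k T^i_k ⊗ T^k_j, the weights of the
    contracted index cancel ([gcolor_tensor]) and the determinant is det ⊗ det ([color_det_tens]).
    For the unit matrix over C, with zero differential, the off-diagonal products vanish. For the
    inverse S of T, read in the opposite algebra, existence is the Laplace expansion
    ([color_inverse]), and the color relations follow from those of T by conjugation
    ([inverse_color], [inverse_gcolor]). The relations of the groups follow along by
    [group_rel_mul], [group_rel_id] and [group_rel_inv].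

    The determinant is treated through functions of words. On words of length |I|, a function that
    is multiplied by - L x y when adjacent letters x, y are exchanged is determined by its value on
    one word containing each index once ([swapping_ref]). Applied to products of the d xi^i this
    identifies det_theta with an explicit sum ([det_thetaE]); applied to expansions of products of
    matrix entries it gives multiplicativity, invariance under bar and the Laplace expansion.
    Centrality holds because the weights L k i multiply to 1 over all i ([prod_Lam_r],
    [prod_Lam_l]).

    That bar and d exist on the presented algebras means that the relations are stable under them
    ([gida_presP]). The delicate relations are those of det^-1: they use that det is hermitian, that
    d det is graded central and that its square is 0 ([wsign_bar_det], [ddet_central], [ddet_sq]).

    Finally [matrix_hopf] verifies the axioms on generators: coassociativity and the counit laws
    compare algebra homomorphisms, while the antipode law propagates along products by [conv_l_gen]
    and [conv_r_gen], its degree-1 case being the derivative of S T = 1 = T S. *)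

Section Semilinear.
Context (C : pzRingType) (s : {rmorphism C -> C}) (U V : lmodType C).

(** Treats linear maps (s the identity) and antilinear ones (s the conjugation) together. *)
Definition semilin (f : U -> V) : Prop :=
  forall a x y, f (a *: x + y) = s a *: f x + f y.

Context (f : U -> V) (fP : semilin f).

Lemma slD x y : f (x + y) = f x + f y.
Proof. by rewrite -[x]scale1r fP rmorph1 !scale1r. Qed.
Lemma sl0 : f 0 = 0.
Proof. by apply: (addrI (f 0)); rewrite -slD !addr0. Qed.
Lemma slZ a x : f (a *: x) = s a *: f x.
Proof. by rewrite -[_ *: x]addr0 fP sl0 addr0. Qed.
Lemma slN x : f (- x) = - f x.
Proof. by rewrite -scaleN1r slZ rmorphN1 scaleN1r. Qed.
Lemma slB x y : f (x - y) = f x - f y.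
Proof. by rewrite slD slN. Qed.
Lemma sl_sum (I : Type) (r : seq I) (P : pred I) (F : I -> U) :
  f (\sum_(i <- r | P i) F i) = \sum_(i <- r | P i) f (F i).
Proof. exact: (big_morph f slD sl0). Qed.
Lemma sl_sign n x : f ((-1) ^+ n *: x) = (-1) ^+ n *: f x.
Proof. by rewrite slZ rmorphXn rmorphN1. Qed.

End Semilinear.

Section LinearMaps.
Context (C : pzRingType) (U V : lmodType C) (f : U -> V) (fP : linear f).
Let fS : semilin idfun f := fP.

Lemma linD x y : f (x + y) = f x + f y. Proof. exact: slD fS x y. Qed.
Lemma lin0 : f 0 = 0. Proof. exact: sl0 fS. Qed.
Lemma linZ a x : f (a *: x) = a *: f x. Proof. exact: slZ fS a x. Qed.
Lemma linN x : f (- x) = - f x. Proof. exact: slN fS x. Qed.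
Lemma linB x y : f (x - y) = f x - f y. Proof. exact: slB fS x y. Qed.
Lemma lin_sum (I : Type) (r : seq I) (P : pred I) (F : I -> U) :
  f (\sum_(i <- r | P i) F i) = \sum_(i <- r | P i) f (F i).
Proof. exact: (big_morph f linD lin0). Qed.

End LinearMaps.

Lemma pzmulZl (C : pzRingType) (A : pzAlg C) a (x y : A) :
  (a *: x) * y = a *: (x * y).
Proof. by rewrite pzscalerAl. Qed.
Lemma pzmulZr (C : pzRingType) (A : pzAlg C) a (x y : A) :
  x * (a *: y) = a *: (x * y).
Proof. by rewrite pzscalerAr. Qed.

Section GradedLemmas.
Context (C : comNzRingType) (A : gradedAlg C).
Implicit Types (x y : A) (p q : nat).

Lemma homog1 : homog 0 (1 : A). Proof. exact: gcomp1. Qed.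
Lemma homogN p x : homog p x -> homog p (- x).
Proof. by rewrite -scaleN1r; apply: homogZ. Qed.
Lemma homogB p x y : homog p x -> homog p y -> homog p (x - y).
Proof. by move=> hx hy; apply/homogD/homogN. Qed.
Lemma homog_sum p (I : Type) (r : seq I) (P : pred I) (F : I -> A) :
  (forall i, P i -> homog p (F i)) -> homog p (\sum_(i <- r | P i) F i).
Proof.
move=> h; apply: big_ind => //; first exact: homog0.
by move=> x y; apply: homogD.
Qed.
Lemma homog0M x y : homog 0 x -> homog 0 y -> homog 0 (x * y).
Proof. exact: (@homogM _ _ 0 0). Qed.
Lemma homogMl0 p x y : homog 0 x -> homog p y -> homog p (x * y).
Proof. exact: (@homogM _ _ 0 p). Qed.
Lemma homogM0r p x y : homog p x -> homog 0 y -> homog p (x * y).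
Proof. by move=> hx hy; rewrite -[p]addn0; apply: homogM. Qed.
Lemma homog0X x k : homog 0 x -> homog 0 (x ^+ k).
Proof.
move=> hx; elim: k => [|k IH]; first by rewrite expr0; apply: homog1.
by rewrite exprS; apply: homog0M.
Qed.

Section Kernel.
Context (Z : set A).
Hypothesis Zsub : is_submodule Z.
Hypothesis ZM : forall p q x y, homog p x -> homog q y -> Z x ->
  Z (x * y) /\ Z (y * x).

Let ZD x y : Z x -> Z y -> Z (x + y).
Proof. by move=> hx hy; rewrite -[x]scale1r; apply: (subP Zsub). Qed.
Let Zsum (I : Type) (r : seq I) (P : pred I) (F : I -> A) :
  (forall i, P i -> Z (F i)) -> Z (\sum_(i <- r | P i) F i).
Proof. by move=> h; apply: (big_ind Z) => //; apply: sub0. Qed.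

(** A generated ideal is the intersection of the graded ideals containing the generators, so a
    property Z is compared with it through the largest graded part of Z: the elements all of whose
    components satisfy Z. *)
Lemma graded_core_ideal :
  is_graded_ideal [set x : A | forall p, Z (gcomp p x)]%classic.
Proof.
have K0 : Z 0 by apply: sub0.
split; first split; first split.
- by move=> p; rewrite gcomp0.
- by move=> a x y hx hy p; rewrite gcompZD; apply: (subP Zsub).
- move=> a x hx p; move: a; apply: gcomp_ind => [|a a' ha ha'|q a ha].
  + by rewrite mul0r gcomp0.
  + by rewrite mulrDl gcompD; apply: ZD.
  have [N ->] := gcomp_sum x; rewrite mulr_sumr gcomp_bigsum.
  apply: Zsum => k _.
  rewrite (homogE _ (homogM ha (homog_gcomp k x))).
  case: ifP => // _; have [_] := ZM (homog_gcomp k x) ha (hx k); exact.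
- move=> a x hx p; move: a; apply: gcomp_ind => [|a a' ha ha'|q a ha].
  + by rewrite mulr0 gcomp0.
  + by rewrite mulrDr gcompD; apply: ZD.
  have [N ->] := gcomp_sum x; rewrite mulr_suml gcomp_bigsum.
  apply: Zsum => k _.
  rewrite (homogE _ (homogM (homog_gcomp k x) ha)).
  case: ifP => // _; have [h _] := ZM (homog_gcomp k x) ha (hx k); exact: h.
by move=> p x hx q; rewrite gcompK; case: ifP.
Qed.

Lemma graded_core_homog p x : homog p x -> Z x -> forall q, Z (gcomp q x).
Proof. by move=> hx Zx q; rewrite (homogE _ hx); case: ifP => // _; apply: sub0. Qed.

Lemma graded_core_sub x : (forall p, Z (gcomp p x)) -> Z x.
Proof. by move=> h; have [N ->] := gcomp_sum x; apply: Zsum. Qed.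

(** Induction over a generated ideal. Z has to be stable only under products of homogeneous
    elements, the setting in which the sign rules for bar and d are stated. *)
Lemma gideal_gen_min (S : set A) :
  (forall x, S x -> exists p, homog p x) -> (forall x, S x -> Z x) ->
  forall x, gideal_gen S x -> Z x.
Proof.
move=> Sh SZ x hx; apply: graded_core_sub.
apply: (hx [set y : A | forall p, Z (gcomp p y)]%classic); split.
  exact: graded_core_ideal.
by move=> y Sy; have [p hp] := Sh y Sy; apply: (graded_core_homog hp (SZ _ Sy)).
Qed.

Lemma closed_gideal_gen_min (d : A -> A) (S : set A) :
  linear d -> (forall p x, homog p x -> homog p.+1 (d x)) ->
  (forall p x, homog p x -> Z x -> Z (d x)) ->
  (forall x, S x -> exists p, homog p x) -> (forall x, S x -> Z x) ->
  forall x, closed_gideal_gen d S x -> Z x.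
Proof.
move=> dl dh dZ Sh SZ x hx; apply: graded_core_sub.
apply: (hx [set y : A | forall p, Z (gcomp p y)]%classic); split.
  exact: graded_core_ideal.
split=> [y hy p|y Sy]; last first.
  by have [p hp] := Sh y Sy; apply: (graded_core_homog hp (SZ _ Sy)).
have [N ->] := gcomp_sum y; rewrite (lin_sum dl) gcomp_bigsum.
apply: Zsum => k _; rewrite (homogE _ (dh _ _ (homog_gcomp k y))).
case: ifP => _; last exact: sub0.
exact: (dZ _ _ (homog_gcomp k y)).
Qed.

End Kernel.

Lemma gideal_gen_sub (S : set A) x : S x -> gideal_gen S x.
Proof. by move=> Sx J [_ SJ]; apply: SJ. Qed.

Lemma closed_gideal_gen_sub d (S : set A) x : S x -> closed_gideal_gen d S x.
Proof. by move=> Sx J [_ [_ SJ]]; apply: SJ. Qed.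

Lemma closed_gideal_gen_dif d (S : set A) x :
  closed_gideal_gen d S x -> closed_gideal_gen d S (d x).
Proof. by move=> hx J hJ; have [_ [h _]] := hJ; apply: h; exact: hx J hJ. Qed.

End GradedLemmas.

Lemma idealM_l (C : pzRingType) (A : pzAlg C) (J : ideal A) (a x : A) :
  J x -> J (a * x).
Proof. by case: (ideal_ax J) => _ h _; apply: h. Qed.
Lemma idealM_r (C : pzRingType) (A : pzAlg C) (J : ideal A) (a x : A) :
  J x -> J (x * a).
Proof. by case: (ideal_ax J) => _ _ h; apply: h. Qed.

(** The induction principle multiplies by one generator on the left and keeps the other factor
    homogeneous, so that the signs of bar and of the Leibniz rule are available at each step. *)
Record generated (C : pzRingType) (A : gradedAlg C) (X : Type) (deg : X -> nat)
    (g : X -> A) : Prop := {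
  gen_homog : forall x, homog (deg x) (g x);
  gen_ind : forall P : A -> Prop, P 1 ->
    (forall a x y, P x -> P y -> P (a *: x + y)) ->
    (forall x p y, homog p y -> P y -> P (g x * y)) ->
    forall y, P y }.

Section Homs.
Context (C : comNzRingType).

(** The structure expected of a target of the universal property. It covers opposite algebras and
    the scalars; compatibility with bar is checked afterwards on generators. *)
Record is_dga (A : gradedAlg C) (d : A -> A) : Prop := {
  dga_linear : linear d;
  dga_homog : forall p x, homog p x -> homog p.+1 (d x);
  dgaM : forall p x y, homog p x ->
    d (x * y) = d x * y + (-1) ^+ p *: (x * d y);
  dga2 : forall x, d (d x) = 0 }.

Lemma dga1 (A : gradedAlg C) (d : A -> A) : is_dga d -> d 1 = 0.
Proof.
move=> dP; apply: (addrI (d 1)); rewrite addr0.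
by rewrite -[in RHS](mulr1 1) (dgaM dP 1 (homog1 A)) expr0 scale1r mulr1 mul1r.
Qed.

Record alg_hom (A B : pzAlg C) (f : A -> B) : Prop := {
  ah_linear : linear f;
  ah_mul : monoid_morphism f }.

Lemma ahM (A B : pzAlg C) (f : A -> B) : alg_hom f -> {morph f : x y / x * y}.
Proof. by case=> _ [_ h]. Qed.
Lemma ah1 (A B : pzAlg C) (f : A -> B) : alg_hom f -> f 1 = 1.
Proof. by case=> _ [h _]. Qed.

Lemma alg_hom_id (A : pzAlg C) : alg_hom (@id A).
Proof. by []. Qed.

Lemma alg_hom_comp (A B D : pzAlg C) (f : A -> B) (g : B -> D) :
  alg_hom f -> alg_hom g -> alg_hom (g \o f).
Proof.
move=> fP gP; split.
  by move=> a x y /=; rewrite (ah_linear fP) (ah_linear gP).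
by split => [|x y] /=; rewrite ?(ah1 fP, ah1 gP) // (ahM fP) (ahM gP).
Qed.

Context (A : gradedAlg C) (X : Type) (deg : X -> nat) (g : X -> A).
Hypothesis Ag : generated deg g.

Lemma alg_hom_ext (B : pzAlg C) (f f' : A -> B) : alg_hom f -> alg_hom f' ->
  (forall x, f (g x) = f' (g x)) -> forall y, f y = f' y.
Proof.
move=> fP fP' e; apply: (gen_ind Ag).
- by rewrite !ah1.
- by move=> a x y hx hy; rewrite (ah_linear fP) (ah_linear fP') hx hy.
by move=> x p y hy IH; rewrite (ahM fP) (ahM fP') IH e.
Qed.

Lemma alg_hom_homog (B : gradedAlg C) (f : A -> B) : alg_hom f ->
  (forall x, homog (deg x) (f (g x))) -> forall p y, homog p y -> homog p (f y).
Proof.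
move=> fP fg p y.
suff h : forall y p, homog p (f (gcomp p y)) by move=> <-; apply: h.
have h0 q : homog q (f 0) by rewrite (lin0 (ah_linear fP)); apply: homog0.
move=> {}y; move: y; apply: (gen_ind Ag) => [q|a x y hx hy q|x q y hy IH r].
- rewrite (homogE _ (homog1 A)); case: eqP => [->|_] //.
  by rewrite (ah1 fP); apply: homog1.
- rewrite gcompZD (ah_linear fP); apply: homogD; last exact: hy.
  by apply: homogZ; apply: hx.
rewrite (homogE _ (homogM (gen_homog Ag x) hy)); case: eqP => [->|_] //.
by rewrite (ahM fP); apply: homogM => //; rewrite -hy; apply: IH.
Qed.

Lemma alg_hom_dif (d : A -> A) (B : gradedAlg C) (d' : B -> B) (f : A -> B) :
  is_dga d -> is_dga d' -> alg_hom f ->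
  (forall x, homog (deg x) (f (g x))) ->
  (forall x, f (d (g x)) = d' (f (g x))) -> forall y, f (d y) = d' (f y).
Proof.
move=> dP dP' fP fh fd; apply: (gen_ind Ag).
- by rewrite (dga1 dP) (ah1 fP) (dga1 dP') (lin0 (ah_linear fP)).
- move=> a x y hx hy; rewrite (ah_linear fP) (dga_linear dP) (dga_linear dP').
  by rewrite (ah_linear fP) hx hy.
move=> x p y hy IH; rewrite (dgaM dP _ (gen_homog Ag x)).
rewrite (linD (ah_linear fP)) (linZ (ah_linear fP)) !(ahM fP) IH fd.
by rewrite (dgaM dP' _ (fh x)).
Qed.

End Homs.

Section GidaHoms.
Context (C : numClosedFieldType).

Lemma gida_dga (A : gida_data C) : is_gida A -> is_dga (@gdif C A).
Proof. by case=> *; split. Qed.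

Lemma gbar1 (A : gida_data C) : is_gida A -> gbar (1 : A) = 1.
Proof.
move=> AP; have h := gbarM AP (homog1 A) (gbar_homog AP (homog1 A)).
by move: h; rewrite mul1r (gbarK AP) muln0 expr0 scale1r mul1r => <-.
Qed.

Lemma gida_hom_alg (A B : gida_data C) (f : A -> B) : is_gida_hom f -> alg_hom f.
Proof. by case=> *; split. Qed.

Lemma gida_hom_gen (A B : gida_data C) (X : Type)
    (deg : X -> nat) (g : X -> A) (f : A -> B) :
  generated deg g -> is_gida A -> is_gida B -> alg_hom f ->
  (forall x, homog (deg x) (f (g x))) ->
  (forall x, f (gbar (g x)) = gbar (f (g x))) ->
  (forall x, f (gdif (g x)) = gdif (f (g x))) ->
  is_gida_hom f.
Proof.
move=> Ag AP BP fP fh fb fd.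
have fH := alg_hom_homog Ag fP fh.
split=> //; [exact: ah_linear fP|exact: ah_mul fP| |].
  move=> y; move: y; apply: (gen_ind Ag).
  - by rewrite (gbar1 AP) (ah1 fP) (gbar1 BP).
  - move=> a x y hx hy; rewrite (gbar_antilinear AP) !(ah_linear fP).
    by rewrite (gbar_antilinear BP) hx hy.
  move=> x p y hy IH; rewrite (gbarM AP (gen_homog Ag x) hy).
  rewrite (linZ (ah_linear fP)) !(ahM fP) IH fb.
  by rewrite (gbarM BP (fH _ _ (gen_homog Ag x)) (fH _ _ hy)).
by apply: (alg_hom_dif Ag) => //; apply: gida_dga.
Qed.

End GidaHoms.

(** * Graded tensor products *)

Lemma sign_parity (C : pzRingType) m n : odd m = odd n ->
  (-1) ^+ m = (-1) ^+ n :> C.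
Proof. by rewrite -signr_odd => ->; rewrite signr_odd. Qed.

Section Weight.
Context (C : comNzRingType) (A : gradedAlg C) (c : nat -> C).

(** Multiplication by c p in degree p: the operator [gsign] for c p = (-1)^p, and the twist of the
    antipode for c p = (-1)^(p(p-1)/2). *)
Definition gweight (x : A) : A := (\sum_(p \in [set: nat]) c p *: gcomp p x)%R.

Lemma gweight_linear : linear gweight.
Proof.
move=> a x y; have [N1 h1] := gcomp_bound x; have [N2 h2] := gcomp_bound y.
have hx p : (maxn N1 N2 <= p)%N -> gcomp p x = 0.
  by rewrite geq_max => /andP[/h1].
have hy p : (maxn N1 N2 <= p)%N -> gcomp p y = 0.
  by rewrite geq_max => /andP[_ /h2].
rewrite /gweight.
rewrite !(@fsum_ord _ (fun p => c p *: _) (maxn N1 N2)); first last.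
- by move=> p hp; rewrite gcompZD hx // hy // !scaler0 addr0 scaler0.
- by move=> p /hx ->; rewrite scaler0.
- by move=> p /hy ->; rewrite scaler0.
rewrite scaler_sumr -big_split; apply: eq_bigr => p _ /=.
by rewrite gcompZD scalerDr !scalerA mulrC.
Qed.

Lemma gweightE p x : homog p x -> gweight x = c p *: x.
Proof.
move=> hx; rewrite /gweight (fsum_delta (N := p)); first by rewrite hx.
by move=> q qp; rewrite (homogE _ hx) (negbTE qp) scaler0.
Qed.

End Weight.

Lemma gsignE (C : comNzRingType) (A : gradedAlg C) p (x : A) :
  homog p x -> gsign x = (-1) ^+ p *: x.
Proof. exact: gweightE. Qed.

Lemma gsign_linear (C : comNzRingType) (A : gradedAlg C) :
  linear (@gsign C A).
Proof. exact: gweight_linear. Qed.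

Section TensorLift.
Context (C : comNzRingType) (U V W : lmodType C).

Definition bilin (f : U -> V -> W) : Prop :=
  (forall v, linear (f^~ v)) /\ (forall u, linear (f u)).

Context (f : U -> V -> W) (fB : bilin f).

Lemma tlE u v : tens_lift idfun f (u ⊗ v) = f u v.
Proof.
by apply: (tens_liftE (s := idfun)) => [a x y z|a x y z]; [apply: fB.1|apply: fB.2].
Qed.
Lemma tl_linear : linear (tens_lift idfun f).
Proof.
move=> a x y.
by apply: (tens_liftP (s := idfun)) => [b u v z|b u v z]; [apply: fB.1|apply: fB.2].
Qed.

End TensorLift.

Lemma tensor_suml (C : comNzRingType) (U V : lmodType C) (I : Type) (r : seq I)
    (P : pred I) (F : I -> U) (v : V) :
  (\sum_(i <- r | P i) F i) ⊗ v = \sum_(i <- r | P i) (F i ⊗ v).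
Proof.
exact: (big_morph (fun u => u ⊗ v) (fun x y => tensorDl x y v) (tensor0l U v)).
Qed.
Lemma tensor_sumr (C : comNzRingType) (U V : lmodType C) (I : Type) (r : seq I)
    (P : pred I) (F : I -> V) (u : U) :
  u ⊗ (\sum_(i <- r | P i) F i) = \sum_(i <- r | P i) (u ⊗ F i).
Proof.
exact: (big_morph (fun v => u ⊗ v) (fun x y => tensorDr u x y) (tensor0r V u)).
Qed.

Lemma bilin_tensor (C : comNzRingType) (U V U' V' : lmodType C)
    (f : U -> U') (g : V -> V') : linear f -> linear g ->
  bilin (fun u v => f u ⊗ g v).
Proof.
move=> fl gl; split=> [v a x y|u a x y].
  by rewrite fl tensorPl.
by rewrite gl tensorPr.
Qed.

Section GradedTensorLemmas.
Context (C : comNzRingType) (A B : gradedAlg C).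
Implicit Types (a : A) (b : B) (p q : nat).

Definition tn a b : gtens A B := a ⊗ b.

Lemma tnM a b a' b' p q : homog q b -> homog p a' ->
  tn a b * tn a' b' = (-1) ^+ (q * p) *: tn (a * a') (b * b').
Proof. by move=> hb ha; apply: tmulE. Qed.

Lemma tnM0l a b a' b' : homog 0 b -> tn a b * tn a' b' = tn (a * a') (b * b').
Proof.
move=> hb; move: a'; apply: gcomp_ind => [|x y hx hy|p x hx].
- by rewrite mulr0 /tn !tensor0l; apply: (mulr0 (_ : gtens A B)).
- rewrite mulrDr /tn !tensorDl.
  have := mulrDr (tn a b) (tn x b') (tn y b'); rewrite /tn => ->.
  by move: hx hy; rewrite /tn => -> ->.
by rewrite (tnM _ _ hb hx) mul0n expr0 scale1r.
Qed.
Lemma tnM0r a b a' b' : homog 0 a' -> tn a b * tn a' b' = tn (a * a') (b * b').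
Proof.
move=> ha; move: b; apply: gcomp_ind => [|x y hx hy|p x hx].
- by rewrite mul0r /tn !tensor0r; apply: (mul0r (_ : gtens A B)).
- rewrite mulrDl /tn !tensorDr.
  have := mulrDl (tn a x) (tn a y) (tn a' b'); rewrite /tn => ->.
  by move: hx hy; rewrite /tn => -> ->.
by rewrite (tnM _ _ hx ha) muln0 expr0 scale1r.
Qed.

Lemma tn1 : tn 1 1 = 1. Proof. by []. Qed.
Lemma tnDl a a' b : tn (a + a') b = tn a b + tn a' b.
Proof. exact: tensorDl. Qed.
Lemma tnDr a b b' : tn a (b + b') = tn a b + tn a b'.
Proof. exact: tensorDr. Qed.
Lemma tnZl c a b : tn (c *: a) b = c *: tn a b.
Proof. exact: tensorZl. Qed.
Lemma tnZr c a b : tn a (c *: b) = c *: tn a b.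
Proof. exact: tensorZr. Qed.
Lemma tn0l b : tn 0 b = 0. Proof. exact: tensor0l. Qed.
Lemma tn0r a : tn a 0 = 0. Proof. exact: tensor0r. Qed.
Lemma tn_suml (I : Type) (r : seq I) (P : pred I) (F : I -> A) b :
  tn (\sum_(i <- r | P i) F i) b = \sum_(i <- r | P i) tn (F i) b.
Proof. exact: tensor_suml. Qed.
Lemma tn_sumr (I : Type) (r : seq I) (P : pred I) (F : I -> B) a :
  tn a (\sum_(i <- r | P i) F i) = \sum_(i <- r | P i) tn a (F i).
Proof. exact: tensor_sumr. Qed.

Lemma gcomp_tn m p q a b : homog p a -> homog q b ->
  gcomp m (tn a b) = if m == (p + q)%N then tn a b else 0.
Proof. exact: tcompE. Qed.

Lemma homog_tn p q a b : homog p a -> homog q b -> homog (p + q) (tn a b).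
Proof. by move=> ha hb; rewrite /homog (gcomp_tn _ ha hb) eqxx. Qed.

Lemma homog_tn00 a b : homog 0 a -> homog 0 b -> homog 0 (tn a b).
Proof. exact: (@homog_tn 0 0). Qed.

Lemma gtens_ind (P : gtens A B -> Prop) :
    P 0 -> (forall x y, P x -> P y -> P (x + y)) ->
    (forall a b, P (tn a b)) ->
  forall x, P x.
Proof. exact: tens_ind. Qed.

Lemma gtens_hind (P : gtens A B -> Prop) :
    P 0 -> (forall x y, P x -> P y -> P (x + y)) ->
    (forall p q a b, homog p a -> homog q b -> P (tn a b)) ->
  forall x, P x.
Proof. exact: tens_hind. Qed.

Section LiftHom.
Context (D : pzAlg C) (f : A -> B -> D) (fB : bilin f).

Lemma gtlE a b : tens_lift idfun f (tn a b) = f a b.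
Proof. exact: tlE. Qed.
Lemma gtl_linear : linear (tens_lift idfun f : gtens A B -> D).
Proof. exact: tl_linear. Qed.

Lemma gtl_mul : f 1 1 = 1 ->
    (forall p q p' q' a b a' b', homog p a -> homog q b ->
       homog p' a' -> homog q' b' ->
       f a b * f a' b' = (-1) ^+ (q * p') *: f (a * a') (b * b')) ->
  monoid_morphism (tens_lift idfun f : gtens A B -> D).
Proof.
move=> f1 fM; have fl := gtl_linear.
split; first by rewrite -tn1 gtlE.
apply: gtens_hind => [y|x x' h h' y|p q a b ha hb].
- by rewrite mul0r (lin0 fl) mul0r.
- by rewrite mulrDl !(linD fl) h h' mulrDl.
apply: gtens_hind => [|x x' h h'|p' q' a' b' ha' hb'].
- by rewrite mulr0 (lin0 fl) mulr0.
- by rewrite mulrDr !(linD fl) h h' mulrDr.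
by rewrite (tnM _ _ hb ha') (linZ fl) !gtlE (fM p q p' q').
Qed.

End LiftHom.

End GradedTensorLemmas.

Arguments tn {C A B} a b.

Section TensorMaps.
Context (C : comNzRingType).

Lemma bilin_tn (A B A' B' : gradedAlg C) (f : A -> A') (g : B -> B') :
  linear f -> linear g -> bilin (fun a b => tn (f a) (g b)).
Proof. exact: bilin_tensor. Qed.

Section Map.
Context (A B A' B' : gradedAlg C) (f : A -> A') (g : B -> B').
Hypotheses (fP : alg_hom f) (gP : alg_hom g).
Hypotheses (fh : forall p x, homog p x -> homog p (f x)).
Hypotheses (gh : forall p x, homog p x -> homog p (g x)).

Lemma tens_mapE a b : tens_map f g (tn a b) = tn (f a) (g b).
Proof. by apply: tlE; apply: bilin_tensor; apply: ah_linear. Qed.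

Lemma tens_map_hom : alg_hom (tens_map f g : gtens A B -> gtens A' B').
Proof.
have fb : bilin (fun a b => tn (f a) (g b)) by apply: bilin_tn; apply: ah_linear.
split; first exact: gtl_linear.
apply: gtl_mul => //; first by rewrite !ah1.
move=> p q p' q' a b a' b' ha hb ha' hb'.
by rewrite (tnM _ _ (gh hb) (fh ha')) (ahM fP) (ahM gP).
Qed.

End Map.

Section RawAssoc.
Context (U V W : lmodType C).

Let assoc1 (w : W) : bilin (fun (u : U) (v : V) => u ⊗ (v ⊗ w)).
Proof.
by split=> [v a x y|u a x y]; [rewrite tensorPl|rewrite tensorPl tensorPr].
Qed.

Let assoc2 : bilin (fun (uv : tens U V) (w : W) =>
  tens_lift idfun (fun u v => u ⊗ (v ⊗ w)) uv).
Proof.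
split=> [w a x y|x a w w']; first exact: (tl_linear (assoc1 w)).
have l w0 := tl_linear (assoc1 w0).
move: x; apply: tens_ind => [|x y hx hy|u v].
- by rewrite !(lin0 (l _)) scaler0 addr0.
- by rewrite !(linD (l _)) hx hy scalerDr addrACA.
by rewrite !tlE // !tensorPr.
Qed.

Lemma tens_assocE (u : U) (v : V) (w : W) :
  tens_assoc ((u ⊗ v) ⊗ w) = u ⊗ (v ⊗ w).
Proof.
rewrite /tens_assoc; apply: etrans (tlE assoc2 (u ⊗ v) w) _.
exact: tlE (assoc1 w) u v.
Qed.
Lemma tens_assoc_linear : linear (@tens_assoc C U V W).
Proof. exact: (tl_linear assoc2). Qed.

End RawAssoc.

Section Assoc.
Context (A B D : gradedAlg C).

Definition gassoc : gtens (gtens A B) D -> gtens A (gtens B D) :=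
  @tens_assoc C A B D.

Lemma gassocE (a : A) (b : B) (c : D) :
  gassoc (tn (tn a b) c) = tn a (tn b c).
Proof. exact: tens_assocE. Qed.

Lemma gassoc_linear : linear gassoc.
Proof. exact: tens_assoc_linear. Qed.

Lemma gassoc_hom : alg_hom gassoc.
Proof.
have l := gassoc_linear.
split=> //; split; first by rewrite -!tn1 gassocE.
apply: gtens_hind => [y|x x' h h' y|p q x c hx hc].
- by rewrite mul0r (lin0 l) mul0r.
- by rewrite mulrDl !(linD l) h h' mulrDl.
apply: gtens_hind => [|y y' h h'|p' q' y c' hy hc'].
- by rewrite mulr0 (lin0 l) mulr0.
- by rewrite mulrDr !(linD l) h h' mulrDr.
(* A homogeneous tensor need not be presented as a sum of pure tensors of its own degree. Writing x
   as [gcomp p x] gives a statement about arbitrary x, to which induction on pure tensors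
   applies. *)
rewrite -hx -hy; move: x {hx}; apply: gtens_hind => [|x x' h h'|r s a b ha hb].
- by rewrite gcomp0 tn0l mul0r (lin0 l) mul0r.
- by rewrite gcompD tnDl mulrDl !(linD l) h h' mulrDl.
rewrite (gcomp_tn _ ha hb); case: eqP => _; last by rewrite tn0l mul0r (lin0 l) mul0r.
move: y {hy}; apply: gtens_hind => [|y y' h h'|r' s' a' b' ha' hb'].
- by rewrite gcomp0 tn0l mulr0 (lin0 l) mulr0.
- by rewrite gcompD tnDl mulrDr !(linD l) h h' mulrDr.
rewrite (gcomp_tn _ ha' hb'); case: eqP => _; last by rewrite tn0l mulr0 (lin0 l) mulr0.
rewrite (tnM _ _ hc (homog_tn ha' hb')) (tnM _ _ hb ha') tnZl !(linZ l).
rewrite !gassocE (tnM _ _ (homog_tn hb hc) ha') (tnM _ _ hc hb') tnZr !scalerA.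
rewrite -!exprD; apply: (congr1 (fun x : C => x *: _)); apply: sign_parity.
by rewrite !(oddD, oddM); case: (odd q); case: (odd s); case: (odd r'); case: (odd s').
Qed.

End Assoc.

Section Contraction.
Context (A : gradedAlg C) (e : A -> C).
Hypotheses (el : scalar e) (eM : monoid_morphism e).
Hypothesis e0 : forall p x, homog p.+1 x -> e x = 0.

Lemma contract_l_bilin (B : gradedAlg C) : bilin (fun (a : A) (b : B) => e a *: b).
Proof.
split=> [b c x y|a c x y]; first by rewrite el scalerDl scalerA.
by rewrite scalerDr !scalerA mulrC.
Qed.
Lemma contract_r_bilin (B : gradedAlg C) : bilin (fun (b : B) (a : A) => e a *: b).
Proof.
split=> [a c x y|b c x y]; last by rewrite el scalerDl scalerA.
by rewrite scalerDr !scalerA mulrC.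
Qed.

(** The sign in the product of two tensors is nontrivial only if the second A-factor has positive
    degree, and there e vanishes. *)
Lemma contract_l_hom (B : gradedAlg C) :
  alg_hom (tens_lift idfun (fun (a : A) (b : B) => e a *: b) : gtens A B -> B).
Proof.
have fb := contract_l_bilin B; split; first exact: gtl_linear.
apply: gtl_mul => //; first by rewrite eM.1 scale1r.
move=> p q p' q' a b a' b' ha hb ha' hb'.
case: p' ha' => [|p'] ha'.
  by rewrite muln0 expr0 scale1r eM.2 pzmulZl pzmulZr scalerA.
by rewrite eM.2 (e0 ha') mulr0 !scale0r mulr0 scaler0.
Qed.

Lemma contract_r_hom (B : gradedAlg C) :
  alg_hom (tens_lift idfun (fun (b : B) (a : A) => e a *: b) : gtens B A -> B).
Proof.
have fb := contract_r_bilin B; split; first exact: gtl_linear.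
apply: gtl_mul => //; first by rewrite eM.1 scale1r.
move=> p q p' q' a b a' b' ha hb ha' hb'.
case: q hb => [|q] hb.
  by rewrite mul0n expr0 scale1r eM.2 pzmulZl pzmulZr scalerA.
by rewrite eM.2 (e0 hb) mul0r !scale0r mul0r scaler0.
Qed.

End Contraction.

Section Convolution.
Context (A : gradedAlg C) (S : A -> A) (Sl : linear S).
Hypothesis SM : forall p q x y, homog p x -> homog q y ->
  S (x * y) = (-1) ^+ (p * q) *: (S y * S x).

Lemma conv_l_bilin : bilin (fun a b : A => S a * b).
Proof.
split=> [b c x y|a c x y]; first by rewrite Sl mulrDl pzmulZl.
by rewrite mulrDr pzmulZr.
Qed.
Lemma conv_r_bilin : bilin (fun a b : A => a * S b).
Proof.
split=> [b c x y|a c x y]; first by rewrite mulrDl pzmulZl.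
by rewrite Sl mulrDr pzmulZr.
Qed.

Let ml : gtens A A -> A := tens_lift idfun (fun a b : A => S a * b).
Let mr : gtens A A -> A := tens_lift idfun (fun a b : A => a * S b).
Let mlE a b : ml (tn a b) = S a * b. Proof. exact: (gtlE conv_l_bilin). Qed.
Let mrE a b : mr (tn a b) = a * S b. Proof. exact: (gtlE conv_r_bilin). Qed.
Let mll : linear ml. Proof. exact: (gtl_linear conv_l_bilin). Qed.
Let mrl : linear mr. Proof. exact: (gtl_linear conv_r_bilin). Qed.

Let mlM p (X : gtens A A) q a b : homog p X -> homog q a ->
  ml (X * tn a b) = (-1) ^+ (p * q) *: (S a * ml X * b).
Proof.
move=> <- ha; move: X; apply: gtens_hind => [|x y hx hy|r s x y hx hy].
- by rewrite gcomp0 mul0r (lin0 mll) mulr0 mul0r scaler0.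
- by rewrite gcompD mulrDl !(linD mll) hx hy mulrDr mulrDl scalerDr.
rewrite (gcomp_tn _ hx hy); case: eqP => [->|_]; last first.
  by rewrite mul0r (lin0 mll) mulr0 mul0r scaler0.
rewrite (tnM _ _ hy ha) (linZ mll) !mlE (SM hx ha) pzmulZl scalerA -exprD.
by rewrite mulnDl addnC !mulrA.
Qed.

Let mrM q (Y : gtens A A) s a b : homog q Y -> homog s b ->
  mr (tn a b * Y) = (-1) ^+ (s * q) *: (a * mr Y * S b).
Proof.
move=> <- hb; move: Y; apply: gtens_hind => [|x y hx hy|r t x y hx hy].
- by rewrite gcomp0 mulr0 (lin0 mrl) mulr0 mul0r scaler0.
- by rewrite gcompD mulrDr !(linD mrl) hx hy mulrDr mulrDl scalerDr.
rewrite (gcomp_tn _ hx hy); case: eqP => [->|_]; last first.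
  by rewrite mulr0 (lin0 mrl) mulr0 mul0r scaler0.
rewrite (tnM _ _ hb hx) (linZ mrl) !mrE (SM hb hy) pzmulZr scalerA -exprD.
by rewrite mulnDr !mulrA.
Qed.

(** As S reverses products, S(xa) yb equals S(a) (S(x) y) b up to sign, so a contraction of the
    first factor that yields a scalar can be pulled out. The sign is harmless: either X has degree 0
    or the scalar is 0. In this way the antipode law, whose left side is not an algebra
    homomorphism, reduces to generators. *)
Lemma conv_l_mul p (X Y : gtens A A) c : homog p X -> ml X = c *: (1 : A) ->
  p = 0%N \/ c = 0 -> ml (X * Y) = c *: ml Y.
Proof.
move=> hX eX hp; move: Y; apply: gtens_hind => [|x y hx hy|r s a b ha hb].
- by rewrite mulr0 (lin0 mll) scaler0.
- by rewrite mulrDr !(linD mll) hx hy scalerDr.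
rewrite (mlM _ hX ha) eX pzmulZr mulr1 pzmulZl mlE.
by case: hp => ->; rewrite ?mul0n ?expr0 ?scale1r // !scale0r scaler0.
Qed.

Lemma conv_r_mul q (X Y : gtens A A) c : homog q Y -> mr Y = c *: (1 : A) ->
  q = 0%N \/ c = 0 -> mr (X * Y) = c *: mr X.
Proof.
move=> hY eY hp; move: X; apply: gtens_hind => [|x y hx hy|r s a b ha hb].
- by rewrite mul0r (lin0 mrl) scaler0.
- by rewrite mulrDl !(linD mrl) hx hy scalerDr.
rewrite (mrM _ hY hb) eY pzmulZr mulr1 pzmulZl mrE.
by case: hp => ->; rewrite ?muln0 ?expr0 ?scale1r // !scale0r scaler0.
Qed.

Context (X : Type) (deg : X -> nat) (g : X -> A) (Ag : generated deg g).
Context (D : A -> gtens A A) (DP : alg_hom D).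
Hypothesis Dh : forall p x, homog p x -> homog p (D x).
Context (e : A -> C) (el : scalar e) (eM : monoid_morphism e).
Hypothesis e0 : forall p x, homog p.+1 x -> e x = 0.
Hypothesis S1 : S 1 = 1.

Lemma conv_l_gen : (forall x, ml (D (g x)) = e (g x) *: (1 : A)) ->
  forall y, ml (D y) = e y *: (1 : A).
Proof.
move=> h; apply: (gen_ind Ag) => [|a x y hx hy|x p y hy IH].
- by rewrite (ah1 DP) eM.1 -tn1 mlE S1 mulr1 scale1r.
- by rewrite (ah_linear DP) mll hx hy el scalerDl scalerA.
rewrite (ahM DP) (conv_l_mul _ (Dh (gen_homog Ag x)) (h x)).
  by rewrite IH eM.2 scalerA.
by case: (deg x) (gen_homog Ag x) => [|k] hx; [left|right; apply: e0 hx].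
Qed.

Lemma conv_r_gen : (forall x, mr (D (g x)) = e (g x) *: (1 : A)) ->
  forall y, mr (D y) = e y *: (1 : A).
Proof.
move=> h; apply: (gen_ind Ag) => [|a x y hx hy|x p y hy IH].
- by rewrite (ah1 DP) eM.1 -tn1 mrE S1 mulr1 scale1r.
- by rewrite (ah_linear DP) mrl hx hy el scalerDl scalerA.
rewrite (ahM DP) (conv_r_mul _ (Dh hy) IH).
  by rewrite h eM.2 scalerA mulrC.
by case: p hy => [|k] hy; [left|right; apply: e0 hy].
Qed.

End Convolution.

End TensorMaps.

Section TensorGidas.
Context (C : numClosedFieldType).

Section RawBar.
Context (U V : lmodType C) (bU : U -> U) (bV : V -> V).
Hypotheses (bUs : semilin Num.conj bU) (bVs : semilin Num.conj bV).

Let bar_l a u u' v : bU (a *: u + u') ⊗ bV v =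
  a^* *: (bU u ⊗ bV v) + bU u' ⊗ bV v.
Proof. by rewrite bUs tensorPl. Qed.
Let bar_r a u v v' : bU u ⊗ bV (a *: v + v') =
  a^* *: (bU u ⊗ bV v) + bU u ⊗ bV v'.
Proof. by rewrite bVs tensorPr. Qed.

Lemma tl_barE u v :
  tens_lift Num.conj (fun u v => bU u ⊗ bV v) (u ⊗ v) = bU u ⊗ bV v.
Proof. exact: (tens_liftE (s := Num.conj) bar_l bar_r). Qed.
Lemma tl_bar_semilin :
  semilin Num.conj (tens_lift Num.conj (fun u v => bU u ⊗ bV v)).
Proof. by move=> a x y; rewrite (tens_liftP (s := Num.conj) bar_l bar_r). Qed.

End RawBar.

(** The shape of the Leibniz rule for (a ⊗ b)(a' ⊗ b') in [gida_tensP]: d falls on one of four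
    factors, and the hypotheses are the four comparisons of signs, each a parity check. *)
Lemma scale_comb4 (V : pzAlg C) (x1 x2 x3 x4 : V)
    (c0 c1 c2 c3 d1 d2 d3 d4 d5 d6 d7 : C) :
  c0 = d1 -> c0 * c1 = d4 * d5 -> c0 * c2 = d2 * d3 ->
  c0 * c2 * c3 = d4 * d6 * d7 ->
  c0 *: ((x1 + c1 *: x2) + c2 *: (x3 + c3 *: x4)) =
  (d1 *: x1 + d2 *: (d3 *: x3)) + d4 *: (d5 *: x2 + d6 *: (d7 *: x4)).
Proof.
move=> e1 e2 e3 e4; rewrite !scalerDr !scalerA e4 e2 e3 e1.
by rewrite addrACA.
Qed.

Section TensorGida.
Context (A B : gida_data C) (AP : is_gida A) (BP : is_gida B).
Let T := gida_tens A B.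

Lemma tens_barE (a : A) (b : B) : gbar (tn a b : T) = tn (gbar a) (gbar b).
Proof. exact: (tl_barE (gbar_antilinear AP) (gbar_antilinear BP)). Qed.
Lemma tens_bar_semilin : semilin Num.conj (@gbar C T).
Proof. exact: (tl_bar_semilin (gbar_antilinear AP) (gbar_antilinear BP)). Qed.

Let dif_bilin : bilin (fun (a : A) (b : B) =>
  tn (gdif a) b + tn (gsign a) (gdif b)).
Proof.
split=> [b c x y|a c x y].
  rewrite (gdif_linear AP) gsign_linear !tnDl !tnZl scalerDr.
  by rewrite addrACA.
by rewrite (gdif_linear BP) !tnDr !tnZr scalerDr addrACA.
Qed.

Lemma tens_difE p (a : A) (b : B) : homog p a ->
  gdif (tn a b : T) = tn (gdif a) b + (-1) ^+ p *: tn a (gdif b).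
Proof.
move=> ha; apply: etrans (gtlE dif_bilin a b) _.
by rewrite (gsignE ha) tnZl.
Qed.
Lemma tens_dif_linear : linear (@gdif C T).
Proof. exact: (gtl_linear dif_bilin). Qed.

Let bsl := tens_bar_semilin.
Let dl := tens_dif_linear.

Lemma gida_tensP : is_gida T.
Proof.
split=> //.
- apply: gtens_hind => [|x y hx hy|p q a b ha hb].
  + by rewrite !(sl0 bsl).
  + by rewrite !(slD bsl) hx hy.
  by rewrite !tens_barE !gbarK.
- move=> p x <-; move: x; apply: gtens_hind => [|x y hx hy|q r a b ha hb].
  + by rewrite gcomp0 (sl0 bsl); apply: homog0.
  + by rewrite gcompD (slD bsl); apply: homogD.
  rewrite (gcomp_tn _ ha hb); case: eqP => [->|_].
    by rewrite tens_barE; apply: homog_tn; apply: gbar_homog.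
  by rewrite (sl0 bsl); apply: homog0.
- move=> p q x y <- <-; move: x; apply: gtens_hind => [|x x' h h'|r s a b ha hb].
  + by rewrite gcomp0 mul0r (sl0 bsl) mulr0 scaler0.
  + by rewrite gcompD mulrDl !(slD bsl) h h' mulrDr scalerDr.
  rewrite (gcomp_tn _ ha hb); case: eqP => [->|_]; last first.
    by rewrite mul0r (sl0 bsl) mulr0 scaler0.
  move: y; apply: gtens_hind => [|y y' h h'|r' s' a' b' ha' hb'].
  + by rewrite gcomp0 mulr0 (sl0 bsl) mul0r scaler0.
  + by rewrite gcompD mulrDr !(slD bsl) h h' mulrDl scalerDr.
  rewrite (gcomp_tn _ ha' hb'); case: eqP => [->|_]; last first.
    by rewrite mulr0 (sl0 bsl) mul0r scaler0.
  rewrite (tnM _ _ hb ha') (sl_sign bsl) !tens_barE.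
  rewrite (tnM _ _ (gbar_homog BP hb') (gbar_homog AP ha)).
  rewrite (gbarM AP ha ha') (gbarM BP hb hb') tnZl tnZr !scalerA -!exprD.
  apply: (congr1 (fun x : C => x *: _)); apply: sign_parity; rewrite !(oddD, oddM).
  by case: (odd r); case: (odd s); case: (odd r'); case: (odd s').
- move=> p x <-; move: x; apply: gtens_hind => [|x y hx hy|q r a b ha hb].
  + by rewrite gcomp0 (lin0 dl); apply: homog0.
  + by rewrite gcompD (linD dl); apply: homogD.
  rewrite (gcomp_tn _ ha hb); case: eqP => [->|_].
    rewrite (tens_difE _ ha); apply: homogD.
      by rewrite -addSn; apply: homog_tn => //; apply: gdif_homog.
    by apply: homogZ; rewrite -addnS; apply: homog_tn => //; apply: gdif_homog.
  by rewrite (lin0 dl); apply: homog0.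
- move=> p x y <-; move: x; apply: gtens_hind => [|x x' h h'|r s a b ha hb].
  + by rewrite gcomp0 (lin0 dl) !mul0r (lin0 dl) scaler0 addr0.
  + by rewrite gcompD (linD dl) !mulrDl (linD dl) h h' scalerDr addrACA.
  rewrite (gcomp_tn _ ha hb); case: eqP => [->|_]; last first.
    by rewrite (lin0 dl) !mul0r (lin0 dl) scaler0 addr0.
  move: y; apply: gtens_hind => [|y y' h h'|r' s' a' b' ha' hb'].
  + by rewrite (lin0 dl) !mulr0 (lin0 dl) scaler0 addr0.
  + by rewrite (linD dl) !mulrDr (linD dl) h h' scalerDr addrACA.
  rewrite (tnM _ _ hb ha') (linZ dl) !(tens_difE _ ha) (tens_difE _ ha').
  rewrite (tens_difE _ (homogM ha ha')).
  rewrite mulrDl mulrDr pzmulZl pzmulZr (tnM _ _ hb ha').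
  rewrite (tnM _ _ (gdif_homog BP hb) ha') (tnM _ _ hb (gdif_homog AP ha')).
  rewrite (tnM _ _ hb ha') (gdifM AP _ ha) (gdifM BP _ hb).
  rewrite tnDl tnDr tnZl tnZr.
  apply: scale_comb4; rewrite -?exprD;
  apply: sign_parity; rewrite !(oddD, oddM, oddS);
  by case: (odd r); case: (odd s); case: (odd r'); case: (odd s').
- apply: gtens_hind => [|x y hx hy|p q a b ha hb].
  + by rewrite !(lin0 dl).
  + by rewrite !(linD dl) hx hy addr0.
  rewrite (tens_difE _ ha) (linD dl) (linZ dl) (tens_difE _ (gdif_homog AP ha)).
  rewrite (tens_difE _ ha) !gdif2 // tn0l tn0r scaler0 addr0 add0r exprS mulN1r.
  by rewrite scaleNr addNr.
apply: gtens_hind => [|x y hx hy|p q a b ha hb].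
- by rewrite (lin0 dl) !(sl0 bsl) (lin0 dl).
- by rewrite (linD dl) !(slD bsl) (linD dl) hx hy.
rewrite tens_barE (tens_difE _ ha) (tens_difE _ (gbar_homog AP ha)).
by rewrite (slD bsl) (sl_sign bsl) !tens_barE !gdif_bar.
Qed.

End TensorGida.

End TensorGidas.

(** * Opposite algebras *)

Section Opposite.
Context (C : comNzRingType) (A : gradedAlg C).

(** The product is reversed without the sign (-1)^(pq); that sign is restored by the twist in
    [exists_antipode]. *)
Definition op_alg : pzAlg C :=
  @PzAlg C A 1 (fun x y => y * x) (fun x y z => esym (mulrA z y x))
    (fun x => mulr1 x) (fun x => mul1r x) (fun x y z => mulrDr z x y)
    (fun x y z => mulrDl y z x) (fun a x y => pzscalerAr a y x)
    (fun a x y => pzscalerAl a y x).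

Definition op_comp (p : nat) : op_alg -> op_alg := @gcomp C A p.

Fact op_compM p q (x y : op_alg) :
  op_comp (p + q) (op_comp p x * op_comp q y) = op_comp p x * op_comp q y.
Proof. by rewrite addnC; have := @gcompM C A q p y x. Qed.

Definition gop : gradedAlg C :=
  @GradedAlg C op_alg op_comp (@gcomp_linear C A) (@gcompK C A)
    (@gcomp_sum C A) (@gcomp1 C A) op_compM.

Definition toop (x : A) : gop := x.
Definition ofop (x : gop) : A := x.

Lemma toopM (x y : A) : toop (x * y) = toop y * toop x. Proof. by []. Qed.
Lemma ofopM (x y : gop) : ofop (x * y) = ofop y * ofop x. Proof. by []. Qed.
Lemma homog_toop p (x : A) : homog p x -> homog p (toop x). Proof. by []. Qed.
Lemma homog_ofop p (x : gop) : homog p x -> homog p (ofop x). Proof. by []. Qed.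
Lemma toop_linear : linear toop. Proof. by []. Qed.
Lemma ofop_linear : linear ofop. Proof. by []. Qed.

Context (d : A -> A) (dP : is_dga d).

(** For the unsigned opposite product, d satisfies a Leibniz rule with the sign on the wrong factor.
    The factor (-1)^p in degree p moves it to the right one. *)
Definition op_dif (x : gop) : gop := toop (d (gsign (ofop x))).

Lemma op_difE p (x : gop) : homog p x ->
  op_dif x = (-1) ^+ p *: toop (d (ofop x)).
Proof.
move=> hx; rewrite /op_dif (gsignE (homog_ofop hx)) (linZ (dga_linear dP)).
by rewrite (linZ toop_linear).
Qed.

Lemma op_dga : is_dga op_dif.
Proof.
have dl := dga_linear dP.
have l : linear op_dif.
  move=> a x y; rewrite /op_dif; have := ofop_linear a x y => ->.
  by rewrite gsign_linear dl; apply: toop_linear.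
split=> //.
- move=> p x hx; rewrite (op_difE hx); apply: homogZ; apply: homog_toop.
  exact/(dga_homog dP)/homog_ofop.
- move=> p x y hx; move: y; apply: gcomp_ind => [|y y' h h'|q y hy].
  + by rewrite mulr0 (lin0 l) !mulr0 scaler0 addr0.
  + by rewrite mulrDr !(linD l) !mulrDr h h' scalerDr addrACA.
  rewrite (op_difE hx) (op_difE hy) (op_difE (homogM hx hy)) ofopM.
  rewrite (dgaM dP _ (homog_ofop hy)) (linD toop_linear) (linZ toop_linear).
  rewrite !toopM scalerDr !scalerA pzmulZl pzmulZr scalerA addrC -!exprD.
  congr (_ + _); apply: (congr1 (fun c : C => c *: _)); apply: sign_parity.
  by rewrite !oddD addbK.
move=> x; move: x; apply: gcomp_ind => [|y y' h h'|q y hy].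
- by rewrite !(lin0 l).
- by rewrite !(linD l) h h' addr0.
rewrite (op_difE hy) (linZ l) (op_difE (homog_toop (dga_homog dP (homog_ofop hy)))).
rewrite -[ofop (toop _)]/(d (ofop y)) (dga2 dP) (lin0 toop_linear).
by rewrite !scaler0.
Qed.

End Opposite.

(** * Free algebras and presentations *)

Section FreeWords.
Context (C : comNzRingType) (X : choiceType).

Definition fword (s : seq X) : free C X := \prod_(x <- s) fgen C x.

Lemma monalg_word_prod (m : fmonom X) :
  monalg_word C m = fword (m : seq X).
Proof.
case: m => s /=; elim: s => [|x s IH].
  rewrite /fword big_nil; have -> : FMonom [::] = mone :> fmonom X by apply: val_inj; rewrite /= fm1.
  by [].
rewrite /fword big_cons -[\big[_/_]_(_ <- s) _]IH /fgen monalg_wordM; congr monalg_word.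
by apply: val_inj; rewrite /= fmM fmuE.
Qed.

Lemma fword_monalg (s : seq X) : fword s = monalg_word C (FMonom s).
Proof. by rewrite monalg_word_prod. Qed.

Lemma fword0 : fword [::] = 1. Proof. exact: big_nil. Qed.
Lemma fword_cons x s : fword (x :: s) = fgen C x * fword s.
Proof. exact: big_cons. Qed.
Lemma fword_cat s t : fword (s ++ t) = fword s * fword t.
Proof. exact: big_cat. Qed.

Lemma free_word_ind (P : free C X -> Prop) : P 0 ->
    (forall x y, P x -> P y -> P (x + y)) ->
    (forall a (s : seq X), P (a *: fword s)) ->
  forall y, P y.
Proof. by move=> P0 PD Pw; apply: monalg_ind => // a m; rewrite monalg_word_prod. Qed.

Lemma homog_fword (deg : X -> nat) (s : seq X) :
  homog (wdeg deg s) (fword s : gfree C deg).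
Proof.
rewrite fword_monalg /homog /=.
have := monalg_compU C (fun w : fmonom X => wdeg deg w) (wdeg deg s) (FMonom s).
by rewrite eqxx.
Qed.

Lemma free_eval_linear (A : pzAlg C) (f : X -> A) : linear (free_eval f).
Proof. by move=> a x y; apply: (mextP idfun). Qed.

Lemma free_eval_word (A : pzAlg C) (f : X -> A) (s : seq X) :
  free_eval f (fword s) = \prod_(x <- s) f x.
Proof. by rewrite fword_monalg; apply: (mextU idfun). Qed.

Lemma free_dif_linear (deg : X -> nat) (dx : X -> free C X) :
  linear (free_dif deg dx).
Proof. by move=> a x y; apply: (mextP idfun). Qed.

Lemma free_dif_word (deg : X -> nat) (dx : X -> free C X) s :
  free_dif deg dx (fword s) = word_dif deg dx s.
Proof. by rewrite fword_monalg; apply: (mextU idfun). Qed.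

Definition free_lin (V : lmodType C) (f : seq X -> V) : free C X -> V :=
  mext idfun (fun w : {fmonom X} => f w).

Lemma free_lin_linear (V : lmodType C) (f : seq X -> V) : linear (free_lin f).
Proof. by move=> a x y; apply: (mextP idfun). Qed.

Lemma free_lin_word (V : lmodType C) (f : seq X -> V) s :
  free_lin f (fword s) = f s.
Proof. by rewrite fword_monalg; apply: (mextU idfun). Qed.

End FreeWords.

Section FreeBarWords.
Context (C : numClosedFieldType) (X : choiceType) (deg : X -> nat) (bx : X -> X).

Lemma free_bar_semilin : semilin Num.conj (free_bar (C := C) deg bx).
Proof. by move=> a x y; apply: (mextP Num.conj). Qed.

Lemma free_bar_word s : free_bar deg bx (fword C s) = word_bar C deg bx s.
Proof. by rewrite fword_monalg; apply: (mextU Num.conj). Qed.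

End FreeBarWords.

Section FreeTheory.
(* The concrete free algebra computes: conversion tests on its products are   *)
(* very costly, so that its theory is derived from these abstract properties. *)
Context (C : comNzRingType) (X : choiceType) (deg : X -> nat).
Context (F : gradedAlg C) (gen : X -> F) (word : seq X -> F).
Hypothesis word0 : word [::] = 1.
Hypothesis word_cons : forall x s, word (x :: s) = gen x * word s.
Hypothesis word_ind : forall P : F -> Prop, P 0 ->
    (forall x y, P x -> P y -> P (x + y)) ->
    (forall a (s : seq X), P (a *: word s)) ->
  forall y, P y.
Hypothesis homog_word : forall s, homog (wdeg deg s) (word s).

Let word_cat s t : word (s ++ t) = word s * word t.
Proof.
by elim: s => [|x s IH] /=; rewrite ?word0 ?mul1r // !word_cons IH mulrA.
Qed.

Lemma homog_gen x : homog (deg x) (gen x).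
Proof.
have := homog_word [:: x]; rewrite word_cons word0 mulr1.
by rewrite /wdeg big_seq1.
Qed.

Lemma word_generated : generated deg gen.
Proof.
split=> [x|P P1 PD Pg]; first exact: homog_gen.
have P0 : P 0 by have := PD (-1) _ _ P1 P1; rewrite scaleN1r addNr.
apply: word_ind => // [x y hx hy|a s].
  by rewrite -[x]scale1r; apply: PD.
rewrite -[_ *: _]addr0; apply: PD => //; elim: s => [|x s IH].
  by rewrite word0.
by rewrite word_cons; apply: Pg (homog_word s) IH.
Qed.

Lemma eval_gen (A : pzAlg C) (f : X -> A) (ev : F -> A) :
  (forall s, ev (word s) = \prod_(x <- s) f x) -> forall x, ev (gen x) = f x.
Proof. by move=> h x; have := h [:: x]; rewrite word_cons word0 mulr1 big_seq1. Qed.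

Lemma eval_hom (A : pzAlg C) (f : X -> A) (ev : F -> A) : linear ev ->
  (forall s, ev (word s) = \prod_(x <- s) f x) -> alg_hom ev.
Proof.
move=> l h; split=> //; split; first by rewrite -word0 h big_nil.
apply: word_ind => [y|x x' hx hx' y|a s].
- by rewrite mul0r (lin0 l) mul0r.
- by rewrite mulrDl !(linD l) hx hx' mulrDl.
apply: word_ind => [|x x' hx hx'|b t].
- by rewrite mulr0 (lin0 l) mulr0.
- by rewrite mulrDr !(linD l) hx hx' mulrDr.
rewrite pzmulZl pzmulZr !(linZ l) pzmulZl pzmulZr -word_cat.
by rewrite !h big_cat.
Qed.

Section Dif.
Context (dx : X -> F) (d : F -> F) (dl : linear d).
Hypothesis d0 : d (word [::]) = 0.
Hypothesis dcons : forall x s, d (word (x :: s)) =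
  dx x * word s + (-1) ^+ deg x *: (gen x * d (word s)).

Lemma dif1 : d 1 = 0. Proof. by rewrite -word0. Qed.

Let dgenM x (y : F) :
  d (gen x * y) = dx x * y + (-1) ^+ deg x *: (gen x * d y).
Proof.
move: y; apply: word_ind => [|y y' h h'|a s].
- by rewrite !(mulr0, lin0 dl) scaler0 addr0.
- by rewrite !mulrDr !(linD dl) h h' mulrDr scalerDr addrACA.
rewrite !pzmulZr !(linZ dl) pzmulZr -word_cons.
by rewrite dcons scalerDr !scalerA mulrC.
Qed.

Lemma dif_gen x : d (gen x) = dx x.
Proof. by rewrite -[gen x]mulr1 dgenM dif1 !mulr1 mulr0 scaler0 addr0. Qed.

Lemma difM p (x y : F) : homog p x ->
  d (x * y) = d x * y + (-1) ^+ p *: (x * d y).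
Proof.
suff h (z : F) : d (z * y) = d z * y + gsign z * d y.
  by move=> hx; rewrite h (gsignE hx) pzmulZl.
(* With [gsign] in place of (-1)^p, the Leibniz rule makes sense for every z and can be proved by
   induction on z. *)
have sl := @gsign_linear C F.
move: z; apply: (gen_ind word_generated) => [|a z z' hz hz'|z q w hw IH].
- by rewrite dif1 !mul1r mul0r (gsignE (homog1 F)) scale1r mul1r add0r.
- rewrite mulrDl pzmulZl !dl sl hz hz' !mulrDl !pzmulZl scalerDr.
  by rewrite addrACA.
rewrite -mulrA !dgenM IH (gsignE (homogM (homog_gen z) hw)) (gsignE hw).
rewrite mulrDr mulrDl !pzmulZl !pzmulZr !scalerDr !scalerA exprD -!mulrA.
by rewrite addrA.
Qed.

Hypothesis dxh : forall x, homog (deg x).+1 (dx x : F).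

Lemma dif_homog p (x : F) : homog p x -> homog p.+1 (d x).
Proof.
move=> <-; move: x p; apply: (gen_ind word_generated) => [p|a x y hx hy p|x q y hy IH p].
- rewrite (homogE _ (homog1 F)); case: eqP => _; rewrite ?dif1 ?(lin0 dl);
  exact: homog0.
- by rewrite gcompZD dl; apply: homogD; [apply: homogZ|].
rewrite (homogE _ (homogM (homog_gen x) hy)); case: eqP => [->|_]; last first.
  by rewrite (lin0 dl); apply: homog0.
rewrite dgenM; apply: homogD; first by rewrite -addSn; apply: homogM.
by apply: homogZ; rewrite -addnS; apply: homogM; [apply: homog_gen|rewrite -hy].
Qed.

(** The cross terms of d d (g y) cancel, so d d is a derivation and its values are controlled by
    those on generators. Membership in J replaces vanishing because d(det^-1) contains det^-1 and d
    det, whose products vanish only modulo the relations. *)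
Lemma dif2 (J : gideal F) : (forall x, J (d (dx x))) -> forall x, J (d (d x)).
Proof.
move=> dJ; apply: (gen_ind word_generated) => [|a x y hx hy|x q y hy IH].
- by rewrite dif1 (lin0 dl); apply: sub0 (sub_ax J).
- by rewrite !dl; apply: (subP (sub_ax J)).
rewrite dgenM (linD dl) (linZ dl) (difM _ (dxh x)) dgenM.
rewrite scalerDr exprS mulN1r scaleNr addrA subrK scalerA.
apply: subD; first exact: idealM_r.
by apply: subZ; apply: idealM_l.
Qed.

End Dif.

End FreeTheory.

Section FreeBar.
Context (C : numClosedFieldType) (X : choiceType) (deg : X -> nat) (bx : X -> X).
Hypothesis bxh : forall x, deg (bx x) = deg x.
Context (F : gradedAlg C) (gen : X -> F) (word : seq X -> F).
Hypothesis word0 : word [::] = 1.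
Hypothesis word_cons : forall x s, word (x :: s) = gen x * word s.
Hypothesis word_ind : forall P : F -> Prop, P 0 ->
    (forall x y, P x -> P y -> P (x + y)) ->
    (forall a (s : seq X), P (a *: word s)) ->
  forall y, P y.
Hypothesis homog_word : forall s, homog (wdeg deg s) (word s).
Let Fg : generated deg gen := word_generated word0 word_cons word_ind homog_word.

Context (bar : F -> F) (bl : semilin Num.conj bar).
Hypothesis bar0 : bar (word [::]) = 1.
Hypothesis barwM : forall x s, bar (word (x :: s)) =
  (-1) ^+ (deg x * wdeg deg s) *: (bar (word s) * gen (bx x)).

Lemma bar1 : bar 1 = 1.
Proof. by rewrite -[in LHS]word0. Qed.

Let bargM x q (y : F) : homog q y ->
  bar (gen x * y) = (-1) ^+ (deg x * q) *: (bar y * gen (bx x)).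
Proof.
move=> <-; move: y; apply: word_ind => [|y y' h h'|a s].
- by rewrite gcomp0 mulr0 (sl0 bl) mul0r scaler0.
- by rewrite gcompD mulrDr !(slD bl) h h' mulrDl scalerDr.
rewrite gcompZ (homogE _ (homog_word s)); case: eqP => [->|_].
  by rewrite pzmulZr !(slZ bl) -word_cons barwM pzmulZl !scalerA mulrC.
by rewrite scaler0 mulr0 (sl0 bl) mul0r scaler0.
Qed.

Lemma bar_gen x : bar (gen x) = gen (bx x).
Proof.
by rewrite -[gen x]mulr1 (bargM _ (homog1 F)) bar1 muln0 scale1r mul1r.
Qed.

Lemma bar_homog p (x : F) : homog p x -> homog p (bar x).
Proof.
move=> <-; move: x p.
apply: (gen_ind Fg) => [p|a x y hx hy p|x q y hy IH p].
- rewrite (homogE _ (homog1 F)); case: eqP => [->|_].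
    by rewrite bar1; apply: homog1.
  by rewrite (sl0 bl); apply: homog0.
- by rewrite gcompZD bl; apply: homogD; [apply: homogZ|].
rewrite (homogE _ (homogM (gen_homog Fg x) hy)); case: eqP => [->|_].
  rewrite (bargM _ hy) addnC; apply/homogZ/homogM; first by rewrite -hy.
  by rewrite -bxh; apply: (gen_homog Fg).
by rewrite (sl0 bl); apply: homog0.
Qed.

Lemma barM p q (x y : F) : homog p x -> homog q y ->
  bar (x * y) = (-1) ^+ (p * q) *: (bar y * bar x).
Proof.
move=> <- hy; move: x p.
apply: (gen_ind Fg) => [p|a x z hx hz p|x r z hz IH p].
- rewrite (homogE _ (homog1 F)); case: eqP => [->|_].
    by rewrite mul1r bar1 mulr1 scale1r.
  by rewrite mul0r (sl0 bl) mulr0 scaler0.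
- rewrite gcompZD mulrDl pzmulZl !bl hx hz mulrDr scalerDr.
  by rewrite !pzmulZr !scalerA mulrC.
rewrite (homogE _ (homogM (gen_homog Fg x) hz)); case: eqP => [->|_].
  rewrite -mulrA (bargM _ (homogM hz hy)) -[z]hz (IH r) hz (bargM _ hz).
  rewrite pzmulZl pzmulZr !scalerA -!exprD mulrA.
  apply: (congr1 (fun c : C => c *: _)); apply: sign_parity.
  by rewrite !(oddD, oddM); case: (odd (deg x)); case: (odd r); case: (odd q).
by rewrite mul0r (sl0 bl) mulr0 scaler0.
Qed.

Hypothesis bxK : involutive bx.

Lemma barK : involutive bar.
Proof.
apply: (gen_ind Fg) => [|a x y hx hy|x p y hy IH].
- by rewrite !bar1.
- by rewrite !bl /= conjCK hx hy.
rewrite (bargM _ hy) (sl_sign bl).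
have hb : homog (deg x) (gen (bx x) : F) by rewrite -bxh; apply: (gen_homog Fg).
rewrite (barM (bar_homog hy) hb) IH bar_gen bxK scalerA -exprD.
by rewrite mulnC -signr_odd oddD addbb scale1r.
Qed.

Context (dx : X -> F).
Hypothesis dxh : forall x, homog (deg x).+1 (dx x : F).
Context (d : F -> F) (dl : linear d).
Hypothesis d1 : d 1 = 0.
Hypothesis d_gen : forall x, d (gen x) = dx x.
Hypothesis dM : forall p x y, homog p x ->
  d (x * y) = d x * y + (-1) ^+ p *: (x * d y).
Hypothesis dh : forall p x, homog p x -> homog p.+1 (d x).

Lemma dif_bar (J : gideal F) :
    (forall x, J (d (gen (bx x)) - bar (dx x))) ->
  forall x, J (d (bar x) - bar (d x)).
Proof.
move=> h; apply: (gen_ind Fg) => [|a x y hx hy|x p y hy IH].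
- rewrite bar1 d1 (sl0 bl) subr0; exact: sub0 (sub_ax J).
- rewrite bl !dl bl opprD addrACA -scalerBr.
  by apply: (subP (sub_ax J)).
have hg := gen_homog Fg x.
have hgb : homog (deg x) (gen (bx x) : F) by rewrite -bxh; apply: (gen_homog Fg).
rewrite (bargM _ hy) (linZ dl) (dM _ (bar_homog hy)).
rewrite (dM _ hg) (d_gen x) (slD bl) (sl_sign bl).
rewrite (barM (dxh x) hy) (bargM _ (dh hy)).
rewrite scalerDr !scalerA -!exprD.
have e1 : (-1) ^+ (deg x + deg x * p.+1) = (-1) ^+ (deg x * p) :> C.
  by apply: sign_parity; rewrite mulnS addnA oddD oddD addbb.
have e2 : (-1) ^+ ((deg x).+1 * p) = (-1) ^+ (deg x * p + p) :> C.
  by congr (_ ^+ _); rewrite mulSn addnC.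
rewrite e1 e2 [X in _ - X]addrC opprD addrACA -!scalerBr -mulrBl -mulrBr.
apply: subD; first by apply: subZ; apply: idealM_r.
by apply: subZ; apply: idealM_l.
Qed.

End FreeBar.

(** * Quotients by graded ideals and stability of ideals under bar and d *)

Section Quotients.
Context (C : comNzRingType) (A : gradedAlg C) (J : gideal A).
Local Notation pi := (qproj J : A -> gquot J).

Lemma qproj_hom : alg_hom pi.
Proof.
split; first by move=> a x y; rewrite -qprojZ -qprojD.
by split=> // x y; apply: qprojM.
Qed.

Lemma gcomp_qproj p x : gcomp p (pi x) = pi (gcomp p x).
Proof. exact: gqcompE. Qed.

Lemma homog_qproj p x : homog p x -> homog p (pi x).
Proof. by move=> hx; rewrite /homog gcomp_qproj hx. Qed.

Lemma qproj_surj (y : gquot J) : exists x, y = pi x.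
Proof. by exists (qrepr y); rewrite qreprK. Qed.

Lemma qproj_homog_surj p (y : gquot J) : homog p y ->
  exists2 x, homog p x & y = pi x.
Proof.
move=> hy; have [x e] := qproj_surj y; exists (gcomp p x).
  exact: homog_gcomp.
by rewrite -gcomp_qproj -e.
Qed.

Lemma qproj_ker x : J x -> pi x = 0.
Proof. by move/(qproj_eq0 J). Qed.
Lemma qproj_eq x y : J (x - y) -> pi x = pi y.
Proof. by move/(qprojP J). Qed.
Lemma ker_qproj x : pi x = 0 -> J x.
Proof. by move/(qproj_eq0 J). Qed.

Lemma quot_generated (X : Type) (deg : X -> nat) (g : X -> A) :
  generated deg g -> generated deg (fun x => pi (g x)).
Proof.
move=> Ag; split=> [x|P P1 PD Pg y].
  by apply: homog_qproj; apply: gen_homog Ag x.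
have [x ->] := qproj_surj y.
have piP := qproj_hom.
suff h z : forall p, P (pi (gcomp p z)).
  have P0 : P 0 by have := PD (-1) _ _ P1 P1; rewrite scaleN1r addNr.
  have [N ->] := gcomp_sum x; rewrite (lin_sum (ah_linear piP)).
  by apply: big_ind => // u v hu hv; rewrite -[u]scale1r; apply: PD.
have P0 : P 0 by have := PD (-1) _ _ P1 P1; rewrite scaleN1r addNr.
move: z; apply: (gen_ind Ag) => [p|a z z' h h' p|z q w hw IH p].
- rewrite (homogE _ (homog1 A)); case: eqP => _; last by rewrite (lin0 (ah_linear piP)).
  by rewrite (ah1 piP).
- by rewrite gcompZD (ah_linear piP); apply: PD.
rewrite (homogE _ (homogM (gen_homog Ag z) hw)); case: eqP => _; last by rewrite (lin0 (ah_linear piP)).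
rewrite (ahM piP) -hw; apply: (Pg _ q) => //.
by apply: homog_qproj; apply: homog_gcomp.
Qed.

Lemma quot_lift (B : pzAlg C) (f : A -> B) : alg_hom f ->
    (forall x, J x -> f x = 0) ->
  (forall x, f (qrepr (pi x)) = f x) /\
  alg_hom (fun y : gquot J => f (qrepr y)).
Proof.
move=> fP fJ; have piP := qproj_hom.
have e x : f (qrepr (pi x)) = f x.
  apply/eqP; rewrite -subr_eq0 -(linB (ah_linear fP)); apply/eqP/fJ.
  exact: (qrepr_proj J x).
split=> //; split.
  move=> a u v; have [x ->] := qproj_surj u; have [y ->] := qproj_surj v.
  by rewrite -(ah_linear piP) !e (ah_linear fP).
split; first by rewrite -(ah1 piP) e (ah1 fP).
move=> u v; have [x ->] := qproj_surj u; have [y ->] := qproj_surj v.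
by rewrite -(ahM piP) !e (ahM fP).
Qed.

End Quotients.

Section QuotientGida.
Context (C : numClosedFieldType) (A : gradedAlg C) (bA dA : A -> A).
Context (J : gideal A).
Hypothesis bl : semilin Num.conj bA.
Hypothesis bh : forall p x, homog p x -> homog p (bA x).
Hypothesis bM : forall p q (x y : A), homog p x -> homog q y ->
  bA (x * y) = (-1) ^+ (p * q) *: (bA y * bA x).
Hypothesis dl : linear dA.
Hypothesis dh : forall p x, homog p x -> homog p.+1 (dA x).
Hypothesis dM : forall p x y, homog p x ->
  dA (x * y) = dA x * y + (-1) ^+ p *: (x * dA y).
Hypothesis bJ : forall x, J x -> J (bA x).
Hypothesis dJ : forall x, J x -> J (dA x).
Hypothesis bKJ : forall x, J (bA (bA x) - x).
Hypothesis d2J : forall x, J (dA (dA x)).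
Hypothesis dbJ : forall x, J (dA (bA x) - bA (dA x)).

Let Q := gida_quot (A := @GidaData C A bA dA) J.
Local Notation pi := (qproj J : A -> gquot J).

Lemma quot_barE x : gbar (pi x : Q) = pi (bA x).
Proof. by apply: qmapE => // u v; apply: (slB bl). Qed.
Lemma quot_difE x : gdif (pi x : Q) = pi (dA x).
Proof. by apply: qmapE => // u v; apply: (linB dl). Qed.

Lemma quot_gidaP : is_gida Q.
Proof.
have piP := qproj_hom J; have pl := ah_linear piP.
split.
- move=> a u v; have [x ->] := qproj_surj u; have [y ->] := qproj_surj v.
  by rewrite -pl (quot_barE x) (quot_barE y) (quot_barE (a *: x + y)) -pl bl.
- move=> u; have [x ->] := qproj_surj u; rewrite (quot_barE x) (quot_barE (bA x)).
  exact: (qproj_eq (bKJ x)).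
- move=> p u hu; have [x hx ->] := qproj_homog_surj hu.
  by rewrite quot_barE; apply: homog_qproj; apply: bh.
- move=> p q u v hu hv; have [x hx ->] := qproj_homog_surj hu.
  have [y hy ->] := qproj_homog_surj hv.
  rewrite -(ahM piP) (quot_barE x) (quot_barE y) (quot_barE (x * y)).
  by rewrite (bM hx hy) (linZ pl) (ahM piP).
- move=> a u v; have [x ->] := qproj_surj u; have [y ->] := qproj_surj v.
  by rewrite -pl (quot_difE x) (quot_difE y) (quot_difE (a *: x + y)) -pl dl.
- move=> p u hu; have [x hx ->] := qproj_homog_surj hu.
  by rewrite quot_difE; apply: homog_qproj; apply: dh.
- move=> p u v hu; have [x hx ->] := qproj_homog_surj hu.
  have [y ->] := qproj_surj v.
  rewrite -(ahM piP) (quot_difE x) (quot_difE y) (quot_difE (x * y)).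
  by rewrite (dM _ hx) (linD pl) (linZ pl) !(ahM piP).
- move=> u; have [x ->] := qproj_surj u; rewrite (quot_difE x) (quot_difE (dA x)).
  exact: (qproj_ker (d2J x)).
move=> u; have [x ->] := qproj_surj u.
rewrite (quot_barE x) (quot_difE x) (quot_difE (bA x)) (quot_barE (dA x)).
exact: (qproj_eq (dbJ x)).
Qed.

End QuotientGida.

Section StableIdealBar.
Context (C : numClosedFieldType) (A : gradedAlg C) (rel : set A).
Hypothesis relh : forall r, rel r -> exists p, homog p r.
Local Notation J := (gideal_gen rel).

Lemma gideal_gen_bar (bA : A -> A) : semilin Num.conj bA ->
    (forall p q (x y : A), homog p x -> homog q y ->
       bA (x * y) = (-1) ^+ (p * q) *: (bA y * bA x)) ->
  (forall r, rel r -> J (bA r)) -> forall x, J x -> J (bA x).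
Proof.
move=> bl bM bJ; apply: (gideal_gen_min (Z := fun x => J (bA x))) => //.
- split; first by rewrite /= (sl0 bl); apply: sub0 (sub_ax J).
  by move=> a x y hx hy /=; rewrite bl; apply: (subP (sub_ax J)).
- move=> p q x y hx hy Zx; rewrite (bM _ _ _ _ hx hy) (bM _ _ _ _ hy hx).
  by split; apply: subZ; [apply: idealM_l|apply: idealM_r].
Qed.

End StableIdealBar.

Section StableIdeals.
Context (C : comNzRingType) (A : gradedAlg C) (rel : set A).
Hypothesis relh : forall r, rel r -> exists p, homog p r.
Local Notation J := (gideal_gen rel).

Lemma gideal_gen_dif (dA : A -> A) : linear dA ->
    (forall p x y, homog p x -> dA (x * y) = dA x * y + (-1) ^+ p *: (x * dA y)) ->
  (forall r, rel r -> J (dA r)) -> forall x, J x -> J (dA x).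
Proof.
move=> dl dM dJ x Jx.
(* The Leibniz rule for d(xy) contains x itself, so membership of x is carried along in the
   induction. *)
suff [] : J x /\ J (dA x) by [].
move: x Jx; apply: (gideal_gen_min (Z := fun x => J x /\ J (dA x))) => //.
- split; first by rewrite /= (lin0 dl); split; apply: sub0 (sub_ax J).
  move=> a x y [hx hx'] [hy hy'] /=; rewrite dl.
  by split; apply: (subP (sub_ax J)).
- move=> p q x y hx hy [Jx Zx]; rewrite (dM _ _ _ hx) (dM _ _ _ hy).
  split; split.
  + exact: idealM_r.
  + by apply: subD; [apply: idealM_r|apply: subZ; apply: idealM_r].
  + exact: idealM_l.
  by apply: subD; [apply: idealM_l|apply: subZ; apply: idealM_l].
by move=> r hr; split; [apply: gideal_gen_sub|apply: dJ].
Qed.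

Lemma gideal_gen_hom (B : pzAlg C) (f : A -> B) : alg_hom f ->
  (forall r, rel r -> f r = 0) -> forall x, J x -> f x = 0.
Proof.
move=> fP fr; apply: (gideal_gen_min (Z := fun x => f x = 0)) => //.
- split; first exact: lin0 (ah_linear fP).
  by move=> a x y hx hy /=; rewrite (ah_linear fP) hx hy scaler0 addr0.
by move=> p q x y _ _ Zx; rewrite !(ahM fP) Zx mul0r mulr0.
Qed.

End StableIdeals.

Section Presentations.
Context (C : comNzRingType) (X : choiceType) (deg : X -> nat).
Local Notation F := (gfree C deg).

Lemma free_generated : @generated C F X deg (@fgen C X).
Proof.
apply: word_generated; [exact: fword0|exact: fword_cons| |exact: homog_fword].
exact: free_word_ind.
Qed.

Lemma free_eval_hom (A : pzAlg C) (f : X -> A) : alg_hom (free_eval f).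
Proof.
apply: (@eval_hom _ _ F (@fgen C X) (@fword C X)) (free_eval_linear f) (free_eval_word f).
- exact: fword0.
- exact: fword_cons.
exact: free_word_ind.
Qed.

Lemma free_eval_gen (A : pzAlg C) (f : X -> A) x : free_eval f (fgen C x) = f x.
Proof.
apply: (@eval_gen _ _ F (@fgen C X) (@fword C X)) (free_eval_word f) x.
- exact: fword0.
exact: fword_cons.
Qed.

Lemma free_eval_rel (A : pzAlg C) (f : X -> A) x y x' y' a :
  f x * f y = a *: (f y' * f x') ->
  free_eval f (fgen C x * fgen C y - a *: (fgen C y' * fgen C x')) = 0.
Proof.
move=> h; have eP := free_eval_hom f; have l := ah_linear eP.
apply: etrans (linB l _ _) _; apply/eqP; rewrite subr_eq0; apply/eqP.
rewrite -(free_eval_gen f x) -(free_eval_gen f y) in h.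
rewrite -(free_eval_gen f x') -(free_eval_gen f y') in h.
apply: etrans (ahM eP _ _) _; apply: etrans h _; apply: esym.
apply: etrans (linZ l _ _) _.
exact: (congr1 (fun z => a *: z) (ahM eP _ _)).
Qed.

Section PresLemmas.
Context (rel : set F).
Hypothesis relh : forall r, rel r -> exists p, homog p r.
Local Notation P := (pres rel).
Local Notation pp := (pproj rel : free C X -> P).

Lemma pproj_hom : alg_hom pp.
Proof. exact: (qproj_hom (gideal_gen rel)). Qed.

Lemma pproj_rel x y : rel (x - y) -> pp x = pp y.
Proof. by move=> h; apply: (qproj_eq (J := gideal_gen rel)); apply: gideal_gen_sub. Qed.

Lemma pgen_rel x y x' y' a :
  rel (fgen C x * fgen C y - a *: (fgen C y' * fgen C x') : free C X) ->
  pgen rel x * pgen rel y = a *: (pgen rel y' * pgen rel x').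
Proof.
move=> h; apply: etrans (esym (ahM pproj_hom _ _)) _.
apply: etrans (pproj_rel h) _; apply: etrans (linZ (ah_linear pproj_hom) _ _) _.
exact: (congr1 (fun z => a *: z) (ahM pproj_hom _ _)).
Qed.

Lemma pproj_fword s : pproj rel (fword C s) = \prod_(x <- s) pgen rel x.
Proof.
elim: s => [|x s IH]; first by rewrite big_nil fword0; apply: (ah1 pproj_hom).
rewrite big_cons fword_cons -IH; exact: (ahM pproj_hom).
Qed.

Lemma pgen_generated : generated deg (pgen rel).
Proof. exact: (quot_generated (gideal_gen rel) free_generated). Qed.

Section Lift.
Context (A : pzAlg C) (f : X -> A).
Hypothesis fr : forall r, rel r -> free_eval f r = 0.

Let lift := quot_lift (A := F) (free_eval_hom f) (gideal_gen_hom relh (free_eval_hom f) fr).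

Lemma plift_hom : alg_hom (plift (rel := rel) f).
Proof. exact: lift.2. Qed.
Lemma plift_pproj x : plift (rel := rel) f (pp x) = free_eval f x.
Proof. exact: lift.1. Qed.
Lemma plift_gen x : plift (rel := rel) f (pgen rel x) = f x.
Proof. by rewrite plift_pproj free_eval_gen. Qed.

End Lift.

End PresLemmas.

End Presentations.

Section GidaPres.
Context (C : numClosedFieldType) (X : choiceType) (deg : X -> nat).
Local Notation F := (gfree C deg).
Context (rel : set F) (bx : X -> X) (dx : X -> free C X).
Hypothesis relh : forall r, rel r -> exists p, homog p r.
Hypothesis bxh : forall x, deg (bx x) = deg x.
Hypothesis bxK : involutive bx.
Hypothesis dxh : forall x, homog (deg x).+1 (dx x : F).
Local Notation bar := (free_bar deg bx : F -> F).
Local Notation d := (free_dif deg dx : F -> F).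
Local Notation pp := (pproj rel : free C X -> gida_pres rel bx dx).

Lemma fdif_gen x : d (fgen C x) = dx x.
Proof.
apply: (@dif_gen C X deg F (@fgen C X) (@fword C X) _ _ _ dx d).
- exact: fword0.
- exact: fword_cons.
- exact: free_word_ind.
- exact: free_dif_linear.
- exact: (free_dif_word deg dx [::]).
by move=> y s; rewrite !free_dif_word.
Qed.

Lemma fdifM p (x y : F) : homog p x ->
  d (x * y) = d x * y + (-1) ^+ p *: (x * d y).
Proof.
apply: (@difM C X deg F (@fgen C X) (@fword C X) _ _ _ _ dx d).
- exact: fword0.
- exact: fword_cons.
- exact: free_word_ind.
- exact: homog_fword.
- exact: free_dif_linear.
- exact: (free_dif_word deg dx [::]).
by move=> z s; rewrite !free_dif_word.
Qed.

Lemma fdif1 : d 1 = 0.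
Proof. by rewrite -(fword0 C X) free_dif_word. Qed.

Lemma fdif_homog p (x : F) : homog p x -> homog p.+1 (d x).
Proof.
apply: (@dif_homog C X deg F (@fgen C X) (@fword C X) _ _ _ _ dx d).
- exact: fword0.
- exact: fword_cons.
- exact: free_word_ind.
- exact: homog_fword.
- exact: free_dif_linear.
- exact: (free_dif_word deg dx [::]).
- by move=> z s; rewrite !free_dif_word.
exact: dxh.
Qed.

Lemma fbar_gen x : bar (fgen C x) = fgen C (bx x).
Proof.
apply: (@bar_gen C X deg bx F (@fgen C X) (@fword C X) _ _ _ _ bar).
- exact: fword0.
- exact: fword_cons.
- exact: free_word_ind.
- exact: homog_fword.
- exact: free_bar_semilin.
- exact: (free_bar_word C deg bx [::]).
by move=> z s; rewrite !free_bar_word.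
Qed.

Lemma fbarM p q (x y : F) : homog p x -> homog q y ->
  bar (x * y) = (-1) ^+ (p * q) *: (bar y * bar x).
Proof.
apply: (@barM C X deg bx F (@fgen C X) (@fword C X) _ _ _ _ bar).
- exact: fword0.
- exact: fword_cons.
- exact: free_word_ind.
- exact: homog_fword.
- exact: free_bar_semilin.
- exact: (free_bar_word C deg bx [::]).
by move=> z s; rewrite !free_bar_word.
Qed.

(** In the free algebra bar is already an involution, whereas d d = 0 and d bar = bar d may hold
    only modulo the relations. Both propagate from the generators, whence the two hypotheses on
    [dx x]. *)
Lemma gida_presP :
    (forall r, rel r -> pp (bar r) = 0) -> (forall r, rel r -> pp (d r) = 0) ->
    (forall x, pp (d (dx x)) = 0) ->
    (forall x, pp (dx (bx x)) = pp (bar (dx x))) ->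
  [/\ is_gida (gida_pres rel bx dx),
      forall x, gbar (pp x) = pp (bar x) &
      forall x, gdif (pp x) = pp (d x)].
Proof.
move=> rb rd dd db; pose J := gideal_gen rel.
have bl := free_bar_semilin (C := C) deg bx.
have dl := free_dif_linear deg dx.
have bJ : forall x : F, J x -> J (bar x).
  apply: gideal_gen_bar => //; first exact: fbarM.
  by move=> r /rb /(qproj_eq0 J).
have dJ : forall x : F, J x -> J (d x).
  apply: gideal_gen_dif => //; first exact: fdifM.
  by move=> r /rd /(qproj_eq0 J).
have bK : forall x : F, bar (bar x) = x.
  apply: (@barK C X deg bx _ F (@fgen C X) (@fword C X) _ _ _ _ bar) => //.
  - exact: fword0.
  - exact: fword_cons.
  - exact: free_word_ind.
  - exact: homog_fword.
  - exact: (free_bar_word C deg bx [::]).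
  by move=> z s; rewrite !free_bar_word.
have bh : forall p (x : F), homog p x -> homog p (bar x).
  apply: (@bar_homog C X deg bx _ F (@fgen C X) (@fword C X) _ _ _ _ bar) => //.
  - exact: fword0.
  - exact: fword_cons.
  - exact: free_word_ind.
  - exact: homog_fword.
  - exact: (free_bar_word C deg bx [::]).
  by move=> z s; rewrite !free_bar_word.
have d2 : forall x : F, J (d (d x)).
  apply: (@dif2 C X deg F (@fgen C X) (@fword C X) _ _ _ _ dx d) => //.
  - exact: fword0.
  - exact: fword_cons.
  - exact: free_word_ind.
  - exact: homog_fword.
  - exact: (free_dif_word deg dx [::]).
  - by move=> z s; rewrite !free_dif_word.
  by move=> x; apply/(qproj_eq0 J); apply: dd.
have hdb : forall x : F, J (d (bar x) - bar (d x)).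
  apply: (@dif_bar C X deg bx _ F (@fgen C X) (@fword C X) _ _ _ _ bar bl _ _ dx _ d dl) => //.
  - exact: fword0.
  - exact: fword_cons.
  - exact: free_word_ind.
  - exact: homog_fword.
  - exact: (free_bar_word C deg bx [::]).
  - by move=> z s; rewrite !free_bar_word.
  - exact: fdif1.
  - exact: fdif_gen.
  - exact: fdifM.
  - exact: fdif_homog.
  by move=> x; rewrite fdif_gen; apply/(qprojP J); apply: db.
split.
- have bKJ : forall x : F, J (bar (bar x) - x).
    by move=> x; rewrite bK subrr; apply: sub0 (sub_ax J).
  exact: (@quot_gidaP C F bar d J bl bh fbarM dl fdif_homog fdifM bJ dJ bKJ d2 hdb).
- exact: (@quot_barE C F bar d J bl bJ).
exact: (@quot_difE C F bar d J dl dJ).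
Qed.

End GidaPres.

(** * The color determinant *)

Lemma scale_regular (C : pzRingType) (a : C) (b : C^o) : a *: b = a * b :> C.
Proof. by []. Qed.

Section WordSign.
Context (C : numClosedFieldType) (I : finType) (L : I -> I -> C) (r : seq I).

Definition wsign2 (x y : I) : C :=
  if (index y r < index x r)%N then - L x y else 1.

(* The coefficient of the reference word r in the word w, for generators      *)
(* subject to e_x e_y = - L x y e_y e_x.                                      *)
Fixpoint wsign (w : seq I) : C :=
  if w is x :: v then
    if x \in v then 0 else (\prod_(y <- v) wsign2 x y) * wsign v
  else 1.

(** Color analogue of an alternating function: such F are the linear maps on words that respect e_x
    e_y = - L x y e_y e_x. *)
Definition swapping (V : lmodType C) (F : seq I -> V) : Prop :=
  forall u x y v, F (u ++ x :: y :: v) = - L x y *: F (u ++ y :: x :: v).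

Lemma swapping_cons (V : lmodType C) (F : seq I -> V) k :
  swapping F -> swapping (fun w => F (k :: w)).
Proof. by move=> FP u x y v; rewrite -!cat_cons FP. Qed.

Hypothesis Lii : forall i, L i i = 1.
Hypothesis LV : forall i j, L i j * L j i = 1.

Let wsign2C x y : x != y -> x \in r -> y \in r ->
  wsign2 x y = - L x y * wsign2 y x.
Proof.
move=> xy xr yr; rewrite /wsign2; case: ltngtP => h.
- by rewrite mulr1.
- by rewrite mulNr mulrN opprK LV.
by case/eqP: xy; rewrite -(nth_index x xr) -(nth_index x yr) h.
Qed.

Hypothesis rI : forall i, i \in r.

Lemma wsign_swap : swapping (wsign : seq I -> C^o).
Proof.
elim=> [|z u IH] x y v /=; last first.
  have p : perm_eq (u ++ x :: y :: v) (u ++ y :: x :: v).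
    by rewrite perm_cat2l -(cat1s x) -(cat1s y) perm_catCA.
  rewrite (perm_mem p) (perm_big _ p) IH; case: ifP => _; first by rewrite scaler0.
  by rewrite !scale_regular !mulrA; congr (_ * _); rewrite mulrC.
rewrite !inE (eq_sym y x); case: eqP => [->|/eqP xy] /=.
  by rewrite scaler0.
case: (x \in v) => //=; first by case: ifP => _; rewrite ?mulr0 scaler0.
case: (y \in v) => //=; first by rewrite mulr0 scaler0.
rewrite !big_cons (wsign2C _ (rI x) (rI y)) //.
rewrite scale_regular -!mulrA; congr (_ * _); congr (_ * _).
by rewrite mulrCA.
Qed.

Lemma wsign_nuniq w : ~~ uniq w -> wsign w = 0.
Proof.
elim: w => //= x v IH; rewrite negb_and negbK => /orP[->//|h].
by rewrite IH // mulr0 if_same.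
Qed.

Lemma wsign_neq0 w : uniq w -> wsign w != 0.
Proof.
elim: w => [|x v IH] /=; first by rewrite oner_eq0.
case/andP=> /negbTE -> /IH h; rewrite mulf_neq0 // prodf_seq_neq0.
apply/allP => y _ /=; rewrite /wsign2; case: ifP => _; last exact: oner_neq0.
rewrite oppr_eq0; apply: contraTneq (oner_neq0 C) => e.
by rewrite -(LV x y) e mul0r eqxx.
Qed.

Hypothesis ru : uniq r.

Lemma wsign_ref : wsign r = 1.
Proof.
suff h u s : r = u ++ s -> wsign s = 1 by apply: (h [::]).
elim: s u => //= x s IH u e.
have := ru; rewrite e cat_uniq /= => /and3P[_ /norP[xu us] /andP[xs us']].
rewrite (negbTE xs) (IH (rcons u x)) ?cat_rcons // mulr1.
rewrite big_seq big1 // => y ys; rewrite /wsign2 ifF //.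
apply/negbTE; rewrite -leqNgt e !index_cat /= (negbTE xu) eqxx addn0.
by case: ifP => [yu|_]; [case/hasP: us; exists y|rewrite leq_addr].
Qed.

Let move_front x a b : exists c : C, forall (V : lmodType C) (F : seq I -> V),
  swapping F -> forall u, F (u ++ a ++ x :: b) = c *: F (u ++ x :: a ++ b).
Proof.
elim: a => [|z a [c IH]]; first by exists 1 => V F _ u; rewrite scale1r.
exists (c * - L z x) => V F FP u /=.
by rewrite -cat_rcons (IH V F FP) cat_rcons FP scalerA.
Qed.

(** The scalar is chosen before V and F: it depends on the two words only and can therefore be
    computed with any one swapping function. *)
Let perm_scalar w w' : perm_eq w w' ->
  exists c : C, forall (V : lmodType C) (F : seq I -> V),
    swapping F -> forall u, F (u ++ w) = c *: F (u ++ w').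
Proof.
elim: w' w => [|x t IH] w p.
  by exists 1 => V F _ u; rewrite (perm_nilP p) scale1r.
have xw : x \in w by rewrite (perm_mem p) mem_head.
case/splitPr: xw p => a b p.
have {}p : perm_eq (a ++ b) t.
  by rewrite -(perm_cons x); apply: perm_trans p; rewrite -cat1s perm_catCA.
have [c h] := IH _ p; have [c' h'] := move_front x a b.
exists (c' * c) => V F FP u.
by rewrite (h' V F FP) -cat_rcons (h V F FP) cat_rcons scalerA.
Qed.

(** Two equal letters can be brought next to each other, and exchanging them changes the sign
    because L x x = 1. *)
Lemma swapping_nuniq (V : lmodType C) (F : seq I -> V) w :
  swapping F -> ~~ uniq w -> F w = 0.
Proof.
move=> FP nw; suff h u : F (u ++ w) = 0 by apply: (h [::]).
elim: w nw u => //= x v IH; rewrite negb_and negbK => /orP[xv|nv] u; last first.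
  by rewrite -cat_rcons IH.
case/splitPr: xv => a b; have [c h] := move_front x a b.
rewrite -cat_rcons (h V F FP) cat_rcons.
have := FP u x x (a ++ b); rewrite Lii scaleN1r => /eqP.
rewrite -addr_eq0 -mulr2n -scaler_nat scaler_eq0 pnatr_eq0 /= => /eqP ->.
by rewrite scaler0.
Qed.

(** If w repeats a letter both sides vanish. Otherwise w is a rearrangement of r, and the scalar
    relating F w to F r is common to all swapping functions, hence is the one of [wsign], whose
    value on r is 1. *)
Lemma swapping_ref (V : lmodType C) (F : seq I -> V) w : swapping F ->
  size w = size r -> F w = wsign w *: F r.
Proof.
move=> FP sw; case: (boolP (uniq w)) => [uw|nw]; last first.
  by rewrite (swapping_nuniq FP) // wsign_nuniq // scale0r.
have p : perm_eq w r.
  apply: uniq_perm => //.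
  have sub : {subset w <= r} by move=> x _; apply: rI.
  by have [] := uniq_min_size uw sub; rewrite ?sw.
have [c h] := perm_scalar p.
have := h _ _ wsign_swap [::]; rewrite /= scale_regular wsign_ref mulr1 => ->.
exact: (h V F FP [::]).
Qed.

End WordSign.

Section WordSums.
Context (C : pzRingType) (I : finType) (V : lmodType C).

Fixpoint wsum (n : nat) (F : seq I -> V) : V :=
  if n is n'.+1 then \sum_i wsum n' (fun w => F (i :: w)) else F [::].

Lemma eq_wsum n F G : (forall w, size w = n -> F w = G w) -> wsum n F = wsum n G.
Proof.
elim: n F G => [|n IH] F G h /=; first exact: h.
by apply: eq_bigr => i _; apply: IH => w sw; apply: h; rewrite /= sw.
Qed.

Lemma wsumD n F G : wsum n (fun w => F w + G w) = wsum n F + wsum n G.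
Proof.
elim: n F G => //= n IH F G; rewrite -big_split; apply: eq_bigr => i _.
exact: IH.
Qed.
Lemma wsum0 n : wsum n (fun=> 0) = 0.
Proof. by elim: n => //= n IH; apply: big1. Qed.
Lemma wsum_sum n (J : finType) F :
  wsum n (fun w => \sum_(j : J) F j w) = \sum_j wsum n (F j).
Proof.
rewrite -[RHS](big_map F xpredT (wsum n)) /=.
suff h (s : seq J) : wsum n (fun w => \sum_(j <- s) F j w) = \sum_(j <- s) wsum n (F j).
  by rewrite big_map; apply: h.
elim: s => [|j s IH].
  by rewrite big_nil -[RHS](wsum0 n); apply: eq_wsum => w _; rewrite big_nil.
rewrite big_cons -IH -wsumD; apply: eq_wsum => w _; rewrite big_cons.
by [].
Qed.

End WordSums.

Lemma wsum_le (C : numClosedFieldType) (I : finType) (F : seq I -> C^o) w :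
  (forall v, 0 <= (F v : C)) -> (F w : C) <= wsum (size w) F.
Proof.
elim: w F => [|i w IH] F F0 //=.
rewrite (bigD1 i) //=; apply: le_trans (IH (fun v => F (i :: v)) _) _ => //.
rewrite lerDl; apply: sumr_ge0 => j _.
have h n (G : seq I -> C^o) : (forall v, 0 <= (G v : C)) -> 0 <= (wsum n G : C).
  elim: n G => //= n IHn G G0; apply: sumr_ge0 => k _; exact: IHn.
exact: h.
Qed.

Lemma wsum_scale (C : numClosedFieldType) (I : finType) (V : lmodType C) n
    (c : seq I -> C) (x : V) :
  wsum n (fun w => c w *: x) = (wsum n (c : seq I -> C^o) : C) *: x.
Proof.
elim: n c => //= n IH c; rewrite scaler_suml; apply: eq_bigr => i _.
exact: IH.
Qed.

Section ColorDet.
Context (C : comNzRingType) (I : finType) (A : pzAlg C).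
Implicit Types (T : I -> I -> A) (f : seq I -> A).

(** The sum over words w of T v1 w1 ... T vm wm f(w): the image of the word v under e_i |-> sum_k T
    i k e_k, with f(w) put for the word w. *)
Fixpoint mexp T (v : seq I) f : A :=
  if v is i :: v' then \sum_k T i k * mexp T v' (fun w => f (k :: w))
  else f [::].

Lemma eq_mexp T v f g : (forall w, size w = size v -> f w = g w) ->
  mexp T v f = mexp T v g.
Proof.
elim: v f g => [|i v IH] f g h /=; first exact: h.
apply: eq_bigr => k _; congr (_ * _); apply: IH => w sw.
by apply: h; rewrite /= sw.
Qed.

Lemma eq_mexpl T T' v f : (forall i j, T i j = T' i j) -> mexp T v f = mexp T' v f.
Proof.
by move=> e; elim: v f => //= i v IH f; apply: eq_bigr => k _; rewrite e IH.
Qed.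

Lemma mexpD T v f g : mexp T v (fun w => f w + g w) = mexp T v f + mexp T v g.
Proof.
elim: v f g => //= i v IH f g; rewrite -big_split; apply: eq_bigr => k _ /=.
by rewrite -mulrDr; congr (_ * _); apply: IH.
Qed.
Lemma mexp0 T v : mexp T v (fun=> 0) = 0.
Proof. by elim: v => //= i v IH; apply: big1 => k _; rewrite IH mulr0. Qed.
Lemma mexpZ T v (a : C) f : mexp T v (fun w => a *: f w) = a *: mexp T v f.
Proof.
elim: v f => //= i v IH f; rewrite scaler_sumr; apply: eq_bigr => k _ /=.
by rewrite -pzmulZr; congr (_ * _); apply: IH.
Qed.
Lemma mexpMr T v f x : mexp T v (fun w => f w * x) = mexp T v f * x.
Proof.
elim: v f => //= i v IH f; rewrite mulr_suml; apply: eq_bigr => k _ /=.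
by rewrite -mulrA; congr (_ * _); apply: IH.
Qed.
Lemma mexp_sum T v (F : I -> seq I -> A) :
  mexp T v (fun w => \sum_j F j w) = \sum_j mexp T v (F j).
Proof.
suff h (s : seq I) : mexp T v (fun w => \sum_(j <- s) F j w) = \sum_(j <- s) mexp T v (F j).
  exact: h.
elim: s => [|j s IH].
  by rewrite big_nil -[RHS](mexp0 T v); apply: eq_mexp => w _; rewrite big_nil.
by rewrite big_cons -IH -mexpD; apply: eq_mexp => w _; rewrite big_cons.
Qed.

Lemma mexp_commute T v x f : (forall i j, x * T i j = T i j * x) ->
  mexp T v (fun w => x * f w) = x * mexp T v f.
Proof.
move=> h; elim: v f => //= i v IH f; rewrite mulr_sumr; apply: eq_bigr => k _.
by rewrite (IH (fun w => f (k :: w))) !mulrA h.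
Qed.

Lemma mexp_rcons T v i f : (forall w i j, f w * T i j = T i j * f w) ->
  mexp T (rcons v i) f = \sum_k mexp T v (fun w => f (rcons w k)) * T i k.
Proof.
elim: v f => [|j v IH] f fc /=.
  by apply: eq_bigr => k _; rewrite fc.
rewrite (eq_bigr _ (fun k _ => congr1 _ (IH (fun w => f (k :: w)) (fun w => fc (k :: w))))).
under eq_bigr => k _ do rewrite mulr_sumr.
rewrite exchange_big /=; apply: eq_bigr => k _.
by rewrite mulr_suml; apply: eq_bigr => l _; rewrite mulrA.
Qed.

Lemma mexp_id v f : mexp (fun i j => (i == j)%:R) v f = f v.
Proof.
elim: v f => //= i v IH f; rewrite (bigD1 i) //= big1 ?addr0 => [|k ki].
  by rewrite eqxx mul1r IH.
by rewrite eq_sym (negbTE ki) mul0r.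
Qed.

Lemma mexp_mul X Y v f : (forall i j k l, X i j * Y k l = Y k l * X i j) ->
  mexp (fun i j => \sum_k X i k * Y k j) v f =
  mexp X v (fun w => mexp Y w f).
Proof.
move=> XY; elim: v f => //= i v IH f.
transitivity (\sum_j \sum_k X i k * mexp X v (fun w => Y k j * mexp Y w (fun w' => f (j :: w')))).
  apply: eq_bigr => j _; rewrite mulr_suml; apply: eq_bigr => k _.
  by rewrite (IH (fun w => f (j :: w))) -mulrA mexp_commute.
rewrite exchange_big /=; apply: eq_bigr => k _.
by rewrite -mulr_sumr; congr (_ * _); rewrite mexp_sum.
Qed.

Lemma mexp_scal T v (u u' : I -> C) x f :
    (forall i j, x * T i j = (u i * u' j) *: (T i j * x)) ->
  x * mexp T v f =
  (\prod_(i <- v) u i) *: mexp T v (fun w => (\prod_(j <- w) u' j) *: (x * f w)).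
Proof.
move=> h; elim: v f => [|i v IH] f /=.
  by rewrite !big_nil !scale1r.
rewrite mulr_sumr scaler_sumr; apply: eq_bigr => k _.
rewrite mulrA h pzmulZl -mulrA (IH (fun w => f (k :: w))) pzmulZr scalerA.
rewrite big_cons -mulrA [u' k * _]mulrC mulrA -scalerA; congr (_ *: _).
rewrite -pzmulZr -mexpZ; congr (_ * _); apply: eq_mexp => w _.
by rewrite big_cons scalerA.
Qed.

End ColorDet.

Lemma mexp_hom (C : comNzRingType) (I : finType) (A B : pzAlg C) (h : A -> B) T v
    (f : seq I -> A) : alg_hom h ->
  h (mexp T v f) = mexp (fun i j => h (T i j)) v (fun w => h (f w)).
Proof.
move=> hP; elim: v f => //= i v IH f; rewrite (lin_sum (ah_linear hP)).
by apply: eq_bigr => k _; rewrite (ahM hP) IH.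
Qed.

(** The inner expansion is taken in the opposite algebra, so the entries of Y come in reverse order.
    The last X then stands next to its Y, and the products cancel from the inside outwards. *)
Lemma mexp_inv (C : comNzRingType) (I : finType) (A : gradedAlg C)
    (X Y : I -> I -> A) v (f : seq I -> A) :
    (forall i j, \sum_k X i k * Y k j = (i == j)%:R) ->
    (forall w i j, f w * X i j = X i j * f w) ->
  mexp X v (fun w => ofop (mexp (fun i j => toop (Y i j)) w (fun w => toop (f w)))) = f v.
Proof.
move=> XY; elim: v f => //= i v IH f fc.
transitivity (\sum_k X i k * mexp X v (fun w =>
   \sum_l ofop (mexp (fun i j => toop (Y i j)) w (fun w => toop (f (l :: w)))) * Y k l)).
  apply: eq_bigr => k _; congr (_ * _); apply: eq_mexp => w _.
transitivity (\sum_l \sum_k X i k * (f (l :: v) * Y k l)).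
  rewrite exchange_big; apply: eq_bigr => k _; rewrite -mulr_sumr mexp_sum.
  congr (_ * _); apply: eq_bigr => l _; rewrite mexpMr.
  by rewrite (IH (fun w => f (l :: w)) (fun w => fc (l :: w))).
have e l : \sum_k X i k * (f (l :: v) * Y k l) = f (l :: v) * (i == l)%:R.
  by rewrite -XY mulr_sumr; apply: eq_bigr => k _; rewrite !mulrA fc.
rewrite (eq_bigr _ (fun l _ => e l)) (bigD1 i) //= eqxx mulr1 big1 ?addr0 // => l li.
by rewrite eq_sym (negbTE li) mulr0.
Qed.

Definition color_mx (C : comNzRingType) (I : finType) (L : I -> I -> C)
    (A : pzAlg C) (T : I -> I -> A) : Prop :=
  forall i j k l, T i j * T k l = (L i k * L l j) *: (T k l * T i j).

(** The coefficient of the word r in the image of r under e_i |-> sum_k T i k e_k; for L = 1 and r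
    an enumeration of I, the usual sum over permutations. *)
Definition color_det (C : numClosedFieldType) (I : finType) (L : I -> I -> C)
    (r : seq I) (A : pzAlg C) (T : I -> I -> A) : A :=
  mexp T r (fun w => wsign L r w *: (1 : A)).

Section ColorDet.
Context (C : numClosedFieldType) (I : finType) (L : I -> I -> C) (r : seq I).
Hypothesis Lii : forall i, L i i = 1.
Hypothesis LV : forall i j, L i j * L j i = 1.
Hypothesis rI : forall i, i \in r.
Hypothesis ru : uniq r.

Let wsP := wsign_swap LV rI.

Lemma wsign_swapping (V : lmodType C) (x : V) :
  swapping L (fun w => wsign L r w *: x).
Proof. by move=> u y z v; rewrite wsP scale_regular scalerA. Qed.

Section Alg.
Context (A : pzAlg C).
Implicit Types (T X Y : I -> I -> A).
Local Notation sg := (fun w => wsign L r w *: (1 : A)).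
Local Notation det := (color_det L r).

(** Exchanging T x k and T y l costs L x y L l k, and exchanging k and l in f costs - L k l. The
    column weights cancel and - L x y remains. *)
Lemma mexp_swapping T f : color_mx L T -> swapping L f ->
  swapping L (fun v => mexp T v f).
Proof.
move=> TT fP u x y v; elim: u f fP => [|i u IH] f fP /=; last first.
  rewrite scaler_sumr; apply: eq_bigr => k _.
  by rewrite -pzmulZr; congr (_ * _); apply: IH; apply: swapping_cons.
rewrite scaler_sumr.
under eq_bigr => k _ do rewrite mulr_sumr.
under [RHS]eq_bigr => k _ do rewrite mulr_sumr scaler_sumr.
rewrite [RHS]exchange_big /=; apply: eq_bigr => k _; apply: eq_bigr => l _.
rewrite !mulrA TT pzmulZl.
have -> : mexp T v (fun w => f (k :: l :: w)) = - L k l *: mexp T v (fun w => f (l :: k :: w)).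
  by rewrite -mexpZ; apply: eq_mexp => w _; apply: (fP [::]).
rewrite pzmulZr scalerA; congr (_ *: _).
by rewrite mulrN -mulrA [L l k * _]mulrC LV mulr1.
Qed.

Lemma mexp_sg T v : color_mx L T -> size v = size r ->
  mexp T v sg = wsign L r v *: det T.
Proof.
move=> TT sv; rewrite /color_det.
have h := mexp_swapping TT (wsign_swapping (1 : A)).
exact: (swapping_ref Lii LV rI ru h sv).
Qed.

(** Only words containing each index once have a nonzero coefficient, so in every surviving term the
    row and column weights multiply to the full products over I. *)
Lemma color_det_scal T (u u' : I -> C) x :
    (forall i j, x * T i j = (u i * u' j) *: (T i j * x)) ->
  x * det T = (\prod_i u i * \prod_i u' i) *: (det T * x).
Proof.
move=> h; rewrite /color_det (mexp_scal _ _ h).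
have prodr v : size v = size r -> wsign L r v != 0 ->
    forall F : I -> C, \prod_(i <- v) F i = \prod_i F i.
  move=> sv nz F.
  have uv : uniq v by apply: contraNT nz => nu; rewrite wsign_nuniq.
  apply: perm_big; apply: uniq_perm => //; first exact: index_enum_uniq.
  move=> i; rewrite mem_index_enum.
  have sub : {subset r <= v}.
    have sub' : {subset v <= r} by move=> j _; apply: rI.
    by have [] := uniq_min_size uv sub'; rewrite ?sv // => _ e j; rewrite e.
  by rewrite sub.
rewrite (prodr r) // ?(wsign_ref L ru) ?oner_neq0 // -scalerA; congr (_ *: _).
rewrite -mexpMr -mexpZ; apply: eq_mexp => w sw.
rewrite pzmulZr mulr1 pzmulZl mul1r.
case: (eqVneq (wsign L r w) 0) => [->|nz]; first by rewrite !scale0r !scaler0.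
by rewrite prodr.
Qed.

Lemma color_det_mul X Y : (forall i j k l, X i j * Y k l = Y k l * X i j) ->
  color_mx L Y -> det (fun i j => \sum_k X i k * Y k j) = det X * det Y.
Proof.
move=> XY YY; rewrite /color_det mexp_mul // -mexpMr; apply: eq_mexp => w sw.
by rewrite mexp_sg // pzmulZl mul1r.
Qed.

Lemma color_det_id : color_det L r (A := A) (fun i j => (i == j)%:R) = 1.
Proof. by rewrite /color_det mexp_id (wsign_ref L ru) scale1r. Qed.

Lemma eq_color_det X Y : (forall i j, X i j = Y i j) -> det X = det Y.
Proof. exact: eq_mexpl. Qed.

End Alg.

Lemma color_det_hom (A B : pzAlg C) (h : A -> B) T : alg_hom h ->
  h (color_det L r T) = color_det L r (fun i j => h (T i j)).
Proof.
move=> hP; rewrite /color_det (mexp_hom _ _ _ hP); apply: eq_mexp => w _.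
by rewrite (linZ (ah_linear hP)) (ah1 hP).
Qed.

Lemma color_det_inv (A : gradedAlg C) (X Y : I -> I -> A) :
    (forall i j, \sum_k X i k * Y k j = (i == j)%:R) ->
    color_mx L (fun i j => toop (Y i j)) ->
  color_det L r X * ofop (color_det L r (fun i j => toop (Y i j))) = 1.
Proof.
move=> XY YY.
have fc (w : seq I) i j : (wsign L r w *: (1 : A)) * X i j = X i j * (wsign L r w *: (1 : A)).
  by rewrite pzmulZl pzmulZr mul1r mulr1.
have := mexp_inv r XY fc; rewrite (wsign_ref L ru) scale1r => <-.
rewrite /color_det -mexpMr; apply: eq_mexp => w sw.
have := mexp_sg YY sw; rewrite /color_det => ->.
by rewrite (linZ (@ofop_linear _ A)) pzmulZl mul1r.
Qed.

Lemma color_det_homog (A : gradedAlg C) (T : I -> I -> A) :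
  (forall i j, homog 0 (T i j)) -> homog 0 (color_det L r T).
Proof.
move=> Th; rewrite /color_det.
suff h v (f : seq I -> A) : (forall w, homog 0 (f w)) -> homog 0 (mexp T v f).
  by apply: h => w; apply: homogZ; apply: homog1.
elim: v f => [|i v IH] f fh /=; first exact: fh.
by apply: homog_sum => k _; apply: homog0M => //; apply: IH.
Qed.

(** The map bar reverses words, applies b to their letters and conjugates coefficients. Conjugation
    turns L i j into L j i, which compensates the reversal, so the new coefficient function is again
    swapping and hence a multiple of [wsign]. *)
Lemma wsign_bar_det (b : I -> I) (bK : involutive b)
    (Lb : forall i j, L (b i) (b j) = L i j) (Lc : forall i j, (L i j)^* = L j i)
    (A : gradedAlg C) (T : I -> I -> A) (bar : A -> A) :
    color_mx L T -> (forall i j, homog 0 (T i j)) ->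
    semilin Num.conj bar -> bar 1 = 1 ->
    (forall x y, homog 0 x -> homog 0 y -> bar (x * y) = bar y * bar x) ->
    (forall i j, bar (T i j) = T (b i) (b j)) ->
  bar (color_det L r T) = color_det L r T.
Proof.
move=> TT Th bl b1 bM bT.
pose rb (w : seq I) := rev (map b w).
have e v (f : seq I -> C) : bar (mexp T v (fun w => f w *: (1 : A))) =
    mexp T (rb v) (fun w => (f (rb w))^* *: (1 : A)).
  elim: v f => [|i v IH] f /=; first by rewrite (slZ bl) b1.
  rewrite /rb /= rev_cons mexp_rcons; last first.
    by move=> w k l; rewrite pzmulZl pzmulZr mul1r mulr1.
  rewrite (sl_sum bl) [RHS](reindex_inj (inv_inj bK)) /=.
  apply: eq_bigr => k _; rewrite bM //; last first.
    suff h (u : seq I) (g : seq I -> A) : (forall w, homog 0 (g w)) -> homog 0 (mexp T u g).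
      by apply: h => w; apply: homogZ; apply: homog1.
    elim: u g => [|j u IHu] g gh /=; first exact: gh.
    by apply: homog_sum => l _; apply: homog0M => //; apply: IHu.
  rewrite bT (IH (fun w => f (k :: w))); congr (_ * _).
  apply: eq_mexp => w _; congr (_ *: _); congr (_^*); congr f.
  by rewrite map_rcons rev_rcons bK.
rewrite /color_det e.
pose g w := (wsign L r (rb w))^*.
have gP : swapping L (g : seq I -> C^o).
  move=> u x y v; rewrite /g /rb !map_cat /= !rev_cat !rev_cons -!cats1 -!catA /=.
  by rewrite wsP scale_regular rmorphM rmorphN /= Lc Lb.
have gE w : size w = size r -> g w = wsign L r w * g r.
  by move=> sw; have := swapping_ref Lii LV rI ru gP sw; rewrite scale_regular.
have srb w : size (rb w) = size w by rewrite size_rev size_map.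
transitivity (mexp T (rb r) (fun w => g r *: (wsign L r w *: (1 : A)))).
  apply: eq_mexp => w sw; rewrite scalerA mulrC -gE //.
  by rewrite sw srb.
rewrite mexpZ mexp_sg ?srb // scalerA.
(* The constant comes from evaluating [gE] at [rb r]: since [rb] is an involution, g (rb r) is the
   conjugate of [wsign L r r], that is 1. *)
suff -> : g r * wsign L r (rb r) = 1 by rewrite scale1r.
have := gE (rb r) (srb r); rewrite /g /rb map_rev revK -map_comp.
rewrite (eq_map (bK : b \o b =1 id)) map_id (wsign_ref L ru) rmorph1 => ->.
by rewrite mulrC.
Qed.

End ColorDet.

(** * Transposition and the inverse matrix by Laplace expansion *)

Section Inverse.
Context (C : numClosedFieldType) (I : finType) (L : I -> I -> C) (r : seq I).
Hypothesis Lii : forall i, L i i = 1.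
Hypothesis LV : forall i j, L i j * L j i = 1.
Hypothesis Lc : forall i j, (L i j)^* = L j i.
Hypothesis rI : forall i, i \in r.
Hypothesis ru : uniq r.
Context (A : pzAlg C) (T : I -> I -> A).
Hypothesis TT : color_mx L T.

Let L' i j := L j i.
Let T' i j := T j i.
Let L'ii i : L' i i = 1 := Lii i.
Let L'V i j : L' i j * L' j i = 1 := LV j i.
Let TT' : color_mx L' T'.
Proof. by move=> i j k l; rewrite /T' TT mulrC. Qed.

Lemma wsign_conj w : wsign L' r w = (wsign L r w)^*.
Proof.
elim: w => [|x v IH] /=; first by rewrite rmorph1.
case: ifP => _; first by rewrite rmorph0.
rewrite rmorphM IH rmorph_prod; congr (_ * _); apply: eq_bigr => y _.
by rewrite /wsign2; case: ifP => _; rewrite ?rmorph1 // rmorphN /= Lc.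
Qed.

(** Both sides are the sum over pairs of words v, w of f v g w T v1 w1 ... T vn wn, grouped by v or
    by w; the order of the factors is the same. *)
Lemma wsum_mexp n (f g : seq I -> C) :
  wsum n (fun v => f v *: mexp T v (fun w => g w *: (1 : A))) =
  wsum n (fun w => g w *: mexp T' w (fun v => f v *: (1 : A))).
Proof.
elim: n f g => [|n IH] f g /=; first by rewrite !scalerA mulrC.
have wsumMl m x (F : seq I -> A) : wsum m (fun w => x * F w) = x * wsum m F.
  elim: m F => //= m IHm F; rewrite mulr_sumr; apply: eq_bigr => k _.
  exact: IHm.
transitivity (\sum_i \sum_k T i k * wsum n
    (fun v => f (i :: v) *: mexp T v (fun w => g (k :: w) *: (1 : A)))).
  apply: eq_bigr => i _; rewrite -(eq_bigr _ (fun k _ => wsumMl _ _ _)) -wsum_sum.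
  apply: eq_wsum => w _; rewrite scaler_sumr; apply: eq_bigr => k _.
  by rewrite pzmulZr.
rewrite exchange_big /=; apply: eq_bigr => k _.
rewrite -[RHS]/(wsum n (fun w => g (k :: w) *: \sum_i T i k * mexp T' w (fun v => f (i :: v) *: (1 : A)))).
under eq_bigr => i _ do rewrite (IH (fun v => f (i :: v)) (fun w => g (k :: w))) -wsumMl.
rewrite -wsum_sum; apply: eq_wsum => w _; rewrite scaler_sumr.
by apply: eq_bigr => i _; rewrite pzmulZr.
Qed.

(* Weighted by the coefficients of L', which are conjugate to those of L, the   *)
(* sum of the products T v1 w1 ... T vm wm over all words v and w is N * det of *)
(* either kind, where N is the sum of the squared moduli of the coefficients.   *)
Lemma color_det_tr : color_det L' r T' = color_det L r T.
Proof.
have h := wsum_mexp (size r) (wsign L' r) (wsign L r).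
pose N := (wsum (size r) (fun w => wsign L r w * wsign L' r w : C^o) : C).
have e1 : wsum (size r) (fun v => wsign L' r v *: mexp T v (fun w => wsign L r w *: (1 : A)))
    = N *: color_det L r T.
  rewrite -wsum_scale; apply: eq_wsum => w sw.
  by rewrite (mexp_sg Lii LV rI ru TT) // scalerA mulrC.
have e2 : wsum (size r) (fun v => wsign L r v *: mexp T' v (fun w => wsign L' r w *: (1 : A)))
    = N *: color_det L' r T'.
  rewrite -wsum_scale; apply: eq_wsum => w sw.
  by rewrite (mexp_sg L'ii L'V rI ru TT') // scalerA.
(* All terms of N are squared moduli, and the term of the word r is 1. *)
have N0 : N != 0.
  have := @wsum_le C I (fun w => wsign L r w * wsign L' r w) r _.
  rewrite (wsign_ref L ru) wsign_conj (wsign_ref L ru) rmorph1 mulr1 => hN.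
  apply: lt0r_neq0; apply: lt_le_trans ltr01 (hN _) => v.
  by rewrite wsign_conj mul_conjC_ge0.
apply: (scalerI N0); rewrite -e1 -e2; exact: esym.
Qed.

Context (V : A).
Hypothesis DV : color_det L r T * V = 1.
Hypothesis VD : V * color_det L r T = 1.

(** The word i followed by r with j removed is a rearrangement of r if i = j and repeats a letter
    otherwise, so the expansion along it is a nonzero multiple of det or 0. Splitting off its first
    letter gives a right inverse. The transpose, expanded with the letter split off at the end,
    gives a left inverse, and the two agree by associativity. *)
Lemma color_inverse : exists S : I -> I -> A,
  (forall i j, \sum_k T i k * S k j = (i == j)%:R) /\
  (forall i j, \sum_k S i k * T k j = (i == j)%:R).
Proof.
have rcons_uniq_rem j : uniq (j :: rem j r).
  by have := ru; rewrite (perm_uniq (perm_to_rem (rI j))).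
have srem j : (size (rem j r)).+1 = size r.
  by rewrite size_rem //; case: (r) (rI j).
have inrem i j : i != j -> i \in rem j r.
  move=> ij; have := rI i; rewrite (perm_mem (perm_to_rem (rI j))) inE.
  by rewrite (negbTE ij).
pose c j := wsign L r (j :: rem j r).
pose S k j := (c j)^-1 *: (mexp T (rem j r) (fun w => wsign L r (k :: w) *: (1 : A)) * V).
pose c' j := wsign L' r (rcons (rem j r) j).
pose S' i k := (c' i)^-1 *: (V * mexp T' (rem i r) (fun w => wsign L' r (rcons w k) *: (1 : A))).
have TS i j : \sum_k T i k * S k j = (i == j)%:R.
  have h : mexp T (i :: rem j r) (fun w => wsign L r w *: (1 : A)) =
      wsign L r (i :: rem j r) *: color_det L r T.
    by apply: (mexp_sg Lii LV rI ru TT); rewrite /= srem.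
  transitivity ((c j)^-1 *: (mexp T (i :: rem j r) (fun w => wsign L r w *: (1 : A)) * V)).
    rewrite /= mulr_suml scaler_sumr; apply: eq_bigr => k _.
    by rewrite pzmulZr mulrA.
  rewrite h pzmulZl DV scalerA.
  case: eqVneq => [->|ij].
    have cj : c j != 0 by apply: (wsign_neq0 r LV); apply: rcons_uniq_rem.
    by rewrite mulVf ?scale1r.
  by rewrite wsign_nuniq ?mulr0 ?scale0r //= inrem.
have ST i j : \sum_k S' i k * T k j = (i == j)%:R.
  have h : mexp T' (rcons (rem i r) j) (fun w => wsign L' r w *: (1 : A)) =
      wsign L' r (rcons (rem i r) j) *: color_det L' r T'.
    by apply: (mexp_sg L'ii L'V rI ru TT'); rewrite size_rcons srem.
  transitivity ((c' i)^-1 *: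
      (V * mexp T' (rcons (rem i r) j) (fun w => wsign L' r w *: (1 : A)))).
    rewrite mexp_rcons; last first.
      by move=> w k l; rewrite pzmulZl pzmulZr mul1r mulr1.
    rewrite mulr_sumr scaler_sumr; apply: eq_bigr => k _.
    by rewrite pzmulZl mulrA.
  rewrite h pzmulZr color_det_tr VD scalerA.
  case: eqVneq => [->|ij].
    have cj : c' j != 0.
      apply: (wsign_neq0 r L'V); rewrite rcons_uniq.
      exact: (rcons_uniq_rem j).
    by rewrite mulVf ?scale1r.
  by rewrite wsign_nuniq ?mulr0 ?scale0r // rcons_uniq inrem // eq_sym.
exists S; split=> // i j; rewrite -ST; apply: eq_bigr => k _; congr (_ * _).
transitivity (\sum_l S' i l * \sum_m T l m * S m k).
  have e m : \sum_l S' i l * (T l m * S m k) = (i == m)%:R * S m k.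
    by rewrite -ST mulr_suml; apply: eq_bigr => l _; rewrite mulrA.
  under eq_bigr => l _ do rewrite mulr_sumr.
  rewrite exchange_big /= (eq_bigr _ (fun m _ => e m)) (bigD1 i) //= eqxx mul1r.
  rewrite big1 ?addr0 // => m mi.
  by rewrite eq_sym (negbTE mi) mul0r.
rewrite (bigD1 k) //= TS eqxx mulr1 big1 ?addr0 // => l lk.
by rewrite TS (negbTE lk) mulr0.
Qed.

End Inverse.

(** * Color algebras *)

(* Graded commutation up to the scalars c: x false k has degree 0 and x true k *)
(* has degree 1.                                                              *)
Definition gcolor (C : comNzRingType) (K : Type) (c : K -> K -> C) (A : pzAlg C)
    (x : bool -> K -> A) : Prop :=
  forall e e' k l,
    x e k * x e' l = ((-1) ^+ (e && e') * c k l) *: (x e' l * x e k).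

Section GradedColor.
Context (C : comNzRingType) (K : Type) (c : K -> K -> C).
Hypothesis cV : forall k l, c k l * c l k = 1.

Lemma gcolor_sym (A : pzAlg C) (a : C) k l (y z : A) :
  a * a = 1 -> y * z = (a * c k l) *: (z * y) -> z * y = (a * c l k) *: (y * z).
Proof.
by move=> aa ->; rewrite scalerA mulrACA aa mul1r cV scale1r.
Qed.

Lemma gcolorP (A : pzAlg C) (x : bool -> K -> A) :
    (forall k l, x false k * x false l = c k l *: (x false l * x false k)) ->
    (forall k l, x false k * x true l = c k l *: (x true l * x false k)) ->
    (forall k l, x true k * x true l = - c k l *: (x true l * x true k)) ->
  gcolor c x.
Proof.
move=> h0 h1 h2 [] [] k l /=; rewrite ?expr1 ?expr0 ?mulN1r ?mul1r //.
have := @gcolor_sym A 1 l k (x false l) (x true k); rewrite !mul1r; by apply.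
Qed.

(** Differentiate y z = a z y and cancel the terms containing dy. *)
Lemma gcolor_dif (A : gradedAlg C) (d : A -> A) (y z : A) a p : is_dga d ->
    homog p y -> homog 0 z ->
    y * z = a *: (z * y) -> d y * z = a *: (z * d y) ->
  y * d z = ((-1) ^+ p * a) *: (d z * y).
Proof.
move=> dP hy hz e e'.
have /eqP := congr1 d e; rewrite (dgaM dP _ hy) (linZ (dga_linear dP)) (dgaM dP _ hz).
rewrite expr0 scale1r e' scalerDr addrC (inj_eq (addIr _)) => /eqP h.
have := congr1 (fun w => (-1) ^+ p *: w) h; rewrite /= !scalerA -exprD.
by rewrite addnn -mul2n exprM sqrrN !expr1n scale1r.
Qed.

End GradedColor.

Section TensorColor.
Context (C : comNzRingType) (I : finType) (S : Type) (L : I -> I -> C).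
Context (E : S -> S -> C) (A B : gradedAlg C).
Hypothesis LV : forall i j, L i j * L j i = 1.
Context (t : bool -> I * I -> A) (x : bool -> I * S -> B).
Hypothesis th : forall (e : bool) k, homog e (t e k).
Hypothesis xh : forall (e : bool) k, homog e (x e k).
Hypothesis tc : gcolor (fun a b => L a.1 b.1 * L b.2 a.2) t.
Hypothesis xc : gcolor (fun a b => L a.1 b.1 * E a.2 b.2) x.

Let m (e f : bool) (i : I) (s : S) : gtens A B :=
  \sum_j tn (t e (i, j)) (x f (j, s)).

Let mono (e f e' f' : bool) i j s k l s' :
  tn (t e (i, j)) (x f (j, s)) * tn (t e' (k, l)) (x f' (l, s')) =
  ((-1) ^+ ((e + f) * (e' + f')) * (L i k * E s s')) *:
    (tn (t e' (k, l)) (x f' (l, s')) * tn (t e (i, j)) (x f (j, s))).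
Proof.
rewrite (tnM _ _ (xh _ _) (th _ _)) (tnM _ _ (xh _ _) (th _ _)) tc xc /=.
rewrite tnZl tnZr !scalerA; apply: (congr1 (fun a : C => a *: _)).
have sg : (-1) ^+ (f * e') * (-1) ^+ (e && e') * (-1) ^+ (f && f') =
    (-1) ^+ ((e + f) * (e' + f')) * (-1) ^+ (f' * e) :> C.
  by rewrite -!exprD; apply: sign_parity; case: e; case: f; case: e'; case: f'.
transitivity ((-1) ^+ (f * e') * (-1) ^+ (e && e') * (-1) ^+ (f && f') *
    (L i k * E s s') * (L l j * L j l)); first by ring.
by rewrite sg LV; ring.
Qed.

Let mM (e f e' f' : bool) i s k s' :
  m e f i s * m e' f' k s' =
  ((-1) ^+ ((e + f) * (e' + f')) * (L i k * E s s')) *: (m e' f' k s' * m e f i s).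
Proof.
rewrite /m !mulr_suml; under eq_bigr => j _ do rewrite mulr_sumr.
under [in RHS]eq_bigr => j _ do rewrite mulr_sumr.
rewrite exchange_big scaler_sumr; apply: eq_bigr => l _.
by rewrite scaler_sumr; apply: eq_bigr => j _; apply: mono.
Qed.

(** The contracted indices j and l contribute L l j from the first factor and L j l from the second,
    whose product is 1, so all terms of the sum have the same weight. In degree 1 the formula is the
    Leibniz rule. The coproduct uses E s s' = L s' s, the coaction E = 1. *)
Lemma gcolor_tensor :
  gcolor (fun a b => L a.1 b.1 * E a.2 b.2) (fun (p : bool) (a : I * S) =>
    if p then m true false a.1 a.2 + m false true a.1 a.2
    else m false false a.1 a.2).
Proof.
move=> [] [] [i s] [k s'] /=.
- rewrite !mulrDl !mulrDr !scalerDr.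
  rewrite [m true false i s * m true false k s']mM.
  rewrite [m true false i s * m false true k s']mM.
  rewrite [m false true i s * m true false k s']mM.
  rewrite [m false true i s * m false true k s']mM.
  exact: addrACA.
- rewrite mulrDl mulrDr scalerDr.
  rewrite [m true false i s * m false false k s']mM.
  by rewrite [m false true i s * m false false k s']mM.
- rewrite mulrDl mulrDr scalerDr.
  rewrite [m false false i s * m true false k s']mM.
  by rewrite [m false false i s * m false true k s']mM.
by rewrite [LHS]mM.
Qed.

Lemma homog_gcolor_tensor (p : bool) (a : I * S) :
  homog p (if p then m true false a.1 a.2 + m false true a.1 a.2
           else m false false a.1 a.2).
Proof.
have h (e f : bool) i s : homog (e + f) (m e f i s).
  by apply: homog_sum => j _; apply: homog_tn; [apply: th|apply: xh].
by case: p; [apply: homogD; [exact: (h true false)|exact: (h false true)]|exact: (h false false)].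
Qed.

End TensorColor.

Section ColorGenerators.
Context (C : numClosedFieldType) (K : Type) (c : K -> K -> C) (bk : K -> K).
Hypothesis cV : forall k l, c k l * c l k = 1.
Hypothesis cc : forall k l, (c k l)^* = c l k.
Hypothesis cb : forall k l, c (bk k) (bk l) = c k l.
Context (F : gradedAlg C) (X : bool -> K -> F) (Q : pzAlg C) (pp : F -> Q).
Hypothesis ppP : alg_hom pp.
Hypothesis Xh : forall (e : bool) k, homog e (X e k).
Hypothesis Xc : gcolor c (fun e k => pp (X e k)).

Let r (e e' : bool) k l : F :=
  X e k * X e' l - ((-1) ^+ (e && e') * c k l) *: (X e' l * X e k).

Lemma color_rel_bar (bar : F -> F) : semilin Num.conj bar ->
    (forall p q (x y : F), homog p x -> homog q y ->
       bar (x * y) = (-1) ^+ (p * q) *: (bar y * bar x)) ->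
    (forall e k, bar (X e k) = X e (bk k)) ->
  forall e e' k l, pp (bar (r e e' k l)) = 0.
Proof.
move=> bl bM bX e e' k l; have pl := ah_linear ppP.
rewrite /r (slB bl) (slZ bl) (bM _ _ _ _ (Xh e k) (Xh e' l)) (bM _ _ _ _ (Xh e' l) (Xh e k)).
rewrite !bX (linB pl) !(linZ pl) !(ahM ppP) (Xc e' e) cb !scalerA.
rewrite rmorphM rmorphXn rmorphN1 /= cc; apply/eqP; rewrite subr_eq0; apply/eqP.
apply: (congr1 (fun a : C => a *: _)).
by case: (e); case: (e'); rewrite /= ?expr0 ?expr1; ring.
Qed.

Lemma color_rel_dif (d : F -> F) : linear d ->
    (forall p x y, homog p x -> d (x * y) = d x * y + (-1) ^+ p *: (x * d y)) ->
    (forall k, d (X false k) = X true k) -> (forall k, d (X true k) = 0) ->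
  forall e e' k l, pp (d (r e e' k l)) = 0.
Proof.
move=> dl dM d0 d1 e e' k l; have pl := ah_linear ppP.
rewrite /r (linB dl) (linZ dl) (dM _ _ _ (Xh e k)) (dM _ _ _ (Xh e' l)).
have h a b := Xc a b k l.
case: e; case: e'; rewrite ?d0 ?d1 ?(mulr0, mul0r, scaler0, addr0, add0r, subr0) /=.
- by rewrite oppr0 (lin0 pl).
- rewrite (linB pl) !(linZ pl) !(ahM ppP) (h true true) /= !scalerA.
  by rewrite !expr1 expr0 mul1r !mulN1r opprK subrr.
- rewrite (linB pl) !(linZ pl) !(ahM ppP) (h true true) /= scalerA.
  by rewrite !expr1 expr0 mul1r mulN1r mulrN1 subrr.
rewrite (linB pl) !(linZ pl) !(linD pl) !(linZ pl) !(ahM ppP).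
rewrite (h true false) (h false true) /= !expr0 !mul1r !scale1r scalerDr.
by rewrite [X in _ - X]addrC subrr.
Qed.

End ColorGenerators.

(** Conjugation by the inverse: the sum over k and l of u'_k S_ak x t_kl S_lb is evaluated once by
    contracting t with S on the right, and once by moving x past t and contracting S with t on the
    left. *)
Lemma inverse_color (C : comNzRingType) (I : finType) (A : pzAlg C)
    (t S : I -> I -> A) (u u' v v' : I -> C) (x : A) :
    (forall i j, \sum_k t i k * S k j = (i == j)%:R) ->
    (forall i j, \sum_k S i k * t k j = (i == j)%:R) ->
    (forall i, u i * u' i = 1) -> (forall i, v i * v' i = 1) ->
    (forall i j, x * t i j = (u i * v j) *: (t i j * x)) ->
  forall a b, x * S a b = (v' a * u' b) *: (S a b * x).
Proof.
move=> tS St uu vv h a b.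
have e1 : \sum_k \sum_l (u' k *: S a k) * (x * t k l) * S l b = u' b *: (S a b * x).
  transitivity (\sum_k (u' k *: S a k) * x * (k == b)%:R).
    apply: eq_bigr => k _; rewrite -tS mulr_sumr.
    by apply: eq_bigr => l _; rewrite !mulrA.
  rewrite (bigD1 b) //= eqxx mulr1 big1 ?addr0 ?pzmulZl // => k /negbTE ->.
  by rewrite mulr0.
have e2 : \sum_k \sum_l (u' k *: S a k) * (x * t k l) * S l b = v a *: (x * S a b).
  rewrite exchange_big /=.
  transitivity (\sum_l (v l *: ((a == l)%:R * (x * S l b)))).
    apply: eq_bigr => l _; rewrite -St mulr_suml scaler_sumr.
    apply: eq_bigr => k _; rewrite h !(pzmulZl, pzmulZr) !scalerA !mulrA.
    by rewrite [u' k * u k]mulrC uu mul1r.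
  rewrite (bigD1 a) //= eqxx mul1r big1 ?addr0 // => l la.
  by rewrite eq_sym (negbTE la) mul0r scaler0.
by rewrite -scalerA -e1 e2 scalerA [v' a * _]mulrC vv scale1r.
Qed.

(** * The algebra of the quantum space and det_theta *)

Lemma quot_linear (C : comNzRingType) (A : gradedAlg C) (J : gideal A)
    (V : lmodType C) (f : A -> V) : linear f -> (forall x, J x -> f x = 0) ->
  (forall x, f (qrepr (qproj J x)) = f x) /\
  linear (fun y : gquot J => f (qrepr y)).
Proof.
move=> fl fJ.
have e x : f (qrepr (qproj J x)) = f x.
  apply/eqP; rewrite -subr_eq0 -(linB fl); apply/eqP/fJ.
  exact: (qrepr_proj J x).
split=> // a u v; have [x ->] := qproj_surj u; have [y ->] := qproj_surj v.
by rewrite -(ah_linear (qproj_hom J)) !e fl.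
Qed.

Lemma word_functional (C : comNzRingType) (X : Type) (F : gradedAlg C)
    (word : seq X -> F) (V : lmodType C) (phi : F -> V) (rel : set F) :
    word [::] = 1 -> (forall s t, word (s ++ t) = word s * word t) ->
    (forall P : F -> Prop, P 0 -> (forall x y, P x -> P y -> P (x + y)) ->
      (forall a (s : seq X), P (a *: word s)) -> forall y, P y) ->
    linear phi -> (forall r, rel r -> exists p, homog p r) ->
    (forall r s t, rel r -> phi (word s * r * word t) = 0) ->
  forall x, gideal_gen rel x -> phi x = 0.
Proof.
move=> w0 wM wI l rh h x hx.
suff H : forall s t, phi (word s * x * word t) = 0.
  by have := H [::] [::]; rewrite w0 mul1r mulr1.
move: x hx; apply: (gideal_gen_min (Z := fun x => forall s t, phi (word s * x * word t) = 0)) => //.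
- split=> [s t|a x y hx hy s t]; first by rewrite mulr0 mul0r (lin0 l).
  by rewrite mulrDr mulrDl pzmulZr pzmulZl l hx hy scaler0 addr0.
- move=> p q x y _ _ hx; split; move: y; apply: wI => [s t|y y' hy hy' s t|a u s t].
  + by rewrite mulr0 mulr0 mul0r (lin0 l).
  + by rewrite mulrDr mulrDr mulrDl (linD l) hy hy' addr0.
  + by rewrite pzmulZr pzmulZr pzmulZl (linZ l) !mulrA -[_ * word u * word t]mulrA -wM hx scaler0.
  + by rewrite mul0r mulr0 mul0r (lin0 l).
  + by rewrite mulrDl mulrDr mulrDl (linD l) hy hy' addr0.
  by rewrite pzmulZl pzmulZr pzmulZl (linZ l) !mulrA -wM hx scaler0.
by move=> r hr s t; apply: h.
Qed.

Section PresFunctional.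
Context (C : comNzRingType) (X : choiceType) (deg : X -> nat).
Context (rel : set (gfree C deg)) (phi : seq X -> C).
Hypothesis relh : forall r, rel r -> exists p, homog p r.
Hypothesis phir : forall r s t, rel r ->
  free_lin (phi : seq X -> C^o) (fword C s * r * fword C t) = 0.

(** Provides linear forms on the quantum space that separate enough elements: one with value 1 on
    [Omega0], and those dual to quadratic monomials. *)
Lemma pres_functional : exists2 f : pres rel -> C, scalar f &
  forall s, f (pproj rel (fword C s)) = phi s.
Proof.
have l := free_lin_linear (phi : seq X -> C^o).
have k : forall x : gfree C deg, gideal_gen rel x -> free_lin (phi : seq X -> C^o) x = 0.
  apply: (@word_functional C X (gfree C deg) (@fword C X) C^o _ rel (fword0 C X) (@fword_cat C X)) => //.
  exact: free_word_ind.
have [e fl] := @quot_linear C (gfree C deg) (gideal_gen rel) C^o _ l k.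
exists (fun y => free_lin (phi : seq X -> C^o) (qrepr y)).
  exact: fl.
by move=> s; rewrite [LHS]e free_lin_word.
Qed.

End PresFunctional.

Section Theta.
Context (R : realType) (n : nat) (theta : 'M[R]_n) (htheta : theta^T = - theta).
Context (b : bool).
Local Notation C := (R[i]).
Local Notation I := (idx n b).
Local Notation L := (@Lam R n theta b).

Let thetaN mu nu : theta mu nu = - theta nu mu.
Proof. by have /matrixP/(_ nu mu) := htheta; rewrite !mxE => ->. Qed.

Lemma lamV mu nu : lam theta mu nu * lam theta nu mu = 1.
Proof.
rewrite /lam (thetaN nu mu) cosN sinN; apply/eqP; rewrite eq_complex /=.
rewrite mulrN opprK -!expr2 cos2Dsin2 eqxx /=.
by rewrite mulrN mulrC addrC subrr.
Qed.

Lemma lam_conj mu nu : (lam theta mu nu)^* = lam theta nu mu.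
Proof. by rewrite /lam (thetaN nu mu) cosN sinN. Qed.

Lemma lam_diag mu : lam theta mu mu = 1.
Proof.
have e : theta mu mu = 0.
  by apply/eqP; rewrite -[_ == 0](mulrn_eq0 _ 2) mulr2n {1}thetaN addNr.
by rewrite /lam e cos0 sin0.
Qed.

Lemma LamV (i j : I) : L i j * L j i = 1.
Proof.
by case: i => [[mu|mu]|o]; case: j => [[nu|nu]|o'] /=; rewrite ?mulr1 ?lamV.
Qed.

Lemma Lam_conj (i j : I) : (L i j)^* = L j i.
Proof.
by case: i => [[mu|mu]|o]; case: j => [[nu|nu]|o'] /=; rewrite ?lam_conj ?rmorph1.
Qed.

Lemma Lam_diag (i : I) : L i i = 1.
Proof. by case: i => [[mu|mu]|o] /=; rewrite ?lam_diag. Qed.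

Lemma ibarK : involutive (@ibar n b).
Proof. by case=> [[mu|mu]|o]. Qed.

Lemma Lam_bar (i j : I) : L (ibar i) (ibar j) = L i j.
Proof. by case: i => [[mu|mu]|o]; case: j => [[nu|nu]|o']. Qed.

Lemma Lam_barl (i j : I) : L (ibar i) j = L j i.
Proof. by case: i => [[mu|mu]|o]; case: j => [[nu|nu]|o']. Qed.

Lemma Lam_self_bar (i : I) : L i (ibar i) = 1.
Proof. by case: i => [[mu|mu]|o] //=; rewrite lam_diag. Qed.

(** The weights at mu and at bar mu are inverse to each other, and the weight at 0 is 1. This makes
    the determinant central. *)
Lemma prod_Lam_r (k : I) : \prod_i L k i = 1.
Proof.
rewrite !big_sumType /= -big_split /= [X in _ * X]big1 ?mulr1 => [|o _].
  apply: big1 => mu _; rewrite -[inl (inr mu)]/(ibar (inl (inl mu) : I)).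
  by rewrite -[L k (ibar _)]Lam_bar ibarK Lam_barl LamV.
by case: k => [[nu|nu]|o'].
Qed.

Lemma prod_Lam_l (k : I) : \prod_i L i k = 1.
Proof.
have h : \prod_i (L i k * L k i) = 1 by apply: big1 => i _; rewrite LamV.
by move: h; rewrite big_split /= prod_Lam_r mulr1.
Qed.

Definition ref_word : seq I :=
  flatten [seq [:: ixb b mu; ix b mu] | mu <- index_enum 'I_n]
  ++ [seq (inr o : I) | o <- index_enum 'I_b].

Lemma ref_word_mem (i : I) : i \in ref_word.
Proof.
rewrite mem_cat; case: i => [[mu|mu]|o].
- apply/orP; left; apply/flattenP; exists [:: ixb b mu; ix b mu].
    by apply/mapP; exists mu; rewrite // mem_index_enum.
  by rewrite !inE eqxx orbT.
- apply/orP; left; apply/flattenP; exists [:: ixb b mu; ix b mu].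
    by apply/mapP; exists mu; rewrite // mem_index_enum.
  by rewrite !inE eqxx.
by apply/orP; right; apply/mapP; exists o; rewrite // mem_index_enum.
Qed.

Lemma ref_word_uniq : uniq ref_word.
Proof.
have e : size ref_word = #|{: I}|.
  rewrite size_cat size_map !card_sum !card_ord; congr (_ + _)%N; last first.
    by rewrite -sum1_size sum1_card card_ord.
  rewrite size_flatten /shape -map_comp sumnE big_map /=.
  by rewrite sum_nat_const card_ord muln2 addnn.
apply: (@leq_size_uniq _ (enum I)); rewrite ?enum_uniq //.
  by move=> i _; apply: ref_word_mem.
by rewrite e cardE.
Qed.

Lemma Omega0_word : Omega0 theta b = \prod_(i <- ref_word) dxi theta i.
Proof.
rewrite /Omega0 big_cat /= big_flatten /= !big_map; congr (_ * _).
by apply: eq_bigr => mu _; rewrite !big_cons big_nil mulr1.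
Qed.

Local Notation fR := (free C (bool * I)%type).

Local Notation relRb := (@relR R n theta b).

Lemma relRE (r : fR) : relRb r -> exists e e' i j,
  r = fgen C (e, i) * fgen C (e', j) -
      ((-1) ^+ (e && e') * L i j) *: (fgen C (e', j) * fgen C (e, i)).
Proof.
case=> i j; [exists false, false|exists false, true|exists true, true]; exists i, j.
- by rewrite expr0 mul1r.
- by rewrite expr0 mul1r.
by rewrite expr1 mulN1r scaleNr opprK.
Qed.

Let fgh e i : homog (e : bool) (fgen C (e, i) : gfree C (@degR n b)).
Proof. exact: (gen_homog (free_generated C (@degR n b)) (e, i)). Qed.

Lemma relR_homog (r : fR) : relRb r ->
  exists p, homog p (r : gfree C (@degR n b)).
Proof.
move/relRE=> [e [e' [i [j ->]]]]; exists (e + e')%N.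
apply: homogB; first exact: homogM.
by apply: homogZ; rewrite addnC; apply: homogM.
Qed.

Local Notation gen e i := (genR theta (e, i) : Omega_R theta b).

Lemma genR_color : gcolor L (fun e i => gen e i).
Proof.
apply: (gcolorP LamV) => k l; apply: pgen_rel.
- exact: RelR00.
- exact: RelR01.
by rewrite scaleNr opprK; apply: RelR11.
Qed.

Lemma genR_generated : generated (@degR n b) (@genR R n theta b).
Proof. exact: pgen_generated. Qed.

Lemma genR_homog (e : bool) i : homog e (gen e i).
Proof. exact: (gen_homog genR_generated (e, i)). Qed.

Lemma Omega_R_lift (B : pzAlg C) (y : bool -> I -> B) : gcolor L y ->
  let f : Omega_R theta b -> B := plift (rel := relRb) (fun x => y x.1 x.2) in
  alg_hom f /\ (forall e i, f (gen e i) = y e i).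
Proof.
move=> yc f.
have fr r : relRb r -> free_eval (fun x => y x.1 x.2) r = 0.
  move/relRE=> [e [e' [i [j ->]]]]; apply: (free_eval_rel (@degR n b)).
  exact: yc.
split; first exact: (plift_hom relR_homog fr).
by move=> e i; apply: (plift_gen relR_homog fr (e, i)).
Qed.

Lemma Omega_R_gida_full :
  [/\ is_gida (Omega_R theta b),
      (forall e i, gbar (gen e i) = gen e (ibar i)),
      (forall i, gdif (gen false i) = gen true i) &
      (forall i, gdif (gen true i) = 0)].
Proof.
pose bx (x : bool * I) := (x.1, ibar x.2).
pose dx (x : bool * I) : fR := if x.1 then 0 else fdxi R x.2.
have pP := pproj_hom (relRb : set (gfree C (@degR n b))).
have dxh x : homog (degR x).+1 (dx x : gfree C (@degR n b)).
  by case: x => [[] i]; [apply: homog0|exact: (fgh true i)].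
have [] := @gida_presP C _ (@degR n b) (relRb) bx dx relR_homog _ _ dxh.
- by [].
- by case=> e i; rewrite /bx /= ibarK.
- move=> r /relRE [e [e' [i [j ->]]]].
  apply: (@color_rel_bar C I L (@ibar n b) Lam_conj Lam_bar
    (gfree C (@degR n b)) (fun e k => fgen C (e, k)) _ _ pP fgh genR_color
    (free_bar (@degR n b) bx)).
  + exact: free_bar_semilin.
  + by apply: fbarM.
  by move=> k l; apply: (fbar_gen C (@degR n b) bx (k, l)).
- move=> r /relRE [e [e' [i [j ->]]]].
  apply: (@color_rel_dif C I L
    (gfree C (@degR n b)) (fun e k => fgen C (e, k)) _ _ pP fgh genR_color
    (free_dif (@degR n b) dx)).
  + exact: free_dif_linear.
  + by apply: fdifM.
  + by move=> k; apply: (fdif_gen (@degR n b) dx).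
  by move=> k; apply: (fdif_gen (@degR n b) dx).
- case=> [[] i] /=; first by rewrite (lin0 (free_dif_linear _ _)) (lin0 (ah_linear pP)).
  rewrite [X in pproj _ X](fdif_gen (degR (b:=b)) dx (true, i)) /dx /=.
  by rewrite (lin0 (ah_linear pP)).
- case=> [[] i] /=; first by rewrite (sl0 (free_bar_semilin (C := C) _ _)).
  by rewrite [X in _ = pproj _ X](fbar_gen C (degR (b:=b)) bx (true, i)).
move=> gP gb gd; split=> //.
- by move=> e i; rewrite [LHS]gb; congr pproj; apply: (fbar_gen C (degR (b:=b)) bx (e, i)).
- by move=> i; rewrite [LHS]gd; congr pproj; apply: (fdif_gen (degR (b:=b)) dx (false, i)).
move=> i; rewrite [LHS]gd [X in pproj _ X](fdif_gen (degR (b:=b)) dx (true, i)).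
by rewrite (lin0 (ah_linear pP)).
Qed.

End Theta.

Lemma word_sandwich (C : comNzRingType) (X : Type) (F : pzAlg C) (gen : X -> F)
    (word : seq X -> F) (V : lmodType C) (phi : F -> V) s t x y x' y' a :
    word [::] = 1 -> (forall z u, word (z :: u) = gen z * word u) ->
    (forall u v, word (u ++ v) = word u * word v) -> linear phi ->
    phi (word (s ++ x :: y :: t)) = a *: phi (word (s ++ y' :: x' :: t)) ->
  phi (word s * (gen x * gen y - a *: (gen y' * gen x')) * word t) = 0.
Proof.
move=> w0 wc wcat l; rewrite !wcat !wc => h.
rewrite mulrBr mulrBl (linB l) pzmulZr pzmulZl (linZ l) -!mulrA h.
by rewrite subrr.
Qed.

Lemma free_lin_sandwich (C : comNzRingType) (X : choiceType) (phi : seq X -> C)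
    s t x y x' y' a :
    phi (s ++ x :: y :: t) = a * phi (s ++ y' :: x' :: t) ->
  free_lin (phi : seq X -> C^o)
    (fword C s * (fgen C x * fgen C y - a *: (fgen C y' * fgen C x')) * fword C t) = 0.
Proof.
move=> h; apply: (word_sandwich (fword0 C X) (@fword_cons C X) (@fword_cat C X)).
  exact: free_lin_linear.
by rewrite !free_lin_word h.
Qed.

Section DegreeZeroCoaction.
Context (C : numClosedFieldType) (I : finType) (L : I -> I -> C) (r : seq I).
Hypothesis Lii : forall i, L i i = 1.
Hypothesis LV : forall i j, L i j * L j i = 1.
Hypothesis rI : forall i, i \in r.
Hypothesis ru : uniq r.
Context (M A : gradedAlg C) (gen : bool -> I -> M) (T : I -> I -> A).
Hypothesis gc : gcolor L gen.
Hypothesis gh : forall (e : bool) i, homog e (gen e i).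
Hypothesis TT : color_mx L T.
Hypothesis Th : forall i j, homog 0 (T i j).

(** The case of [gcolor_tensor] with degree-1 matrix entries set to 0: [delta0] maps d xi^i to sum_j
    t^i_j ⊗ d xi^j, without terms in dt. *)
Lemma gcolor_coaction :
  gcolor L (fun (e : bool) (i : I) => \sum_j tn (T i j) (gen e j) : gtens A M).
Proof.
pose t (e : bool) (ij : I * I) : A := if e then 0 else T ij.1 ij.2.
pose x (e : bool) (js : I * unit) : M := gen e js.1.
have th (e : bool) k : homog e (t e k) by case: e; [apply: homog0|apply: Th].
have xh (e : bool) k : homog e (x e k) by apply: gh.
have tc : gcolor (fun a c => L a.1 c.1 * L c.2 a.2) t.
  move=> [] [] k l; rewrite /t ?(mulr0, mul0r) ?scaler0 //.
  by rewrite expr0 mul1r TT.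
have xc : gcolor (fun a c => L a.1 c.1 * (fun _ _ : unit => 1 : C) a.2 c.2) x.
  by move=> e e' k l; rewrite /= mulr1; apply: gc.
move=> e e' k l; have := gcolor_tensor (E := fun _ _ : unit => 1 : C) LV th xh tc xc e e' (k, tt) (l, tt).
rewrite /= mulr1 /t /x /=.
have z (f : bool) : \sum_j tn (0 : A) (gen f j) = 0.
  by apply: big1 => j _; apply: tn0l.
by case: e; case: e'; rewrite ?z ?add0r.
Qed.

(** The products of degree-1 generators along words form a swapping function, so each equals its
    [wsign] times the product along r. Collecting these coefficients produces [color_det]. *)
Lemma coaction_top (D : M -> gtens A M) : alg_hom D ->
    (forall i, D (gen true i) = \sum_j tn (T i j) (gen true j)) ->
  D (\prod_(i <- r) gen true i) = tn (color_det L r T) (\prod_(i <- r) gen true i).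
Proof.
move=> DP DE; set w0 := \prod_(i <- r) gen true i.
have dswap : swapping L (fun w => \prod_(i <- w) gen true i).
  move=> u i j v; rewrite !big_cat !big_cons /= [gen true i * (_ * _)]mulrA.
  rewrite gc // expr1 mulN1r pzmulZl pzmulZr.
  by rewrite [gen true j * (_ * _)]mulrA.
have dE w : size w = size r -> \prod_(i <- w) gen true i = wsign L r w *: w0.
  by move=> sw; rewrite (swapping_ref Lii LV rI ru dswap sw).
(* Here u collects the letters already chosen, their matrix entries having been pulled out to the
   left. The condition on sizes ensures that at the end u has the length of r. *)
have H v : forall u, (size u + size v)%N = size r ->
    tn 1 (\prod_(i <- u) gen true i) * \prod_(i <- v) \sum_j tn (T i j) (gen true j) =
    tn (mexp T v (fun w => wsign L r (u ++ w) *: (1 : A))) w0.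
  elim: v => [|i v IH] u; rewrite ?addn0 => su.
    by rewrite big_nil mulr1 (dE _ su) tnZr tnZl cats0.
  rewrite big_cons mulrA mulr_sumr mulr_suml /= tn_suml.
  apply: eq_bigr => j _.
  have e1 : tn 1 (\prod_(i <- u) gen true i) * tn (T i j) (gen true j) =
      tn (T i j) 1 * tn (1 : A) (\prod_(i <- rcons u j) gen true i).
    rewrite (tnM0r _ _ _ (Th i j)) (tnM0r _ _ _ (homog1 A)) !mul1r mulr1.
    by rewrite -cats1 big_cat /= big_cons big_nil mulr1.
  rewrite e1 -mulrA IH; last by rewrite size_rcons addSnnS.
  rewrite tnM0l; last exact: homog1.
  rewrite mul1r; congr (tn (_ * _) _); apply: eq_mexp => w _.
  by rewrite cat_rcons.
have := H r [::] (add0n _); rewrite big_nil tn1 mul1r => <-.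
rewrite /w0; elim: (r) => [|i v IH]; first by rewrite !big_nil (ah1 DP).
by rewrite !big_cons (ahM DP) IH DE.
Qed.

Lemma top_coeff_uniq (f : M -> C) (w : M) (D D' : A) : scalar f -> f w = 1 ->
  tn D w = tn D' w -> D = D'.
Proof.
move=> fl f1; have fb : bilin (fun (c : A) (w : M) => f w *: c).
  split=> [x a y z|c a y z]; first by rewrite scalerDr !scalerA mulrC.
  by rewrite fl scalerDl scalerA.
move/(congr1 (tens_lift idfun (fun (c : A) (w : M) => f w *: c))).
by rewrite !(gtlE fb) f1 !scale1r.
Qed.

End DegreeZeroCoaction.

Section Det.
Context (R : realType) (n : nat) (theta : 'M[R]_n) (htheta : theta^T = - theta).
Context (b : bool).
Local Notation C := (R[i]).
Local Notation I := (idx n b).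
Local Notation L := (@Lam R n theta b).
Local Notation r := (ref_word n b).
Local Notation relRb := (@relR R n theta b).
Local Notation relMb := (@relM R n theta b).
Local Notation gen e i := (genR theta (e, i) : Omega_R theta b).

Let LV : forall i j : I, L i j * L j i = 1 := LamV htheta (b:=b).
Let Lii : forall i : I, L i i = 1 := Lam_diag htheta (b:=b).
Let rI : forall i : I, i \in r := @ref_word_mem n b.
Let ru : uniq r := ref_word_uniq n b.

Let top (s : seq (bool * I)) : C :=
  if all fst s then wsign L r (map snd s) else 0.

Lemma top_form : exists2 f : Omega_R theta b -> C, scalar f & f (Omega0 theta b) = 1.
Proof.
have top_swap s t e e' i j : top (s ++ (e, i) :: (e', j) :: t) =
    ((-1) ^+ (e && e') * L i j) * top (s ++ (e', j) :: (e, i) :: t).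
  rewrite /top !all_cat /= [e && (e' && _)]andbCA; case: (e) (e') => [] [] /=;
    rewrite ?andbF ?mulr0 //.
  case: ifP => _; last by rewrite mulr0.
  by rewrite !map_cat /= expr1 mulN1r; apply: (wsign_swap LV rI).
have [f fl fE] : exists2 f : Omega_R theta b -> C, scalar f &
    forall s, f (pproj relRb (fword C s)) = top s.
  apply: pres_functional; first exact: relR_homog.
  move=> x s t /relRE [e [e' [i [j ->]]]].
  exact: (free_lin_sandwich (top_swap s t e e' i j)).
exists f => //; rewrite Omega0_word.
have -> : \prod_(i <- r) dxi theta i = pproj relRb (fword C [seq (true, i) | i <- r]).
  by rewrite pproj_fword big_map.
rewrite fE /top all_map -map_comp map_id_in //.
have -> : all (preim (fun i : I => (true, i)) fst) r by apply/allP.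
by rewrite (wsign_ref L ru).
Qed.

(** The form dual to the monomial xi^i xi^j, color symmetrized so as to respect xi^k xi^l = L k l
    xi^l xi^k. *)
Let quad (i j : I) (s : seq (bool * I)) : C :=
  if s is [:: (false, k); (false, l)] then
    ((k == i) && (l == j))%:R + L k l * ((k == j) && (l == i))%:R
  else 0.

Lemma quad_form (i j : I) : exists2 f : Omega_R theta b -> C, scalar f &
  forall k l, f (xi theta k * xi theta l) =
    ((k == i) && (l == j))%:R + L k l * ((k == j) && (l == i))%:R.
Proof.
have quad_swap s t e e' k l : quad i j (s ++ (e, k) :: (e', l) :: t) =
    ((-1) ^+ (e && e') * L k l) * quad i j (s ++ (e', l) :: (e, k) :: t).
  case: s => [|[a1 a2] [|[a3 a4] [|? ?]]] /=; last 1 first.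
  - by case: a1; case: a3; rewrite ?mulr0.
  - case: t => [|? ?]; last by case: (e); case: (e'); rewrite ?mulr0.
    case: (e); case: (e'); rewrite /= ?mulr0 // expr0 mul1r mulrDr mulrA LV mul1r addrC.
    by rewrite [(l == j) && _]andbC [(l == i) && _]andbC.
  - by case: a1; case: (e); case: (e'); rewrite ?mulr0.
  by case: a1; case: a3; rewrite ?mulr0.
have [f fl fE] : exists2 f : Omega_R theta b -> C, scalar f &
    forall s, f (pproj relRb (fword C s)) = quad i j s.
  apply: pres_functional; first exact: relR_homog.
  move=> x s t /relRE [e [e' [k [l ->]]]].
  exact: (free_lin_sandwich (quad_swap s t e e' k l)).
exists f => // k l.
have -> : xi theta k * xi theta l = pproj relRb (fword C [:: (false, k); (false, l)]).
  by rewrite pproj_fword !big_cons big_nil mulr1.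
by rewrite fE.
Qed.

Lemma relM_homog x : relMb x -> exists p, homog p (x : gfree C (fun _ : I * I => 0%N)).
Proof.
have h (y : I * I) := gen_homog (free_generated C (fun _ : I * I => 0%N)) y.
case=> i j k l; exists 0%N; apply: homogB; first exact: (homogM (h (i, j)) (h (k, l))).
by apply: homogZ; apply: (homogM (h (k, l)) (h (i, j))).
Qed.

Lemma tM_color : color_mx L (@tM R n theta b).
Proof. by move=> i j k l; apply: pgen_rel; apply: RelM. Qed.

Lemma tM_generated : generated (fun _ : I * I => 0%N)
  (fun x => tM theta x.1 x.2 : M_theta theta b).
Proof.
have [h1 h2] := pgen_generated (relMb : set (gfree C (fun _ : I * I => 0%N))).
split; first by case=> i j; exact: (h1 (i, j)).
move=> P P1 PD Pg; apply: (h2 P P1 PD); case=> i j p y hy Py.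
exact: (Pg (i, j) p y hy Py).
Qed.

Lemma M_theta_lift (B : pzAlg C) (T : I -> I -> B) : color_mx L T ->
  let f : M_theta theta b -> B := plift (rel := relMb) (fun x => T x.1 x.2) in
  alg_hom f /\ (forall i j, f (tM theta i j) = T i j).
Proof.
move=> TT f.
have fr x : relMb x -> free_eval (fun x => T x.1 x.2) x = 0.
  case=> i j k l; apply: (free_eval_rel (fun _ : I * I => 0%N)); exact: TT.
split; first exact: (plift_hom relM_homog fr).
by move=> i j; apply: (plift_gen relM_homog fr (i, j)).
Qed.

Section Delta0.
Context (A : gradedAlg C) (T : I -> I -> A).
Hypothesis TT : color_mx L T.
Hypothesis Th : forall i j, homog 0 (T i j).

Let gc := genR_color htheta (b:=b).
Let gh := @genR_homog R n theta b.

Lemma delta0_hom : alg_hom (delta0 T : Omega_R theta b -> gtens A (Omega_R theta b)).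
Proof.
have [h _] := Omega_R_lift (gcolor_coaction LV gc gh TT Th).
exact h.
Qed.

Lemma delta0_gen e i : delta0 T (gen e i) = \sum_j tn (T i j) (gen e j).
Proof.
have [_ h] := Omega_R_lift (gcolor_coaction LV gc gh TT Th).
exact (h e i).
Qed.

Lemma delta0_Omega0 : delta0 T (Omega0 theta b) = tn (color_det L r T) (Omega0 theta b).
Proof.
rewrite Omega0_word.
exact (coaction_top Lii LV rI ru gc Th delta0_hom (delta0_gen true)).
Qed.

End Delta0.

(** The color determinant solves the equation defining [det_theta], so [xget] returns a solution,
    and the form of [top_form] shows that there is only one. *)
Lemma det_thetaE : det_theta theta b = color_det L r (@tM R n theta b).
Proof.
have tMh i j : homog 0 (tM theta i j : M_theta theta b).
  exact: (gen_homog tM_generated (i, j)).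
have h := delta0_Omega0 tM_color tMh.
have : delta0 (@tM R n theta b) (Omega0 theta b) =
    tn (det_theta theta b) (Omega0 theta b).
  apply: (@xgetPex _ 0 [set D : M_theta theta b |
    delta0 (@tM R n theta b) (Omega0 theta b) = D ⊗ Omega0 theta b]%classic).
  by exists (color_det L r (@tM R n theta b)).
rewrite h; have [f fl f0] := top_form.
by move/(top_coeff_uniq fl f0).
Qed.

Lemma det_theta_lift (B : pzAlg C) (T : I -> I -> B) : color_mx L T ->
  plift (rel := relMb) (fun x => T x.1 x.2) (det_theta theta b) = color_det L r T.
Proof.
move=> TT; have [fP fE] := M_theta_lift TT.
rewrite det_thetaE; apply: etrans (color_det_hom _ _ _ fP) _.
by apply: eq_color_det.
Qed.

End Det.

(** * The determinant in a differential algebra *)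

Section ColorDga.
Context (C : numClosedFieldType) (I : finType) (L : I -> I -> C) (r : seq I).
Hypothesis Lii : forall i, L i i = 1.
Hypothesis LV : forall i j, L i j * L j i = 1.
Hypothesis Lc : forall i j, (L i j)^* = L j i.
Hypothesis rI : forall i, i \in r.
Hypothesis ru : uniq r.
Hypothesis Ll : forall k, \prod_i L i k = 1.
Hypothesis Lr : forall k, \prod_i L k i = 1.

Definition mcolor (a b : I * I) : C := L a.1 b.1 * L b.2 a.2.

Lemma mcolorV a b : mcolor a b * mcolor b a = 1.
Proof. by rewrite /mcolor mulrACA LV LV mulr1. Qed.
Lemma mcolor_conj a b : (mcolor a b)^* = mcolor b a.
Proof. by rewrite /mcolor rmorphM /= !Lc. Qed.

Context (A : gradedAlg C) (d : A -> A) (dP : is_dga d) (T : I -> I -> A).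

Definition dmx (e : bool) (a : I * I) : A :=
  if e then d (T a.1 a.2) else T a.1 a.2.

Hypothesis Th : forall i j, homog 0 (T i j).
Hypothesis Tc : gcolor mcolor dmx.

Let dl := dga_linear dP.

Lemma dmx_homog (e : bool) a : homog e (dmx e a).
Proof. by case: e; [apply: (dga_homog dP (Th _ _))|apply: Th]. Qed.

Lemma dmx_color_mx : color_mx L T.
Proof.
by move=> i j k l; have := Tc false false (i, j) (k, l); rewrite /= expr0 mul1r.
Qed.

Local Notation det := (color_det L r T).
Let deth : homog 0 det := color_det_homog L r Th.

Lemma det_central e a : dmx e a * det = det * dmx e a.
Proof.
have h i j : dmx e a * T i j = (L a.1 i * L j a.2) *: (T i j * dmx e a).
  by have := Tc e false a (i, j); rewrite andbF expr0 mul1r.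
by rewrite (color_det_scal L rI ru h) Ll Lr mulr1 scale1r.
Qed.

Lemma ddet_central e a : dmx e a * d det = (-1) ^+ e *: (d det * dmx e a).
Proof.
have h0 : T a.1 a.2 * det = 1 *: (det * T a.1 a.2).
  by rewrite scale1r; apply: (det_central false a).
have h1 : d (T a.1 a.2) * det = 1 *: (det * d (T a.1 a.2)).
  by rewrite scale1r; apply: (det_central true a).
have h2 : d (d (T a.1 a.2)) * det = 1 *: (det * d (d (T a.1 a.2))).
  by rewrite (dga2 dP) mul0r mulr0 scaler0.
case: e => /=.
  by rewrite (gcolor_dif dP (dga_homog dP (Th a.1 a.2)) deth h1 h2) mulr1.
by rewrite (gcolor_dif dP (Th a.1 a.2) deth h0 h1) mulr1.
Qed.

(** Differentiating the commutation of det with d det gives - (d det)^2 = (d det)^2. *)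
Lemma ddet_sq : d det * d det = 0.
Proof.
have h : d det * det = det * d det.
  have key v (f : seq I -> C) : det * d (mexp T v (fun w => f w *: (1 : A))) =
      d (mexp T v (fun w => f w *: (1 : A))) * det.
    elim: v f => [|i v IH] f /=; first by rewrite (linZ dl) (dga1 dP) scaler0 mulr0 mul0r.
    have hm u (g : seq I -> C) : det * mexp T u (fun w => g w *: (1 : A)) =
        mexp T u (fun w => g w *: (1 : A)) * det.
      elim: u g => [|j u IHu] g /=; first by rewrite pzmulZl pzmulZr mul1r mulr1.
      rewrite mulr_sumr mulr_suml; apply: eq_bigr => k _.
      by rewrite mulrA -(det_central false (j, k)) -!mulrA IHu.
    rewrite (lin_sum dl) mulr_sumr mulr_suml; apply: eq_bigr => k _.
    rewrite (dgaM dP _ (Th i k)) expr0 scale1r mulrDr mulrDl !mulrA.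
    rewrite -(det_central true (i, k)) -(det_central false (i, k)) -!mulrA.
    by rewrite (IH (fun w => f (k :: w))) hm.
  exact: (esym (key r (wsign L r))).
have /eqP := congr1 d h; rewrite (dgaM dP _ (dga_homog dP deth)) (dgaM dP _ deth).
rewrite (dga2 dP) mul0r mulr0 scaler0 add0r addr0 expr1 scaleN1r eq_sym -addr_eq0.
by rewrite -mulr2n -scaler_nat scaler_eq0 pnatr_eq0 /= => /eqP.
Qed.

Context (V : A) (detV : det * V = 1).
Hypothesis VT : forall e a, V * dmx e a = dmx e a * V.

Let Vmexp v (f : seq I -> C) : V * mexp T v (fun w => f w *: (1 : A)) =
  mexp T v (fun w => f w *: (1 : A)) * V.
Proof.
elim: v f => [|i v IH] f /=; first by rewrite pzmulZl pzmulZr mul1r mulr1.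
rewrite mulr_sumr mulr_suml; apply: eq_bigr => k _.
by rewrite mulrA (VT false (i, k)) -!mulrA (IH (fun w => f (k :: w))).
Qed.

Lemma Vdet : V * det = 1.
Proof. by rewrite -detV /color_det Vmexp. Qed.

Lemma Vddet : V * d det = d det * V.
Proof.
rewrite /color_det; move: (wsign L r); elim: (r) => [|i v IH] f /=.
  by rewrite (linZ dl) (dga1 dP) scaler0 mulr0 mul0r.
rewrite (lin_sum dl) mulr_sumr mulr_suml; apply: eq_bigr => k _.
rewrite (dgaM dP _ (Th i k)) expr0 scale1r mulrDr mulrDl !mulrA.
rewrite (VT true (i, k)) (VT false (i, k)) -!mulrA.
by rewrite (IH (fun w => f (k :: w))) Vmexp.
Qed.

(** Obtained by differentiating det V = 1 and multiplying by V. Consequently a homomorphism that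
    commutes with d on T does so on V as well ([hom_dif_detV]). *)
Lemma dif_detV : d V = - (V ^+ 2 * d det).
Proof.
have h := congr1 d detV; move: h.
rewrite (dgaM dP _ deth) (dga1 dP) expr0 scale1r => /(congr1 (fun x => V * x)) /=.
rewrite mulrDr mulr0 !mulrA Vdet mul1r addrC => /eqP; rewrite addr_eq0 => /eqP ->.
by rewrite -!mulrA -Vddet mulrA -expr2.
Qed.

Lemma color_mx_inverse : exists S : I -> I -> A,
  (forall i j, \sum_k T i k * S k j = (i == j)%:R) /\
  (forall i j, \sum_k S i k * T k j = (i == j)%:R).
Proof. exact: (color_inverse Lii LV Lc rI ru dmx_color_mx detV Vdet). Qed.

Context (S : I -> I -> A).
Hypothesis TS : forall i j, \sum_k T i k * S k j = (i == j)%:R.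
Hypothesis ST : forall i j, \sum_k S i k * T k j = (i == j)%:R.

(** As T has degree 0, the degree-0 components of S also form a right inverse of T, and they
    coincide with S because S is a left inverse. *)
Lemma inverse_homog i j : homog 0 (S i j).
Proof.
have e1 a k : \sum_l T a l * gcomp 0 (S l k) = (a == k)%:R.
  have := congr1 (gcomp 0) (TS a k); rewrite gcomp_bigsum.
  have -> : gcomp 0 ((a == k)%:R : A) = (a == k)%:R.
    by case: (a == k); [apply: homog1|apply: gcomp0].
  move=> <-; apply: eq_bigr => l _.
  have [N e] := gcomp_sum (S l k); rewrite {2}e mulr_sumr gcomp_bigsum.
  case: N e => [|N] e; first by rewrite e !big_ord0 gcomp0 mulr0.
  rewrite (bigD1 ord0) //= (homogE _ (homogMl0 (Th a l) (homog_gcomp 0 _))) eqxx.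
  rewrite big1 ?addr0 // => p p0.
  rewrite (homogE _ (homogMl0 (Th a l) (homog_gcomp _ _))) ifF //.
  by apply/negbTE; apply: contra p0 => /eqP e0; apply/eqP/val_inj.
have : gcomp 0 (S i j) = \sum_k S i k * (k == j)%:R.
  under eq_bigr => k _ do rewrite -e1 mulr_sumr.
  rewrite exchange_big /=.
  have e2 l : \sum_k S i k * (T k l * gcomp 0 (S l j)) = (i == l)%:R * gcomp 0 (S l j).
    by rewrite -ST mulr_suml; apply: eq_bigr => k _; rewrite mulrA.
  rewrite (eq_bigr _ (fun l _ => e2 l)) (bigD1 i) //= eqxx mul1r big1 ?addr0 // => l li.
  by rewrite eq_sym (negbTE li) mul0r.
rewrite (bigD1 j) //= eqxx mulr1 big1 ?addr0 // => k /negbTE ->.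
by rewrite mulr0.
Qed.

Let dS (e : bool) (a : I * I) : A := if e then d (S a.1 a.2) else S a.1 a.2.

(* The weights of S i j are those of T j i, inverted. *)
Let T_S e a p q : dmx e a * S p q = (L q a.1 * L a.2 p) *: (S p q * dmx e a).
Proof.
have h i j : dmx e a * T i j = (L a.1 i * L j a.2) *: (T i j * dmx e a).
  by have := Tc e false a (i, j); rewrite andbF expr0 mul1r.
rewrite (inverse_color TS ST (fun i => LV a.1 i) (fun j => LV j a.2) h).
by rewrite mulrC.
Qed.

Let T_dS a p q : T a.1 a.2 * d (S p q) = (L q a.1 * L a.2 p) *: (d (S p q) * T a.1 a.2).
Proof.
rewrite (gcolor_dif (p := 0) (a := L q a.1 * L a.2 p) dP (Th _ _) (inverse_homog p q)).
- by rewrite expr0 mul1r.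
- exact: (T_S false a).
exact: (T_S true a).
Qed.

(** Conjugating twice by [inverse_color] gives S_pq S_ij = L i p L q j S_ij S_pq in A, which in the
    opposite algebra is the original commutation rule. The relations with dS come from [gcolor_dif]
    and from conjugating again. *)
Lemma inverse_gcolor :
  gcolor mcolor (fun e a => toop (dS e a) : gop A).
Proof.
have Sh := inverse_homog.
have S_S p q i j : S p q * S i j = (L i p * L q j) *: (S i j * S p q).
  have h k l : S p q * T k l = (L k q * L p l) *: (T k l * S p q).
    have := T_S false (k, l) p q; rewrite /= => ->.
    by rewrite scalerA mulrACA LV LV mulr1 scale1r.
  by rewrite (inverse_color TS ST (fun k => LV k q) (fun l => LV p l) h) mulrC [L q j * _]mulrC.
have dS_S p q i j : d (S p q) * S i j = (L i p * L q j) *: (S i j * d (S p q)).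
  have h k l : d (S p q) * T k l = (L k q * L p l) *: (T k l * d (S p q)).
    have := T_dS (k, l) p q; rewrite /= => ->.
    by rewrite scalerA mulrACA LV LV mulr1 scale1r.
  by rewrite (inverse_color TS ST (fun k => LV k q) (fun l => LV p l) h) mulrC [L q j * _]mulrC.
have S_dS p q i j : S p q * d (S i j) = (L i p * L q j) *: (d (S i j) * S p q).
  by rewrite dS_S scalerA mulrACA LV LV mulr1 scale1r.
have dS_dS p q i j : d (S p q) * d (S i j) = - (L i p * L q j) *: (d (S i j) * d (S p q)).
  rewrite (gcolor_dif (p := 1) (a := L i p * L q j) dP (dga_homog dP (Sh p q)) (Sh i j)) //.
    by rewrite expr1 mulN1r.
  by rewrite (dga2 dP) !mul0r mulr0 scaler0.
move=> e e' a c; apply: (congr1 (@toop C A) (_ : dS e' c * dS e a = _)).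
rewrite /dS /mcolor; case: e; case: e' => /=; rewrite ?expr0 ?expr1 ?mul1r ?mulN1r.
- exact: dS_dS.
- exact: S_dS.
- exact: dS_S.
exact: S_S.
Qed.

Lemma inverse_color_op : color_mx L (fun i j => toop (S i j) : gop A).
Proof.
move=> i j k l; have := inverse_gcolor false false (i, j) (k, l).
by rewrite expr0 mul1r.
Qed.

Lemma det_inverse : ofop (color_det L r (fun i j => toop (S i j))) = V.
Proof.
have := color_det_inv Lii LV rI ru TS inverse_color_op.
move/(congr1 (fun x => V * x)); rewrite /= mulrA Vdet mul1r mulr1.
by [].
Qed.

End ColorDga.

(** * The differential algebra of GL_theta *)

Lemma generated_central (C : comNzRingType) (A : gradedAlg C) (X : Type)
    (deg : X -> nat) (g : X -> A) (v : A) : generated deg g ->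
  (forall x, v * g x = g x * v) -> forall q, v * q = q * v.
Proof.
move=> Ag vg; apply: (gen_ind Ag) => [|a x y hx hy|x p y hy IH].
- by rewrite mul1r mulr1.
- by rewrite mulrDl mulrDr pzmulZl pzmulZr hx hy.
by rewrite mulrA vg -mulrA IH mulrA.
Qed.

Lemma alg_hom_sign_comm (C : comNzRingType) (A B : pzAlg C) (f : A -> B) (e : bool) (x y : A) :
    alg_hom f -> x * y = (-1) ^+ e *: (y * x) ->
  f y * f x = (-1) ^+ e *: (f x * f y).
Proof.
move=> fP h; rewrite -!(ahM fP) h (linZ (ah_linear fP)) scalerA -expr2 -exprM.
by rewrite mulnC exprM sqrrN expr1n expr1n scale1r.
Qed.

Lemma fbar1 (C : numClosedFieldType) (X : choiceType) (deg : X -> nat) (bx : X -> X) :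
  (free_bar deg bx : gfree C deg -> gfree C deg) 1 = 1.
Proof. by apply: etrans (free_bar_word C deg bx [::]); rewrite fword0. Qed.

(** * The differential of the determinant and of its inverse *)

Section SubalgebraDif.
Context (C : comNzRingType) (Y : Type) (G : gradedAlg C) (g : Y -> G).
Hypothesis Gg : generated (fun=> 0%N) g.
Context (F : gradedAlg C) (E : G -> F) (tf dtf : Y -> F).
Hypothesis EP : alg_hom E.
Hypothesis Eg : forall y, E (g y) = tf y.
Hypothesis tfh : forall y, homog 0 (tf y).
Hypothesis dtfh : forall y, homog 1 (dtf y).
Context (d2 : F -> F) (l2 : linear d2).
Hypothesis M2 : forall p x y, homog p x ->
  d2 (x * y) = d2 x * y + (-1) ^+ p *: (x * d2 y).
Hypothesis d21 : d2 1 = 0.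
Hypothesis d2t : forall y, d2 (tf y) = dtf y.

Lemma subalg_dif_homog y : homog 0 (E y) /\ homog 1 (d2 (E y)).
Proof.
move: y; apply: (gen_ind Gg) => [|a x y [h1 h2] [h3 h4]|x p y hy [h1 h2]].
- by rewrite (ah1 EP) d21; split; [apply: homog1|apply: homog0].
- by rewrite (ah_linear EP) l2; split; apply: homogD => //; apply: homogZ.
rewrite (ahM EP) Eg (M2 _ (tfh x)) d2t; split; first exact: homog0M.
apply: homogD; first exact: homogM0r.
by apply: homogZ; apply: homogMl0.
Qed.

(** The differential of det^-1 is defined through an auxiliary differential that ignores det^-1. On
    polynomials in the t^i_j the two differentials agree, and the full one kills the value of the
    auxiliary one. *)
Lemma subalg_dif (d1 : F -> F) : linear d1 ->
    (forall p x y, homog p x -> d1 (x * y) = d1 x * y + (-1) ^+ p *: (x * d1 y)) ->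
    d1 1 = 0 -> (forall y, d1 (tf y) = dtf y) -> (forall y, d1 (dtf y) = 0) ->
  forall y, d1 (E y) = d2 (E y) /\ d1 (d2 (E y)) = 0.
Proof.
move=> l1 M1 d11 d1t d1d.
apply: (gen_ind Gg) => [|a x y [h1 h2] [h3 h4]|x p y hy [h1 h2]].
- by rewrite (ah1 EP) d11 d21 (lin0 l1).
- by rewrite (ah_linear EP) !l1 !l2 l1 h1 h2 h3 h4 scaler0 addr0.
rewrite (ahM EP) Eg (M1 _ _ _ (tfh x)) (M2 _ (tfh x)) d2t d1t h1; split=> //.
rewrite expr0 scale1r (linD l1) (M1 _ _ _ (dtfh x)) (M1 _ _ _ (tfh x)).
by rewrite d1d d1t h1 h2 mul0r add0r mulr0 scaler0 addr0 expr1 scaleN1r addNr.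
Qed.

End SubalgebraDif.

Section DetRelations.
Context (C : numClosedFieldType) (F : gradedAlg C) (Q : pzAlg C) (pp : F -> Q).
Hypothesis pP : alg_hom pp.
Context (bar d : F -> F) (bl : semilin Num.conj bar) (dl : linear d).
Hypothesis bM : forall p q (x y : F), homog p x -> homog q y ->
  bar (x * y) = (-1) ^+ (p * q) *: (bar y * bar x).
Hypothesis b1 : bar 1 = 1.
Hypothesis dM : forall p x y, homog p x ->
  d (x * y) = d x * y + (-1) ^+ p *: (x * d y).
Hypothesis d1 : d 1 = 0.
Context (vf f D : F).
Hypothesis vfh : homog 0 vf.
Hypothesis fh : homog 0 f.
Hypothesis Dh : homog 1 D.
Hypothesis df : d f = D.
Hypothesis dD : d D = 0.
Hypothesis dv : d vf = - (vf ^+ 2 * D).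
Hypothesis bv : bar vf = vf.
Hypothesis fv : pp f * pp vf = 1.
Hypothesis vC : forall q, pp vf * q = q * pp vf.
Hypothesis DD : pp D * pp D = 0.
Hypothesis bf : pp (bar f) = pp f.
Hypothesis bD : pp (bar D) = pp D.

Let pl := ah_linear pP.

Let pdv : pp (d vf) = - (pp vf * pp vf * pp D).
Proof. by rewrite dv (linN pl) expr2 !(ahM pP). Qed.

Lemma det_rel_bar : pp (bar (f * vf - 1)) = 0.
Proof.
rewrite (slB bl) (bM fh vfh) b1 muln0 expr0 scale1r bv (linB pl) (ahM pP) bf.
by rewrite vC fv (ah1 pP) subrr.
Qed.

Lemma det_rel_dif : pp (d (f * vf - 1)) = 0.
Proof.
rewrite (linB dl) d1 subr0 (dM _ fh) expr0 scale1r (linD pl) !(ahM pP) pdv df.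
by rewrite mulrN !mulrA fv mul1r vC subrr.
Qed.

Lemma central_rel_bar p x : homog p x -> pp (bar (vf * x - x * vf)) = 0.
Proof.
move=> hx; rewrite (slB bl) (bM vfh hx) (bM hx vfh) mul0n muln0 expr0 !scale1r bv.
by rewrite (linB pl) !(ahM pP) vC subrr.
Qed.

Lemma central_rel_dif p x : homog p x ->
    pp D * pp x = (-1) ^+ p *: (pp x * pp D) ->
  pp (d (vf * x - x * vf)) = 0.
Proof.
move=> hx h; rewrite (linB dl) (dM _ vfh) (dM _ hx) expr0 scale1r.
rewrite (linB pl) !(linD pl) (linZ pl) !(ahM pP) pdv.
have -> : - (pp vf * pp vf * pp D) * pp x = (-1) ^+ p *: (pp x * - (pp vf * pp vf * pp D)).
  rewrite mulNr mulrN scalerN -!mulrA h !pzmulZr; congr (- (_ *: _)).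
  rewrite (mulrA (pp vf) (pp x)) (vC (pp x)) -(mulrA (pp x)).
  by rewrite (mulrA (pp vf) (pp x)) (vC (pp x)) -(mulrA (pp x)).
by rewrite (vC (pp (d x))) [X in X - _]addrC subrr.
Qed.

Lemma dif2_detV : pp (d (d vf)) = 0.
Proof.
have v2h : homog 0 (vf ^+ 2) by apply: homog0X.
rewrite dv (linN dl) (dM _ v2h) dD mulr0 scaler0 addr0 expr2 (dM _ vfh) expr0 scale1r.
rewrite (linN pl) !(ahM pP) (linD pl) !(ahM pP) pdv.
rewrite mulrDl mulNr mulrN !mulNr -!mulrA.
have -> : pp D * (pp vf * pp D) = 0 by rewrite mulrA -vC -mulrA DD mulr0.
by rewrite DD !mulr0 oppr0 addr0 oppr0.
Qed.

Lemma dif_bar_detV : pp (d vf) = pp (bar (d vf)).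
Proof.
have v2h : homog 0 (vf ^+ 2) by apply: homog0X.
rewrite pdv dv (slN bl) (bM v2h Dh) mul0n expr0 scale1r expr2 (bM vfh vfh).
rewrite muln0 expr0 scale1r bv (linN pl) !(ahM pP) bD; congr (- _).
by rewrite -mulrA vC -mulrA vC -mulrA.
Qed.

End DetRelations.

Section OmegaGL.
Context (R : realType) (n : nat) (theta : 'M[R]_n) (htheta : theta^T = - theta).
Context (b : bool).
Local Notation C := (R[i]).
Local Notation I := (idx n b).
Local Notation L := (@Lam R n theta b).
Local Notation r := (ref_word n b).
Local Notation X := (option (bool * I * I)).
Local Notation F := (gfree C (@degGL n b)).
Local Notation fO := (free C X).
Local Notation relO := (@relOmega R n theta b).
Local Notation OGL := (Omega_GL theta b).

Let LV : forall i j : I, L i j * L j i = 1 := LamV htheta (b:=b).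
Let Lii : forall i : I, L i i = 1 := Lam_diag htheta (b:=b).
Let Lc : forall i j : I, (L i j)^* = L j i := Lam_conj htheta (b:=b).
Let rI : forall i : I, i \in r := @ref_word_mem n b.
Let ru : uniq r := ref_word_uniq n b.
Let Ll : forall k : I, \prod_i L i k = 1 := prod_Lam_l htheta (b:=b).
Let Lr : forall k : I, \prod_i L k i = 1 := prod_Lam_r htheta (b:=b).
Let mV := mcolorV LV.

Let key (e : bool) (a : I * I) : X := Some (e, a.1, a.2).
Let fg (e : bool) (a : I * I) : F := fgen C (key e a).
Let bb (a : I * I) : I * I := (ibar a.1, ibar a.2).

Let mbar a c : mcolor L (bb a) (bb c) = mcolor L a c.
Proof. by rewrite /mcolor /= !Lam_bar. Qed.

Definition color_rel (e e' : bool) (a c : I * I) : fO :=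
  fg e a * fg e' c - ((-1) ^+ (e && e') * mcolor L a c) *: (fg e' c * fg e a).

Let Fg := free_generated C (@degGL n b).
Let fgh (e : bool) a : homog e (fg e a). Proof. exact: (gen_homog Fg (key e a)). Qed.
Let vh : homog 0 (fdetV R n b : F). Proof. exact: (gen_homog Fg None). Qed.

Let color_rel_homog (e e' : bool) a c : homog (e + e') (color_rel e e' a c : F).
Proof.
have h : homog (e + e') (fg e' c * fg e a).
  by rewrite addnC; exact: (homogM (fgh e' c) (fgh e a)).
exact: (homogB (homogM (fgh e a) (fgh e' c)) (homogZ _ h)).
Qed.

(* The facts on bar det and d det that make the relations of det^-1 stable are *)
(* proved first in the algebra without these relations, where the differential *)
(* of the generator det^-1 is set to 0.                                        *)
Definition relO0 (x : fO) : Prop := exists e e' a c, x = color_rel e e' a c.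
Local Notation O0 := (gida_pres (deg := @degGL n b) relO0 (@barOmega n b) (@difOmega_t R n b)).
Local Notation pp0 := (pproj (relO0 : set F)).

Let relO0_homog x : relO0 x -> exists p, homog p (x : F).
Proof. by case=> [e [e' [a [c ->]]]]; exists (e + e')%N. Qed.

Let O0_color : gcolor (mcolor L) (fun e a => pgen (relO0 : set F) (key e a)).
Proof.
move=> e e' a c; apply: pgen_rel.
by exists e, e', a, c.
Qed.

Let dth x : homog (degGL x).+1 (difOmega_t R x : F).
Proof. by case: x => [[[[] i] j]|]; [apply: homog0|exact: (fgh true (i, j))|apply: homog0]. Qed.

Let barO_deg (x : X) : degGL (barOmega x) = degGL x.
Proof. by case: x => [[[e i] j]|]. Qed.
Let barOK : involutive (@barOmega n b).
Proof. by case=> [[[e i] j]|] //=; rewrite !ibarK. Qed.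

Let O0_gida :
  [/\ is_gida O0,
      forall x, gbar (pp0 x : O0) = pp0 (free_bar (@degGL n b) (@barOmega n b) x) &
      forall x, gdif (pp0 x : O0) = pp0 (free_dif (@degGL n b) (@difOmega_t R n b) x)].
Proof.
have pP := pproj_hom (relO0 : set F).
have gd x := fdif_gen (@degGL n b) (@difOmega_t R n b) x.
have z : pp0 0 = 0 := lin0 (ah_linear pP).
apply: (@gida_presP C _ (@degGL n b) relO0 (@barOmega n b) (@difOmega_t R n b)
   relO0_homog barO_deg barOK dth).
- move=> x [e [e' [a [c ->]]]].
  apply: (@color_rel_bar C (I * I)%type (mcolor L) bb (mcolor_conj Lc) mbar
    F fg _ _ pP fgh O0_color (free_bar (@degGL n b) (@barOmega n b))).
  + exact: free_bar_semilin.
  + by apply: fbarM.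
  by move=> k l; apply: (fbar_gen C (@degGL n b) (@barOmega n b) (key k l)).
- move=> x [e [e' [a [c ->]]]].
  apply: (@color_rel_dif C (I * I)%type (mcolor L)
    F fg _ _ pP fgh O0_color (free_dif (@degGL n b) (@difOmega_t R n b))).
  + exact: free_dif_linear.
  + by apply: fdifM.
  + by case=> i j; apply: (gd (key false (i, j))).
  by case=> i j; apply: (gd (key true (i, j))).
- move=> x; have -> : free_dif (@degGL n b) (@difOmega_t R n b) (difOmega_t R x) = 0.
    case: x => [[[[] i] j]|] /=; [exact: (lin0 (free_dif_linear _ _))| |exact: (lin0 (free_dif_linear _ _))].
    exact: (gd (key true (i, j))).
  exact: z.
move=> x; congr pproj; case: x => [[[[] i] j]|] /=; last exact: esym (sl0 (free_bar_semilin (C := C) _ _)).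
  exact: esym (sl0 (free_bar_semilin (C := C) _ _)).
exact: esym (fbar_gen C (@degGL n b) (@barOmega n b) (key true (i, j))).
Qed.

Local Notation pp := (pproj (relO : set F)).
Local Notation fE := (free_eval (fun x : I * I => ft R x.1 x.2)).
Local Notation fdt0 := (free_dif (@degGL n b) (@difOmega_t R n b)).
Local Notation fd := (free_dif (@degGL n b) (@difOmega R n theta b)).
Local Notation fb := (free_bar (@degGL n b) (@barOmega n b)).
Local Notation D := (fdt0 (fdet theta b)).

Lemma relOE x : relO x -> [\/ exists e e' a c, x = color_rel e e' a c,
    x = fdet theta b * fdetV R n b - 1 |
    exists y, x = fdetV R n b * fgen C y - fgen C y * fdetV R n b].
Proof.
case=> [i j k l|i j k l|i j k l||y].
- by constructor 1; exists false, false, (i, j), (k, l); rewrite /color_rel expr0 mul1r.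
- by constructor 1; exists false, true, (i, j), (k, l); rewrite /color_rel expr0 mul1r.
- constructor 1; exists true, true, (i, j), (k, l).
  by rewrite /color_rel expr1 mulN1r scaleNr opprK.
- by constructor 2.
by constructor 3; exists y.
Qed.

Let fEP : alg_hom (fE : gfree C (fun _ : I * I => 0%N) -> F) :=
  free_eval_hom (fun _ : I * I => 0%N) (fun x => ft R x.1 x.2 : F).
Let fEg x : fE (fgen C x) = ft R x.1 x.2 :=
  free_eval_gen (fun _ : I * I => 0%N) (fun x => ft R x.1 x.2 : F) x.
Let Gg := free_generated C (fun _ : I * I => 0%N).
Let tfh (x : I * I) : homog 0 (ft R x.1 x.2 : F) := fgh false x.
Let dtfh (x : I * I) : homog 1 (fdt R x.1 x.2 : F) := fgh true x.
Let fdt01 : fdt0 1 = 0 := fdif1 _ _.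
Let fd1 : fd 1 = 0 := fdif1 _ _.
Let fdt0t (x : I * I) : fdt0 (ft R x.1 x.2) = fdt R x.1 x.2 :=
  fdif_gen (@degGL n b) (@difOmega_t R n b) (key false x).
Let fdt_ (x : I * I) : fd (ft R x.1 x.2) = fdt R x.1 x.2 :=
  fdif_gen (@degGL n b) (@difOmega R n theta b) (key false x).
Let fdd (x : I * I) : fd (fdt R x.1 x.2) = 0 := fdif_gen (@degGL n b) (@difOmega R n theta b) (key true x).

Let fdet_homog : homog 0 (fdet theta b : F).
Proof.
exact: (subalg_dif_homog Gg fEP fEg tfh dtfh (free_dif_linear _ _)
  (@fdifM _ _ _ _) fdt01 fdt0t _).1.
Qed.
Let D_homog : homog 1 (D : F).
Proof.
exact: (subalg_dif_homog Gg fEP fEg tfh dtfh (free_dif_linear _ _)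
  (@fdifM _ _ _ _) fdt01 fdt0t _).2.
Qed.
Let fd_fdet : fd (fdet theta b) = D.
Proof.
exact: (subalg_dif Gg fEP fEg tfh dtfh (free_dif_linear _ _)
  (@fdifM _ _ _ _) fdt01 fdt0t (free_dif_linear _ _) (@fdifM _ _ _ _) fd1 fdt_ fdd _).1.
Qed.
Let fd_D : fd D = 0.
Proof.
exact: (subalg_dif Gg fEP fEg tfh dtfh (free_dif_linear _ _)
  (@fdifM _ _ _ _) fdt01 fdt0t (free_dif_linear _ _) (@fdifM _ _ _ _) fd1 fdt_ fdd _).2.
Qed.

Lemma relO_homog x : relO x -> exists p, homog p (x : F).
Proof.
case/relOE=> [[e [e' [a [c ->]]]]|->|[y ->]].
- by exists (e + e')%N.
- by exists 0%N; exact: (homogB (homog0M fdet_homog vh) (homog1 F)).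
exists (degGL y); apply: homogB.
  exact: (homogMl0 vh (gen_homog Fg y)).
exact: (homogM0r (gen_homog Fg y) vh).
Qed.

Local Notation gO e a := (genOmega theta (key e a) : OGL).
Local Notation V := (genOmega theta None : OGL).

Lemma genOmega_color : gcolor (mcolor L) (fun e a => gO e a).
Proof.
apply: (gcolorP mV) => [[i j] [k l]|[i j] [k l]|[i j] [k l]]; apply: pgen_rel.
- exact: RelOmega00.
- exact: RelOmega01.
by rewrite scaleNr opprK; apply: RelOmega11.
Qed.

Lemma genOmega_generated : generated (@degGL n b) (genOmega theta (b:=b)).
Proof. exact: pgen_generated. Qed.

Lemma genOmega_detV_central (q : OGL) : V * q = q * V.
Proof.
apply: (generated_central genOmega_generated) => x.
rewrite -[RHS]scale1r; apply: pgen_rel; rewrite scale1r; exact: RelOmegaCentral.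
Qed.

Let pP := pproj_hom (relO : set F).
Lemma pproj_fdet (rel : set F) (T := fun i j => pgen rel (key false (i, j))) :
  color_mx L T -> pproj rel (fdet theta b) = color_det L r T.
Proof.
move=> TT; rewrite -(det_theta_lift htheta TT).
apply: (alg_hom_ext Gg (f := fun y => pproj rel (fE y)) (f' := free_eval (fun x => T x.1 x.2))).
- exact: (alg_hom_comp fEP (pproj_hom rel)).
- exact: (free_eval_hom (fun _ : I * I => 0%N)).
move=> x; rewrite (free_eval_gen (fun _ : I * I => 0%N) (fun x => T x.1 x.2) x); congr pproj; exact: fEg.
Qed.

Lemma genOmega_det_detV : color_det L r (fun i j => gO false (i, j)) * V = 1.
Proof.
have TT : color_mx L (fun i j => gO false (i, j)).
  by move=> i j k l; have := genOmega_color false false (i, j) (k, l); rewrite expr0 mul1r.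
rewrite -[color_det _ _ _](pproj_fdet (rel := relO) TT).
apply: etrans (esym (ahM pP _ _)) _; apply: etrans _ (ah1 pP).
exact: (pproj_rel (RelOmegaDetV theta b)).
Qed.

Let phi : O0 -> OGL := plift (rel := relO0) (fun x => genOmega theta x).
Let phi_hom : alg_hom phi /\ (forall x, phi (pp0 x) = pp x).
Proof.
have fr x : relO0 x -> free_eval (fun x => genOmega theta x : OGL) x = 0.
  case=> [e [e' [a [c ->]]]]; apply: (free_eval_rel (@degGL n b)).
  exact: genOmega_color.
split; first exact: (plift_hom relO0_homog fr).
move=> x; rewrite [LHS](plift_pproj relO0_homog fr).
move: x; apply: (alg_hom_ext Fg); [exact: free_eval_hom|exact: pP|].
by move=> x; rewrite free_eval_gen.
Qed.

Let T0 i j : O0 := pgen (relO0 : set F) (key false (i, j)).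
Let T0h i j : homog 0 (T0 i j).
Proof. exact: (gen_homog (pgen_generated (relO0 : set F)) (key false (i, j))). Qed.
Let gdif_T0 i j : gdif (T0 i j) = pgen (relO0 : set F) (key true (i, j)).
Proof.
have [_ _ ed] := O0_gida; rewrite [LHS]ed; congr pproj.
exact: (fdt0t (i, j)).
Qed.
Let T0c : gcolor (mcolor L) (dmx (@gdif C O0) T0).
Proof.
have e e' a : dmx (@gdif C O0) T0 e' a = pgen (relO0 : set F) (key e' a).
  by case: e'; rewrite /dmx ?gdif_T0; case: a.
by move=> e1 e2 a c; rewrite !e; apply: O0_color.
Qed.
Let det0 : O0 := color_det L r T0.
Let d0P : is_dga (@gdif C O0). Proof. by apply: gida_dga; have [] := O0_gida. Qed.
Let pp0_fdet : pp0 (fdet theta b) = det0.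
Proof. exact: (pproj_fdet (dmx_color_mx T0c)). Qed.
Let bar_det0 : gbar det0 = det0.
Proof.
have [gP eb _] := O0_gida.
apply: (@wsign_bar_det C I L r Lii LV rI ru (@ibar n b) (@ibarK n b) (@Lam_bar R n theta b) Lc
  O0 T0 (@gbar C O0) (dmx_color_mx T0c) T0h).
- exact: gbar_antilinear gP.
- exact: gbar1.
- by move=> x y hx hy; rewrite (gbarM gP hx hy) expr0 scale1r.
move=> i j; rewrite [LHS]eb; congr pproj.
exact: (fbar_gen C (@degGL n b) (@barOmega n b) (key false (i, j))).
Qed.

Let ppD : pp D = phi (gdif det0).
Proof.
have [_ _ ed] := O0_gida; have [_ e] := phi_hom.
by rewrite -e -ed pp0_fdet.
Qed.
Let ppDD : pp D * pp D = 0 :> OGL.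
Proof.
have [h _] := phi_hom.
by rewrite ppD -(ahM h) (ddet_sq rI ru Ll Lr d0P T0h T0c) (lin0 (ah_linear h)).
Qed.
Let ppD_central (e : bool) a : pp D * gO e a = (-1) ^+ e *: (gO e a * pp D) :> OGL.
Proof.
have [h eh] := phi_hom.
have eT : phi (dmx (@gdif C O0) T0 e a) = gO e a.
  rewrite -[RHS](eh (fgen C (key e a))); congr phi.
  by case: (e); rewrite /dmx ?gdif_T0; case: (a).
rewrite ppD -eT; apply: (alg_hom_sign_comm h).
exact: (ddet_central rI ru Ll Lr d0P T0h T0c e a).
Qed.
Let pp_bar_fdet : pp (fb (fdet theta b)) = pp (fdet theta b).
Proof.
have [gP eb ed] := O0_gida; have [_ e] := phi_hom.
by rewrite -!e; congr phi; rewrite -[LHS]eb pp0_fdet bar_det0.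
Qed.
Let pp_bar_D : pp (fb D) = pp D.
Proof.
have [gP eb ed] := O0_gida; have [_ e] := phi_hom.
rewrite -!e; congr phi; rewrite -[LHS]eb -ed pp0_fdet.
by rewrite -[LHS](gdif_bar gP) bar_det0.
Qed.

Let vf : F := fdetV R n b.
Let dfh x : homog (degGL x).+1 (difOmega theta x : F).
Proof.
case: x => [x|]; first exact: (dth (Some x)).
apply: homogN; exact: (homogMl0 (homog0X 2 vh) D_homog).
Qed.
Let fbl := free_bar_semilin (C := C) (@degGL n b) (@barOmega n b).
Let fdl := free_dif_linear (@degGL n b) (@difOmega R n theta b).
Let fdM := fun p (x y : F) => @fdifM C X (@degGL n b) (@difOmega R n theta b) p x y.
Let fbM := fun p q (x y : F) => @fbarM C X (@degGL n b) (@barOmega n b) p q x y.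
Let fb1 : fb (1 : F) = 1 := @fbar1 C X (@degGL n b) (@barOmega n b).
Let fbv : fb vf = vf := fbar_gen C (@degGL n b) (@barOmega n b) None.
Let fdv : fd vf = - (vf ^+ 2 * D) := fdif_gen (@degGL n b) (@difOmega R n theta b) None.
Let pp_fdet_detV : pp (fdet theta b) * pp vf = 1 :> OGL.
Proof.
apply: etrans (esym (ahM pP _ _)) _; apply: etrans _ (ah1 pP).
exact: (pproj_rel (RelOmegaDetV theta b)).
Qed.

Lemma Omega_GL_gida_full :
  [/\ is_gida OGL, gbar V = V,
      forall e i j, gbar (gO e (i, j)) = gO e (ibar i, ibar j),
      forall a, gdif (gO false a) = gO true a &
      forall a, gdif (gO true a) = 0].
Proof.
have gd x := fdif_gen (@degGL n b) (@difOmega R n theta b) x.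
have gb x := fbar_gen C (@degGL n b) (@barOmega n b) x.
have z : pp 0 = 0 := lin0 (ah_linear pP).
have [] := @gida_presP C _ (@degGL n b) relO (@barOmega n b) (@difOmega R n theta b)
   relO_homog barO_deg barOK dfh.
- move=> x /relOE [[e [e' [a [c ->]]]]|->|[y ->]].
  + apply: (@color_rel_bar C (I * I)%type (mcolor L) bb (mcolor_conj Lc) mbar
      F fg _ _ pP fgh genOmega_color fb fbl fbM).
    by move=> k l; apply: (gb (key k l)).
  + exact: (@det_rel_bar C F _ _ pP _ fbl fbM fb1 vf (fdet theta b) vh fdet_homog fbv
      pp_fdet_detV genOmega_detV_central pp_bar_fdet).
  exact: (@central_rel_bar C F _ _ pP _ fbl fbM vf vh fbv genOmega_detV_central _ _ (gen_homog Fg y)).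
- move=> x /relOE [[e [e' [a [c ->]]]]|->|[y ->]].
  + apply: (@color_rel_dif C (I * I)%type (mcolor L)
      F fg _ _ pP fgh genOmega_color fd fdl fdM).
    * by case=> i j; apply: (gd (key false (i, j))).
    by case=> i j; apply: (gd (key true (i, j))).
  + exact: (@det_rel_dif C F _ _ pP _ fdl fdM fd1 vf (fdet theta b) D fdet_homog fd_fdet fdv
      pp_fdet_detV genOmega_detV_central).
  apply: (@central_rel_dif C F _ _ pP _ fdl fdM vf D vh fdv genOmega_detV_central _ _ (gen_homog Fg y)).
  case: y => [[[e i] j]|]; first exact: (ppD_central e (i, j)).
  rewrite expr0 scale1r; exact: (esym (genOmega_detV_central _)).
- case=> [[[[] i] j]|].
  + by apply: etrans _ z; congr pproj; exact: (lin0 fdl).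
  + by apply: etrans _ z; congr pproj; exact: (gd (key true (i, j))).
  apply: etrans (@dif2_detV C F _ _ pP _ fdl fdM vf D vh fd_D fdv genOmega_detV_central ppDD).
  by congr pproj; congr (fd _); apply: esym; exact: fdv.
- case=> [[[[] i] j]|].
  + congr pproj; exact: (esym (sl0 fbl)).
  + congr pproj; exact: (esym (gb (key true (i, j)))).
  apply: etrans _ (etrans (@dif_bar_detV C F _ _ pP _ _ fbl fbM vf D vh D_homog fdv fbv
    genOmega_detV_central pp_bar_D) _).
    congr pproj; exact: (esym fdv).
  congr pproj; congr (fb _); exact: fdv.
move=> gP gb' gd'; split; first exact: gP.
- rewrite [LHS]gb'; congr pproj; exact: fbv.
- by move=> e i j; rewrite [LHS]gb'; congr pproj; exact: (gb (key e (i, j))).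
- by move=> a; rewrite [LHS]gd'; congr pproj; exact: (gd (key false a)).
move=> a; rewrite [LHS]gd'; apply: etrans _ z; congr pproj; exact: (gd (key true a)).
Qed.

End OmegaGL.

(** * The relations of the quantum groups *)

Section Orthogonality.
Context (C : numClosedFieldType) (I : finType) (L : I -> I -> C).
Context (br : I -> I) (brK : involutive br).
Hypothesis Ls : forall i, L i (br i) = 1.
Context (q : I -> C).

(** Since xi^i and xi^(bar i) commute, the quadratic form depends only on this symmetrization of its
    coefficients. *)
Definition hsym (i : I) : C := q i + q (br i).

Lemma hsym_bar i : hsym (br i) = hsym i.
Proof. by rewrite /hsym brK addrC. Qed.

Definition delta_bar (B : pzAlg C) (f : I -> C) (j l : I) : B :=
  (if j == br l then f l else 0) *: (1 : B).

Definition orth (B : pzAlg C) (T : I -> I -> B) : Prop := forall j l,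
  \sum_i hsym i *: (T (br i) j * T i l) = delta_bar B hsym j l.

(** The coefficient of xi^j xi^l in delta0 Q - 1 ⊗ Q, before the relations between the monomials are
    taken into account. *)
Definition quad_defect (B : pzAlg C) (T : I -> I -> B) (j l : I) : B :=
  \sum_i q i *: (T (br i) j * T i l) - delta_bar B q j l.

(** Putting the factors of the second defect in the order of the first absorbs the weight L l j.
    Renaming i as bar i turns q(i) into q(bar i), and the two sums add up to [hsym]. *)
Lemma quad_defect_sym (B : pzAlg C) (T : I -> I -> B) j l : color_mx L T ->
  quad_defect T j l + L l j *: quad_defect T l j =
  \sum_i hsym i *: (T (br i) j * T i l) - delta_bar B hsym j l.
Proof.
move=> TT; rewrite /quad_defect scalerBr addrACA -opprD; congr (_ - _).
  have e : \sum_i hsym i *: (T (br i) j * T i l) =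
      \sum_i q i *: (T (br i) j * T i l) + \sum_i q (br i) *: (T (br i) j * T i l).
    by rewrite -big_split; apply: eq_bigr => i _; rewrite scalerDl.
  rewrite e; congr (_ + _); rewrite scaler_sumr [RHS](reindex_inj (inv_inj brK)) /=.
  apply: eq_bigr => i _; by rewrite brK (TT i j) !scalerA Ls mul1r mulrC.
rewrite /delta_bar /hsym scalerA -scalerDl; congr (_ *: _).
have -> : (l == br j) = (j == br l) by rewrite -(inj_eq (inv_inj brK)) brK eq_sym.
by case: eqP => [->|_]; rewrite ?mulr0 ?addr0 // Ls mul1r.
Qed.

Lemma orthP (B : pzAlg C) (T : I -> I -> B) : color_mx L T ->
  orth T <-> forall j l, quad_defect T j l + L l j *: quad_defect T l j = 0.
Proof.
move=> TT; split=> h j l.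
  by rewrite quad_defect_sym // h subrr.
by apply/eqP; rewrite -subr_eq0 -quad_defect_sym // h.
Qed.

(* The form f is color symmetric, so that only the color symmetrization of the *)
(* defect matters.                                                             *)
Lemma orth_form (B : pzAlg C) (T : I -> I -> B) (f : I -> I -> C) : color_mx L T ->
    orth T -> (forall j l, f l j = L l j * f j l) ->
  \sum_j \sum_l f j l *: quad_defect T j l = 0.
Proof.
move=> TT /(orthP TT) h fs; set s := LHS.
have : s + s = 0.
  rewrite {2}/s exchange_big /= -big_split big1 // => j _ /=.
  rewrite -big_split big1 // => l _ /=.
  by rewrite [f l j]fs mulrC -scalerA -scalerDr h scaler0.
by move/eqP; rewrite -mulr2n -scaler_nat scaler_eq0 pnatr_eq0 /= => /eqP.
Qed.

Lemma orth_id (B : pzAlg C) : orth (fun i j => (i == j)%:R : B).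
Proof.
move=> j l; rewrite (bigD1 l) //= eqxx mulr1 big1 ?addr0 => [|i /negbTE il].
  by rewrite /delta_bar eq_sym; case: eqP => _; rewrite ?scaler0 ?scale0r.
by rewrite il mulr0 scaler0.
Qed.

(** This is (TU)^t H (TU) = U^t (T^t H T) U, where entries of T and U commute as they lie in
    different tensor factors and have degree 0. *)
Lemma orth_mul (A B : gradedAlg C) (T : I -> I -> A) (U : I -> I -> B) :
    (forall i j, homog 0 (T i j)) -> (forall i j, homog 0 (U i j)) ->
    orth T -> orth U ->
  orth (fun i j => \sum_k tn (T i k) (U k j)).
Proof.
move=> Th Uh oT oU j l.
have e i : (\sum_k tn (T (br i) k) (U k j)) * (\sum_k tn (T i k) (U k l)) =
    \sum_k \sum_m tn (T (br i) k * T i m) (U k j * U m l).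
  rewrite mulr_suml; apply: eq_bigr => k _; rewrite mulr_sumr.
  by apply: eq_bigr => m _; rewrite tnM0l.
under eq_bigr => i _ do rewrite e scaler_sumr.
rewrite exchange_big /=.
have e2 k : \sum_i hsym i *: (\sum_m tn (T (br i) k * T i m) (U k j * U m l)) =
    hsym (br k) *: tn 1 (U k j * U (br k) l).
  under eq_bigr => i _ do rewrite scaler_sumr.
  rewrite exchange_big /= (bigD1 (br k)) //= [X in _ + X]big1 ?addr0.
    under eq_bigr => i _ do rewrite -tnZl.
    by rewrite -tn_suml oT /delta_bar brK eqxx tnZl.
  move=> m mk; under eq_bigr => i _ do rewrite -tnZl.
  rewrite -tn_suml oT /delta_bar ifF ?scale0r ?tn0l //.
  by apply: contraNF mk => /eqP ->; rewrite brK.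
rewrite (eq_bigr _ (fun k _ => e2 k)) (reindex_inj (inv_inj brK)) /=.
under eq_bigr => k _ do rewrite brK -tnZr.
by rewrite -tn_sumr oU /delta_bar tnZr tn1.
Qed.

Lemma orth_inverse (B : gradedAlg C) (T S : I -> I -> B) :
    (forall i j, \sum_k T i k * S k j = (i == j)%:R) -> orth T ->
  orth (fun i j => toop (S i j) : gop B).
Proof.
move=> TS oT j l.
(* The identity H S = T^t H, obtained by multiplying T^t H T = H by S on the right. *)
have hS a k : hsym a *: S (br a) k = hsym k *: T (br k) a.
  have : \sum_m (\sum_i hsym i *: (T (br i) a * T i m)) * S m k = hsym a *: S (br a) k.
    under eq_bigr => m _ do rewrite oT /delta_bar pzmulZl mul1r.
    rewrite (bigD1 (br a)) //= brK eqxx hsym_bar big1 ?addr0 // => m ma.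
    by rewrite ifF ?scale0r //; apply: contraNF ma => /eqP ->; rewrite brK.
  move <-; under eq_bigr => m _ do rewrite mulr_suml.
  rewrite exchange_big /= (bigD1 k) //= [X in _ + X]big1 ?addr0.
    under eq_bigr => m _ do rewrite pzmulZl -mulrA.
    by rewrite -scaler_sumr -mulr_sumr TS eqxx mulr1.
  move=> i ik; under eq_bigr => m _ do rewrite pzmulZl -mulrA.
  by rewrite -scaler_sumr -mulr_sumr TS (negbTE ik) mulr0 scaler0.
apply: (congr1 (@toop C B)
  (_ : \sum_i hsym i *: (S i l * S (br i) j) = delta_bar B hsym j l)).
rewrite -[l]brK; move: (br l) => {}l.
have -> : \sum_i hsym i *: (S i (br l) * S (br i) j) = hsym l *: \sum_i T l i * S i j.
  rewrite scaler_sumr [RHS](reindex_inj (inv_inj brK)); apply: eq_bigr => i _ /=.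
  have := hS (br i) (br l); rewrite !brK !hsym_bar => h.
  by rewrite -pzmulZl h pzmulZl.
rewrite TS /delta_bar brK hsym_bar eq_sym.
by case: eqP => _; rewrite ?scaler0 ?scale0r.
Qed.

End Orthogonality.

Lemma generated0_homog (C : comNzRingType) (A : gradedAlg C) (X : Type) (g : X -> A) :
  generated (fun=> 0%N) g -> forall y : A, homog 0 y.
Proof.
move=> Ag; apply: (gen_ind Ag) => [|a x y hx hy|x p y _ hy]; first exact: homog1.
  by apply: homogD => //; apply: homogZ.
exact: homog0M (gen_homog Ag x) hy.
Qed.

Section DifDet.
Context (C : numClosedFieldType) (I : finType) (L : I -> I -> C) (r : seq I).
Context (A B : gradedAlg C) (d : A -> A) (dP : is_dga d) (d' : B -> B) (dP' : is_dga d').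
Context (T : I -> I -> A) (Th : forall i j, homog 0 (T i j)).
Context (f : A -> B) (fP : alg_hom f).
Hypothesis fTh : forall i j, homog 0 (f (T i j)).
Hypothesis fd : forall i j, f (d (T i j)) = d' (f (T i j)).

Lemma hom_dif_det : f (d (color_det L r T)) = d' (f (color_det L r T)).
Proof.
rewrite /color_det; move: (wsign L r); elim: (r) => [|i v IH] c /=.
  rewrite (linZ (dga_linear dP)) (dga1 dP) scaler0 (lin0 (ah_linear fP)).
  by rewrite (linZ (ah_linear fP)) (ah1 fP) (linZ (dga_linear dP')) (dga1 dP') scaler0.
rewrite (lin_sum (dga_linear dP)) !(lin_sum (ah_linear fP)) (lin_sum (dga_linear dP')).
apply: eq_bigr => k _; rewrite (dgaM dP _ (Th i k)) (ahM fP) (dgaM dP' _ (fTh i k)).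
rewrite (linD (ah_linear fP)) (linZ (ah_linear fP)) !(ahM fP) fd.
by rewrite (IH (fun w => c (k :: w))).
Qed.

Context (V : A).
Hypothesis Tc : gcolor (mcolor L) (dmx d T).
Hypothesis detV : color_det L r T * V = 1.
Hypothesis VT : forall e a, V * dmx d T e a = dmx d T e a * V.

Lemma hom_dif_detV : f (d V) = d' (f V).
Proof.
have eD e a : f (dmx d T e a) = dmx d' (fun i j => f (T i j)) e a.
  by case: e; rewrite /dmx.
have Tc' : gcolor (mcolor L) (dmx d' (fun i j => f (T i j))).
  move=> e e' a c; rewrite -!eD -!(ahM fP) Tc; exact: linZ (ah_linear fP) _ _.
have detV' : color_det L r (fun i j => f (T i j)) * f V = 1.
  by rewrite -(color_det_hom _ _ _ fP) -(ahM fP) detV (ah1 fP).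
have VT' e a : f V * dmx d' (fun i j => f (T i j)) e a = dmx d' (fun i j => f (T i j)) e a * f V.
  by rewrite -!eD -!(ahM fP) VT.
rewrite (dif_detV dP Th detV VT) (dif_detV dP' fTh detV' VT').
rewrite (linN (ah_linear fP)) !expr2 !(ahM fP) hom_dif_det.
by rewrite (color_det_hom _ _ _ fP).
Qed.

End DifDet.

Lemma form_bilin (C : comNzRingType) (A M : pzAlg C) (f : M -> C) : scalar f ->
  bilin (fun (c : A) (w : M) => f w *: c).
Proof.
move=> fl; split=> [x a y z|c a y z]; first by rewrite scalerDr !scalerA mulrC.
by rewrite fl scalerDl scalerA.
Qed.

Lemma color_mx_hom (C : comNzRingType) (I : finType) (L : I -> I -> C) (A B : pzAlg C)
    (g : A -> B) (T : I -> I -> A) : alg_hom g -> color_mx L T ->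
  color_mx L (fun i j => g (T i j)).
Proof. by move=> gP TT i j k l; rewrite -!(ahM gP) TT (linZ (ah_linear gP)). Qed.

Lemma quad_defect_hom (C : numClosedFieldType) (I : finType) (br : I -> I) (q : I -> C)
    (A B : pzAlg C) (g : A -> B) (T : I -> I -> A) j l : alg_hom g ->
  g (quad_defect br q T j l) = quad_defect br q (fun i j => g (T i j)) j l.
Proof.
move=> gP; rewrite /quad_defect (linB (ah_linear gP)) (linZ (ah_linear gP)) (ah1 gP).
rewrite (lin_sum (ah_linear gP)); congr (_ - _); apply: eq_bigr => i _.
by rewrite (linZ (ah_linear gP)) (ahM gP).
Qed.

Lemma hom_form_sum (C : numClosedFieldType) (I : finType) (A B : pzAlg C) (g : A -> B)
    (f : I -> I -> C) (F : I -> I -> A) : alg_hom g ->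
  g (\sum_j \sum_l f j l *: F j l) = \sum_j \sum_l f j l *: g (F j l).
Proof.
move=> gP; have gl := ah_linear gP; rewrite (lin_sum gl); apply: eq_bigr => j _.
by rewrite (lin_sum gl); apply: eq_bigr => l _; rewrite (linZ gl).
Qed.

Lemma scalar_formZ (C : comNzRingType) (M : lmodType C) (f : M -> C) : scalar f ->
  forall a x, f (a *: x) = a * f x.
Proof.
move=> fl a x; have f0 : f 0 = 0 by have := fl (-1) 0 0; rewrite scaler0 addr0 mulN1r addNr.
by rewrite -[_ *: _]addr0 fl f0 addr0.
Qed.

Lemma sum_delta2 (C : comNzRingType) (I : finType) (B : lmodType C) (F : I -> I -> B) i j :
  \sum_k \sum_l ((k == i) && (l == j))%:R *: F k l = F i j.
Proof.
rewrite (bigD1 i) //= (bigD1 j) //= !eqxx scale1r !big1 ?addr0 //.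
  by move=> k /negbTE kk; apply: big1 => l _; rewrite kk scale0r.
by move=> l /negbTE ll; rewrite ll scale0r.
Qed.

Section QuadraticCoaction.
Context (C : numClosedFieldType) (I : finType) (A M : gradedAlg C).
Context (br : I -> I) (q : I -> C) (T : I -> I -> A) (Th : forall i j, homog 0 (T i j)).
Context (x : I -> M) (D : M -> gtens A M) (DP : alg_hom D).
Hypothesis Dx : forall i, D (x i) = \sum_j tn (T i j) (x j).
Let Q := \sum_i q i *: (x (br i) * x i).

Lemma coaction_quad (f : M -> C) : scalar f ->
  tens_lift idfun (fun c w => f w *: c) (D Q - tn (1 : A) Q) =
  \sum_j \sum_l f (x j * x l) *: quad_defect br q T j l.
Proof.
move=> fl.
have fD y z : f (y + z) = f y + f z by have := fl 1 y z; rewrite scale1r mul1r.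
have f0 : f 0 = 0 by apply: (addrI (f 0)); rewrite -fD !addr0.
have fZ a y : f (a *: y) = a * f y by rewrite -[a *: y]addr0 fl f0 addr0.
have fb := form_bilin A fl; have ll := gtl_linear fb.
have dQ : D Q = \sum_i q i *: \sum_j \sum_l tn (T (br i) j * T i l) (x j * x l).
  rewrite (lin_sum (ah_linear DP)); apply: eq_bigr => i _.
  rewrite (linZ (ah_linear DP)) (ahM DP) !Dx; congr (_ *: _).
  rewrite mulr_suml; apply: eq_bigr => j _; rewrite mulr_sumr.
  by apply: eq_bigr => l _; rewrite tnM0r.
rewrite (linB ll) dQ (lin_sum ll).
have e1 i : tens_lift idfun (fun c w => f w *: c) (q i *:
    \sum_j \sum_l tn (T (br i) j * T i l) (x j * x l)) =
    \sum_j \sum_l f (x j * x l) *: (q i *: (T (br i) j * T i l)).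
  rewrite (linZ ll) (lin_sum ll) scaler_sumr; apply: eq_bigr => j _.
  rewrite (lin_sum ll) scaler_sumr; apply: eq_bigr => l _.
  by rewrite (gtlE fb) !scalerA mulrC.
rewrite (eq_bigr _ (fun i _ => e1 i)) exchange_big /=.
have -> : tens_lift idfun (fun c w => f w *: c) (tn (1 : A) Q) =
    \sum_j \sum_l f (x j * x l) *: delta_bar br A q j l.
  rewrite (gtlE fb) exchange_big /=.
  have fs : f Q = \sum_i q i * f (x (br i) * x i).
    by rewrite (big_morph f fD f0); apply: eq_bigr => i _; rewrite fZ.
  rewrite fs scaler_suml; apply: eq_bigr => l _.
  rewrite (bigD1 (br l)) //= big1 ?addr0 => [|j /negbTE jl].
    by rewrite /delta_bar eqxx scalerA mulrC.
  by rewrite /delta_bar jl scale0r scaler0.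
rewrite -sumrB; apply: eq_bigr => j _; rewrite exchange_big /= -sumrB.
by apply: eq_bigr => l _; rewrite -scaler_sumr -scalerBr.
Qed.

End QuadraticCoaction.

Definition gen_map (I B : Type) (x : bool -> I * I -> B) (v : B)
    (y : option (bool * I * I)) : B :=
  if y is Some (e, i, j) then x e (i, j) else v.

(** * The universal property of GL_theta and the relations of the groups as matrix conditions *)

Section UniversalGL.
Context (R : realType) (n : nat) (theta : 'M[R]_n) (htheta : theta^T = - theta).
Context (b : bool).
Local Notation C := (R[i]).
Local Notation I := (idx n b).
Local Notation L := (@Lam R n theta b).
Local Notation r := (ref_word n b).
Local Notation X := (option (bool * I * I)).
Local Notation F := (gfree C (@degGL n b)).
Local Notation fO := (free C X).
Local Notation relO := (@relOmega R n theta b).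
Local Notation OGL := (Omega_GL theta b).
Local Notation gO e i j := (genOmega theta (Some (e, i, j)) : OGL).
Local Notation V := (genOmega theta None : OGL).

Lemma Omega_GL_lift (B : pzAlg C) (x : bool -> I * I -> B) (v : B) :
    gcolor (mcolor L) x ->
    color_det L r (fun i j => x false (i, j)) * v = 1 ->
    (forall e a, v * x e a = x e a * v) ->
  exists f : OGL -> B, alg_hom f /\ forall y, f (genOmega theta y) = gen_map x v y.
Proof.
move=> xc xv vx; pose g := gen_map x v.
have gP : alg_hom (free_eval g : fO -> B) by apply: (free_eval_hom (@degGL n b)).
have gg y : free_eval g (fgen C y) = g y := free_eval_gen (@degGL n b) g y.
have TT : color_mx L (fun i j => x false (i, j)).
  by move=> i j k l; have := xc false false (i, j) (k, l); rewrite expr0 mul1r.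
have gdet : free_eval g (fdet theta b) = color_det L r (fun i j => x false (i, j)).
  rewrite -(det_theta_lift htheta TT).
  apply: (alg_hom_ext (free_generated C (fun _ : I * I => 0%N))
    (f := fun y => free_eval g (free_eval (fun x : I * I => ft R x.1 x.2) y))
    (f' := free_eval (fun y => x false (y.1, y.2)))).
  - exact: (alg_hom_comp (free_eval_hom (fun _ : I * I => 0%N) _) gP).
  - exact: (free_eval_hom (fun _ : I * I => 0%N)).
  move=> y; rewrite (free_eval_gen (fun _ : I * I => 0%N) (fun y => x false (y.1, y.2)) y).
  apply: etrans (gg (Some (false, y.1, y.2))); congr (free_eval g).
  exact: (free_eval_gen (fun _ : I * I => 0%N) (fun x : I * I => ft R x.1 x.2) y).
have gr z : relO z -> free_eval g z = 0.
  case/relOE=> [[e [e' [a [c ->]]]]|->|[y ->]].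
  - apply: (free_eval_rel (@degGL n b)).
    by case: a => i j; case: c => k l; apply: xc.
  - apply: etrans (linB (ah_linear gP) _ _) _; rewrite (ah1 gP).
    apply/eqP; rewrite subr_eq0; apply/eqP.
    by apply: etrans (ahM gP _ _) _; rewrite gdet (gg None).
  apply: etrans (linB (ah_linear gP) _ _) _; apply/eqP; rewrite subr_eq0; apply/eqP.
  apply: etrans (ahM gP _ _) _; apply: etrans _ (esym (ahM gP _ _)).
  rewrite (gg None) gg; case: y => [[[e i] j]|] //; exact: vx.
exists (plift (rel := relO) g); split; first exact: (plift_hom (@relO_homog R n theta b) gr).
exact: (plift_gen (@relO_homog R n theta b) gr).
Qed.

Local Notation relG := (@relGL R n theta b).
Local Notation CGL := (C_GL theta b).
Local Notation deg0 := (fun _ : option (I * I) => 0%N).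

Let relG_homog x : relG x -> exists p, homog p (x : gfree C deg0).
Proof. by exists 0%N; apply: (generated0_homog (free_generated C deg0)). Qed.

Lemma C_GL_homog (x : CGL) : homog 0 x.
Proof. exact: (generated0_homog (pgen_generated (relG : set (gfree C deg0)))). Qed.

Lemma tGL_color : color_mx L (@tGL R n theta b).
Proof. move=> i j k l; apply: pgen_rel; exact: RelGLt. Qed.

Lemma detGLE : detGL theta b = color_det L r (@tGL R n theta b).
Proof. exact: (det_theta_lift htheta tGL_color). Qed.

Lemma incl_GL_hom : [/\ alg_hom (@incl_GL R n theta b : CGL -> OGL),
  forall i j, incl_GL (tGL theta i j : CGL) = gO false i j &
  incl_GL (genGL theta None : CGL) = V].
Proof.
pose g (x : option (I * I)) := genOmega theta (omap (fun ij => (false, ij.1, ij.2)) x) : OGL.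
have gP : alg_hom (free_eval g : free C (option (I * I)) -> OGL).
  by apply: (free_eval_hom deg0).
have gg y : free_eval g (fgen C y) = g y := free_eval_gen deg0 g y.
have TT : color_mx L (fun i j => gO false i j).
  by move=> i j k l; have := genOmega_color htheta false false (i, j) (k, l); rewrite expr0 mul1r.
have gdet : free_eval g (fGLdet theta b) = color_det L r (fun i j => gO false i j).
  rewrite -(det_theta_lift htheta TT).
  apply: (alg_hom_ext (free_generated C (fun _ : I * I => 0%N))
    (f := fun y => free_eval g (free_eval (fun x : I * I => fGLt R x.1 x.2) y))
    (f' := free_eval (fun y => gO false y.1 y.2))).
  - exact: (alg_hom_comp (free_eval_hom (fun _ : I * I => 0%N) _) gP).
  - exact: (free_eval_hom (fun _ : I * I => 0%N)).
  move=> y; rewrite (free_eval_gen (fun _ : I * I => 0%N) (fun y => gO false y.1 y.2) y).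
  apply: etrans (gg (Some (y.1, y.2))); congr (free_eval g).
  exact: (free_eval_gen (fun _ : I * I => 0%N) (fun x : I * I => fGLt R x.1 x.2) y).
have gr z : relG z -> free_eval g z = 0.
  case=> [i j k l||i j].
  - apply: (@free_eval_rel C _ deg0 OGL g); exact: TT.
  - apply: etrans (linB (ah_linear gP) _ _) _; rewrite (ah1 gP).
    apply/eqP; rewrite subr_eq0; apply/eqP.
    apply: etrans (ahM gP _ _) _; rewrite gdet (gg None); exact: genOmega_det_detV.
  apply: etrans (linB (ah_linear gP) _ _) _; apply/eqP; rewrite subr_eq0; apply/eqP.
  apply: etrans (ahM gP _ _) _; apply: etrans _ (esym (ahM gP _ _)).
  rewrite (gg None); exact: genOmega_detV_central.
split; first exact: (plift_hom relG_homog gr).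
  move=> i j; exact: (plift_gen relG_homog gr (Some (i, j))).
exact: (plift_gen relG_homog gr None).
Qed.

End UniversalGL.

Section GroupRelations.
Context (R : realType) (n : nat) (theta : 'M[R]_n) (htheta : theta^T = - theta).
Context (b : bool).
Local Notation C := (R[i]).
Local Notation I := (idx n b).
Local Notation L := (@Lam R n theta b).
Local Notation r := (ref_word n b).
Local Notation CGL := (C_GL theta b).
Local Notation t := (@tGL R n theta b).
Local Notation br := (@ibar n b).

(** The groups impose combinations of three kinds of relations, so stability is examined for each
    kind instead of each group. *)
Definition has_Q (b : bool) (G : qgroup b) : bool :=
  match G with O_R _ | SO_R _ | U_C => true | _ => false end.
Definition has_det (b : bool) (G : qgroup b) : bool :=
  match G with SL_R _ | SO_R _ | GL1_C => true | _ => false end.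
Definition has_b (b : bool) (G : qgroup b) : bool :=
  match G with GL_C | GL1_C | U_C => true | _ => false end.

Lemma has_b_even (c : bool) (G : qgroup c) : has_b G -> c = false.
Proof. by case: G. Qed.

(* Q = sum_i Qcoef i xi^(bar i) xi^i. *)
Definition Qcoef (i : I) : C := if i is inl (inr _) then 0 else 1.

Definition block (B : pzAlg C) (T : I -> I -> B) : Prop :=
  forall mu nu, T (ix b mu) (ixb b nu) = 0 /\ T (ixb b mu) (ix b nu) = 0.

Definition group_rel (G : qgroup b) (B : pzAlg C) (T : I -> I -> B) : Prop :=
  [/\ has_Q G -> orth br Qcoef T, has_det G -> color_det L r T = 1 &
      has_b G -> block T].

Lemma Q_RE : Q_R theta b = \sum_i Qcoef i *: (xi theta (br i) * xi theta i).
Proof.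
rewrite /Q_R big_sumType /= big_sumType /=; congr (_ + _).
  rewrite [X in _ = _ + X]big1 ?addr0 => [|mu _]; last by rewrite scale0r.
  by apply: eq_bigr => mu _; rewrite scale1r.
by apply: eq_bigr => o _; rewrite scale1r expr2.
Qed.

Let th i j : homog 0 (t i j) := C_GL_homog (t i j).

Lemma delta0_Q (f : Omega_R theta b -> C) (fl : scalar f) :
  tens_lift idfun (fun c w => f w *: c)
    (delta0 t (\sum_i Qcoef i *: (xi theta (br i) * xi theta i)) -
     tn (1 : CGL) (\sum_i Qcoef i *: (xi theta (br i) * xi theta i))) =
  \sum_j \sum_l f (xi theta j * xi theta l) *: quad_defect br Qcoef t j l.
Proof.
exact: (@coaction_quad C I CGL (Omega_R theta b) br Qcoef t th (xi theta (b:=b))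
  (delta0 t) (delta0_hom htheta (@tGL_color R n theta b) th)
  (delta0_gen htheta (@tGL_color R n theta b) th false) f fl).
Qed.

Lemma rel_QP (x : CGL) : rel_Q x <-> exists2 f : Omega_R theta b -> C, scalar f &
  x = \sum_j \sum_l f (xi theta j * xi theta l) *: quad_defect br Qcoef t j l.
Proof.
rewrite /rel_Q Q_RE; split=> -[f fl ->]; exists f => //.
  exact: (delta0_Q fl).
exact: (esym (delta0_Q fl)).
Qed.

Lemma rel_groupE (G : qgroup b) (x : CGL) : rel_group G x <->
  [\/ has_Q G /\ rel_Q x, has_det G /\ rel_det x | has_b G /\ rel_b x].
Proof.
case: G x => [c|c|c|c|||] x; rewrite /rel_group /=; split.
- by [].
- by case=> -[].
- by move=> h; constructor 2.
- by case=> -[].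
- by move=> h; constructor 1.
- by case=> -[].
- by case=> h; [constructor 1|constructor 2].
- by case=> -[] // _ h; [left|right].
- by move=> h; constructor 3.
- by case=> -[].
- by case=> h; [constructor 3|constructor 2].
- by case=> -[] // _ h; [right|left].
- by case=> h; [constructor 1|constructor 3].
by case=> -[] // _ h; [left|right].
Qed.

(** For Q, the forms of [quad_form] extract exactly the symmetrized defects, whose vanishing is
    [orth]. Conversely every linear form on the quantum space has color symmetric values on
    quadratic monomials, so [orth_form] kills its relation. *)
Lemma rel_groupP (G : qgroup b) (B : pzAlg C) (g : CGL -> B) : alg_hom g ->
  (forall x, rel_group (theta := theta) G x -> g x = 0) <-> group_rel G (fun i j => g (t i j)).
Proof.
move=> gP; set T := fun i j => g (t i j).
have TT : color_mx L T.
  exact: (color_mx_hom gP (@tGL_color R n theta b)).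
have gd j l : g (quad_defect br Qcoef t j l) = quad_defect br Qcoef T j l.
  exact: (@quad_defect_hom C I br Qcoef _ _ g t j l gP).
have Qp : (forall x : CGL, rel_Q x -> g x = 0) <-> orth br Qcoef T.
  have eQ f : g (\sum_j \sum_l f j l *: quad_defect br Qcoef t j l) =
      \sum_j \sum_l f j l *: quad_defect br Qcoef T j l.
    apply: etrans (hom_form_sum f _ gP) _.
    by apply: eq_bigr => j _; apply: eq_bigr => l _; rewrite gd.
  split=> [h|oT x /rel_QP [f fl ->]].
    apply/(orthP (@ibarK n b) (Lam_self_bar htheta (b := b)) Qcoef TT) => i j.
    have [f fl fE] := quad_form htheta i j.
    have := h _ (proj2 (rel_QP _) (ex_intro2 _ _ f fl erefl)).
    rewrite (eQ (fun k l => f (xi theta k * xi theta l))) => <-.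
    have e k l : f (xi theta k * xi theta l) *: quad_defect br Qcoef T k l =
        ((k == i) && (l == j))%:R *: quad_defect br Qcoef T k l +
        ((k == j) && (l == i))%:R *: (L k l *: quad_defect br Qcoef T k l).
      by rewrite fE scalerDl [L k l * _]mulrC scalerA.
    under eq_bigr => k _ do under eq_bigr => l _ do rewrite e.
    by under eq_bigr => k _ do rewrite big_split /=; rewrite big_split /= !sum_delta2.
  rewrite (eQ (fun k l => f (xi theta k * xi theta l))).
  apply: (orth_form (@ibarK n b) (Lam_self_bar htheta (b := b)) TT oT) => j l.
  have := genR_color htheta false false l j; rewrite expr0 mul1r => ->.
  exact: scalar_formZ fl _ _.
have dp : (forall x : CGL, rel_det x -> g x = 0) <-> color_det L r T = 1.
  rewrite -(color_det_hom _ _ _ gP) -(detGLE htheta); split=> [h|h x ->].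
    by apply/eqP; rewrite -subr_eq0 -(ah1 gP) -(linB (ah_linear gP)) h.
  by rewrite (linB (ah_linear gP)) h (ah1 gP) subrr.
have bp : (forall x : CGL, rel_b x -> g x = 0) <-> block T.
  split=> [h mu nu|h x [mu [nu [->|->]]]].
  - by split; apply: h; exists mu, nu; [left|right].
  - by have [] := h mu nu.
  by have [] := h mu nu.
have rE := @rel_groupE G; split=> [h|[hQ hd hb] x /rE [] [c hx]].
- split=> c; [apply/Qp => x hx|apply/dp => x hx|apply/bp => x hx]; apply/h/rE.
  + by constructor 1.
  + by constructor 2.
  by constructor 3.
- exact: (proj2 Qp (hQ c) x hx).
- exact: (proj2 dp (hd c) x hx).
exact: (proj2 bp (hb c) x hx).
Qed.

End GroupRelations.

(** * The differential algebras of the quantum groups *)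

Section GidaQuot.
Context (C : numClosedFieldType) (A : gida_data C) (AP : is_gida A) (J : gideal A).
Hypothesis bJ : forall x : A, J x -> J (gbar x).
Hypothesis dJ : forall x : A, J x -> J (gdif x).
Local Notation pi := (qproj J : A -> gida_quot J).

Lemma gida_quotP : [/\ is_gida (gida_quot J),
    forall x : A, gbar (pi x) = pi (gbar x) & forall x : A, gdif (pi x) = pi (gdif x)].
Proof.
have J0 : J 0 := sub0 (sub_ax J).
case: A J AP bJ dJ J0 => A' bA dA J' [bl bK bh bM dl dh dM d2 db] bJ' dJ' J0.
split.
- apply: (@quot_gidaP C A' bA dA J' bl bh bM dl dh dM bJ' dJ') => x.
  + by have := bK x; rewrite /gbar => ->; rewrite subrr.
  + by have := d2 x; rewrite /gdif => ->.
  by have := db x; rewrite /gdif /gbar => ->; rewrite subrr.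
- exact: (@quot_barE C A' bA dA J' bl bJ').
exact: (@quot_difE C A' bA dA J' dl dJ').
Qed.

End GidaQuot.

Section ClosedIdeal.
Context (C : numClosedFieldType) (A : gida_data C) (AP : is_gida A).
Context (G : gradedAlg C) (Gh : forall y : G, homog 0 y) (incl : G -> A) (iP : alg_hom incl).
Hypothesis ih : forall y, homog 0 (incl y).
Context (rel : set G).
Let K : set G := [set a | (qproj (gideal_gen rel) a : gquot (gideal_gen rel)) = 0]%classic.
Let J := closed_gideal_gen (@gdif C A) [set incl a | a in K]%classic.

Let relh r : rel r -> exists p, homog p r.
Proof. by exists 0%N. Qed.

Lemma closed_ideal_rel r : rel r -> J (incl r).
Proof.
move=> hr; apply: closed_gideal_gen_sub; exists r => //.
by apply: (qproj_ker (J := gideal_gen rel)); apply: gideal_gen_sub.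
Qed.

Let Jh x : [set incl a | a in K]%classic x -> exists p, homog p x.
Proof. by case=> a _ <-; exists 0%N. Qed.

(** The kernel of a homomorphism commuting with the differentials is itself stable under d. *)
Lemma closed_ideal_ker (B : gradedAlg C) (f : A -> B) (d : B -> B) : alg_hom f ->
    is_dga d -> (forall x, f (gdif x) = d (f x)) ->
    (forall r, rel r -> f (incl r) = 0) ->
  forall x, J x -> f x = 0.
Proof.
move=> fP dP fd fr; have fl := ah_linear fP.
apply: (closed_gideal_gen_min (Z := fun x => f x = 0)) => //.
- split; first exact: lin0.
  by move=> a x y hx hy /=; rewrite fl hx hy scaler0 addr0.
- by move=> p q x y _ _ Zx; rewrite !(ahM fP) Zx mul0r mulr0.
- exact: gdif_linear AP.
- by move=> p x; apply: gdif_homog AP p x.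
- by move=> p x _ Zx; rewrite fd Zx (lin0 (dga_linear dP)).
move=> x [a ha <-]; move: (ker_qproj ha).
exact: (gideal_gen_hom relh (alg_hom_comp iP fP) fr).
Qed.

Lemma closed_ideal_dif x : J x -> J (gdif x).
Proof. exact: closed_gideal_gen_dif. Qed.

Lemma closed_ideal_bar : (forall r, rel r -> J (gbar (incl r))) ->
  forall x, J x -> J (gbar x).
Proof.
move=> br; have bl : semilin Num.conj (@gbar C A) := gbar_antilinear AP.
apply: (closed_gideal_gen_min (Z := fun x => J (gbar x))) => //.
- split; first by rewrite /= (sl0 bl); apply: sub0 (sub_ax J).
  by move=> a x y hx hy /=; rewrite bl; apply: (subP (sub_ax J)).
- move=> p q x y hx hy Zx; rewrite (gbarM AP hx hy) (gbarM AP hy hx).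
  by split; apply: subZ; [apply: idealM_l|apply: idealM_r].
- exact: gdif_linear AP.
- by move=> p x; apply: gdif_homog AP p x.
- by move=> p x _ Zx; rewrite -(gdif_bar AP); apply: closed_ideal_dif.
move=> x [a ha <-]; move: (ker_qproj ha).
apply: (gideal_gen_min (Z := fun a => J (gbar (incl a)))) => //.
- split; first by rewrite /= (lin0 (ah_linear iP)) (sl0 bl); apply: sub0 (sub_ax J).
  move=> c y z hy hz /=; rewrite (ah_linear iP) bl; apply: (subP (sub_ax J)) => //.
move=> p q y z _ _ Zy; rewrite !(ahM iP) !(gbarM AP (ih _) (ih _)).
by split; apply: subZ; [apply: idealM_l|apply: idealM_r].
Qed.

End ClosedIdeal.

Lemma color_det_subr1_hom (C : numClosedFieldType) (I : finType) (L : I -> I -> C)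
    (r : seq I) (A B : pzAlg C) (h : A -> B) (T : I -> I -> A) : alg_hom h ->
  h (color_det L r T - 1) = color_det L r (fun i j => h (T i j)) - 1.
Proof. by move=> hP; rewrite (linB (ah_linear hP)) (ah1 hP) (color_det_hom _ _ _ hP). Qed.

Lemma gcolor_hom (C : comNzRingType) (K : Type) (c : K -> K -> C) (A B : pzAlg C)
    (h : A -> B) (x : bool -> K -> A) : alg_hom h -> gcolor c x ->
  gcolor c (fun e k => h (x e k)).
Proof. by move=> hP xc e e' k l; rewrite -!(ahM hP) xc (linZ (ah_linear hP)). Qed.

Section GroupRelBar.
Context (C : numClosedFieldType) (I : finType) (L : I -> I -> C).
Hypothesis Lc : forall i j, (L i j)^* = L j i.
Context (br : I -> I) (brK : involutive br).
Hypothesis Lb : forall i j, L (br i) (br j) = L i j.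
Hypothesis Ls : forall i, L i (br i) = 1.
Context (q : I -> C) (qc : forall i, (q i)^* = q i).
Context (A : gida_data C) (AP : is_gida A) (T : I -> I -> A).
Hypothesis Th : forall i j, homog 0 (T i j).
Hypothesis bT : forall i j, gbar (T i j) = T (br i) (br j).
Let bl : semilin Num.conj (@gbar C A) := gbar_antilinear AP.

Lemma quad_defect_bar j l : gbar (quad_defect br q T j l) = quad_defect br q T (br l) (br j).
Proof.
rewrite /quad_defect (slB bl) (sl_sum bl) /delta_bar (slZ bl) (gbar1 AP); congr (_ - _).
  apply: eq_bigr => i _; rewrite (slZ bl) /= qc (gbarM AP (Th _ _) (Th _ _)) !bT.
  by rewrite muln0 expr0 scale1r brK.
congr (_ *: _); rewrite (inj_eq (inv_inj brK)).
have -> : (l == br j) = (j == br l) by rewrite -(inj_eq (inv_inj brK)) brK eq_sym.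
by case: eqP => [->|_]; rewrite ?brK /= ?qc ?rmorph0.
Qed.

(** By [quad_defect_bar], bar permutes the defects, sending (j, l) to (bar l, bar j). The conjugated
    coefficients are again color symmetric, so [orth_form] applies to them. *)
Lemma quad_form_bar (Q : pzAlg C) (pi : A -> Q) (f : I -> I -> C) : alg_hom pi ->
    color_mx L T -> orth br q (fun i j => pi (T i j)) ->
    (forall j l, f l j = L l j * f j l) ->
  pi (gbar (\sum_j \sum_l f j l *: quad_defect br q T j l)) = 0.
Proof.
move=> piP TT oT fs; rewrite (sl_sum bl).
under eq_bigr => j _ do rewrite (sl_sum bl).
rewrite (eq_bigr (fun j => \sum_l (f j l)^* *: quad_defect br q T (br l) (br j))); last first.
  by move=> j _; apply: eq_bigr => l _; rewrite (slZ bl) quad_defect_bar.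
rewrite (hom_form_sum _ _ piP) exchange_big /= (reindex_inj (inv_inj brK)) /=.
under eq_bigr => l _.
  rewrite (reindex_inj (inv_inj brK)) /=; under eq_bigr => j _.
    rewrite !brK (quad_defect_hom _ _ _ _ _ piP); over.
  over.
apply: (orth_form brK Ls (color_mx_hom piP TT) oT) => j l.
by rewrite fs rmorphM /= Lc Lb.
Qed.

End GroupRelBar.

Section OmegaG.
Context (R : realType) (n : nat) (theta : 'M[R]_n) (htheta : theta^T = - theta).
Context (b : bool) (G : qgroup b).
Local Notation C := (R[i]).
Local Notation I := (idx n b).
Local Notation L := (@Lam R n theta b).
Local Notation r := (ref_word n b).
Local Notation X := (option (bool * I * I)).
Local Notation OGL := (Omega_GL theta b).
Local Notation CGL := (C_GL theta b).
Local Notation OG := (Omega_alg theta G).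
Local Notation J := (Omega_ideal theta G).
Local Notation gO e i j := (genOmega theta (Some (e, i, j)) : OGL).
Local Notation V := (genOmega theta None : OGL).
Local Notation br := (@ibar n b).
Local Notation incl := (@incl_GL R n theta b : CGL -> OGL).

Let LV : forall i j : I, L i j * L j i = 1 := LamV htheta (b:=b).
Let Lii : forall i : I, L i i = 1 := Lam_diag htheta (b:=b).
Let Lc : forall i j : I, (L i j)^* = L j i := Lam_conj htheta (b:=b).
Let rI : forall i : I, i \in r := @ref_word_mem n b.
Let ru : uniq r := ref_word_uniq n b.
Let Lb := @Lam_bar R n theta b.
Let Ls : forall i : I, L i (ibar i) = 1 := Lam_self_bar htheta (b:=b).

Definition genG (y : X) : OG := qproj J (genOmega theta y).

Let iP : alg_hom incl. Proof. by have [] := incl_GL_hom htheta b. Qed.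
Let it i j : incl (tGL theta i j) = gO false i j. Proof. by have [] := incl_GL_hom htheta b. Qed.
Let gP : is_gida OGL. Proof. by have [] := Omega_GL_gida_full htheta b. Qed.
Let piP : alg_hom (qproj J : OGL -> OG) := qproj_hom J.
Let gen := genOmega_generated theta b.
Let gh (e : bool) i j : homog e (gO e i j) := gen_homog gen (Some (e, i, j)).

Let ih y : homog 0 (incl y).
Proof.
have gG := pgen_generated (@relGL R n theta b : set (gfree C (fun _ : option (I * I) => 0%N))).
apply: (alg_hom_homog gG iP) (C_GL_homog y) => -[[i j]|].
  rewrite [X in homog _ X](it i j); exact: (gh false).
have [_ _ iV] := incl_GL_hom htheta b.
rewrite [X in homog _ X]iV; exact: (gen_homog gen None).
Qed.

Let rel_J x : rel_group (theta := theta) G x -> (qproj J (incl x) : OG) = 0.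
Proof.
move=> hx; apply: (qproj_ker (J := J)).
exact (@closed_ideal_rel C OGL CGL incl (@rel_group R n theta b G) x hx).
Qed.

Lemma genG_rel : group_rel theta G (fun i j => genG (Some (false, i, j))).
Proof.
have e : (fun i j => genG (Some (false, i, j))) =
    (fun i j => (qproj J (incl (tGL theta i j)) : OG)).
  by apply/funext => i; apply/funext => j; rewrite it.
by rewrite e; apply: (proj1 (rel_groupP htheta G (alg_hom_comp iP piP))); apply: rel_J.
Qed.

Let gOc := genOmega_color htheta (b:=b).
Let T0 i j : OGL := gO false i j.
Let TT0 : color_mx L T0.
Proof. by move=> i j k l; have := gOc false false (i, j) (k, l); rewrite expr0 mul1r. Qed.
Let bT0 i j : gbar (T0 i j) = T0 (br i) (br j).
Proof. by have [_ _ h _ _] := Omega_GL_gida_full htheta b; apply: h. Qed.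
Let bV : gbar V = V.
Proof. by have [_ h _ _ _] := Omega_GL_gida_full htheta b; apply: h. Qed.
Let bdet : gbar (color_det L r T0) = color_det L r T0.
Proof.
apply: (@wsign_bar_det C I L r Lii LV rI ru br (@ibarK n b) Lb Lc OGL T0 (@gbar C OGL) TT0 (gh false)).
- exact: gbar_antilinear gP.
- exact: gbar1.
- by move=> x y hx hy; rewrite (gbarM gP hx hy) expr0 scale1r.
exact: bT0.
Qed.

Let Qcoef_conj (i : I) : (Qcoef R i)^* = Qcoef R i.
Proof. by case: i => [[mu|mu]|o]; rewrite /= ?rmorph1 ?rmorph0. Qed.

Let bar_J x : rel_group (theta := theta) G x -> J (gbar (incl x)).
Proof.
have [hQ hd hb] := genG_rel.
move=> /rel_groupE [] [c hx]; apply: (ker_qproj (J := J)).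
- have [f fl ->] := proj1 (rel_QP htheta x) hx.
  pose F j l := f (xi theta j * xi theta l).
  have e : incl (\sum_j \sum_l F j l *: quad_defect br (@Qcoef R n b) (@tGL R n theta b) j l) =
      \sum_j \sum_l F j l *: quad_defect br (@Qcoef R n b) T0 j l.
    apply: etrans (hom_form_sum F _ iP) _.
    apply: eq_bigr => j _; apply: eq_bigr => l _; congr (_ *: _).
    apply: etrans (quad_defect_hom _ _ _ _ _ iP) _.
    by rewrite [X in quad_defect _ _ X](_ : _ = T0) //; apply/funext => i; apply/funext => k; exact: it.
  apply: etrans (congr1 (fun z => qproj J (gbar z)) e) _.
  apply: (@quad_form_bar C I L Lc br (@ibarK n b) Lb Ls (@Qcoef R n b) Qcoef_conj OGL gP T0 (gh false) bT0
    OG (qproj J) F piP TT0 (hQ c)).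
  move=> j l; rewrite /F; have := genR_color htheta false false l j; rewrite expr0 mul1r => ->.
  exact (scalar_formZ fl (L l j) (xi theta j * xi theta l)).
- rewrite hx; have e : incl (detGL theta b - 1) = color_det L r T0 - 1.
    rewrite (detGLE htheta); apply: etrans (color_det_subr1_hom _ _ _ iP) _.
    by congr (_ - _); apply: eq_color_det.
  apply: etrans (congr1 (fun z => qproj J (gbar z)) e) _.
  rewrite (slB (gbar_antilinear gP)) bdet (gbar1 gP) (linB (ah_linear piP)) (ah1 piP).
  by rewrite (color_det_hom _ _ _ piP) (hd c) subrr.
by have [mu [nu [->|->]]] := hx; rewrite it bT0; have [] := hb c mu nu.
Qed.

Lemma Omega_G_gida_full : [/\ is_gida OG,
    forall x : OGL, gbar (qproj J x : OG) = qproj J (gbar x) &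
    forall x : OGL, gdif (qproj J x : OG) = qproj J (gdif x)].
Proof.
apply: (gida_quotP gP).
  exact (@closed_ideal_bar C OGL gP CGL (@C_GL_homog R n theta b) incl iP ih
    (@rel_group R n theta b G) bar_J).
exact (@closed_ideal_dif C OGL CGL incl (@rel_group R n theta b G)).
Qed.

Local Notation tg e a := (genG (Some (e, a.1, a.2))).
Local Notation dT := (dmx (@gdif C OG) (tG theta G)).

Lemma genG_generated : generated (@degGL n b) genG.
Proof. exact: quot_generated gen. Qed.

Lemma genG_bar y : gbar (genG y) = genG (barOmega y).
Proof.
have [_ h _] := Omega_G_gida_full; rewrite [LHS]h; congr qproj.
by case: y => [[[e i] j]|]; [have [_ _ h' _ _] := Omega_GL_gida_full htheta b; apply: h'|].
Qed.

Lemma genG_dif0 a : gdif (tg false a) = tg true a.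
Proof.
have [_ _ h] := Omega_G_gida_full; rewrite [LHS]h; congr qproj.
by have [_ _ _ h' _] := Omega_GL_gida_full htheta b; apply: h'.
Qed.

Lemma genG_dmx e a : dT e a = tg e a.
Proof. by case: e => //; apply: genG_dif0. Qed.

Lemma genG_color : gcolor (mcolor L) dT.
Proof.
have h : gcolor (mcolor L) (fun e a => (qproj J (gO e a.1 a.2) : OG)) by apply: gcolor_hom.
by move=> e e' a c; rewrite !genG_dmx; apply: h.
Qed.

Lemma genG_det : color_det L r (tG theta G) * detVG theta G = 1.
Proof.
apply: etrans _ (ah1 piP); rewrite -(genOmega_det_detV htheta b).
apply: etrans _ (esym (ahM piP _ _)); congr (_ * _); exact: esym (color_det_hom _ _ _ piP).
Qed.

Lemma genG_detV_central (q : OG) : detVG theta G * q = q * detVG theta G.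
Proof.
have [x ->] := qproj_surj q; apply: etrans (esym (ahM piP _ _)) _.
apply: etrans (congr1 _ (genOmega_detV_central x)) _; exact: ahM piP _ _.
Qed.

(** The map given on [Omega_GL] by its presentation commutes with d on T by construction and on
    det^-1 by [hom_dif_detV]; it then factors through the closed ideal by [closed_ideal_ker]. *)
Lemma Omega_G_lift (B : gradedAlg C) (d : B -> B) (T : I -> I -> B) (v : B) :
    is_dga d -> (forall i j, homog 0 (T i j)) -> homog 0 v -> gcolor (mcolor L) (dmx d T) ->
    color_det L r T * v = 1 -> (forall e a, v * dmx d T e a = dmx d T e a * v) ->
    group_rel theta G T ->
  exists f : OG -> B, [/\ alg_hom f, forall i j, f (tG theta G i j) = T i j,
    f (detVG theta G) = v, forall p x, homog p x -> homog p (f x) &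
    forall x, f (gdif x) = d (f x)].
Proof.
move=> dP Th vh Tc Tv vT TG.
have [f [fP fg]] := Omega_GL_lift htheta Tc Tv vT.
have fh p x : homog p x -> homog p (f x).
  apply: (alg_hom_homog gen fP) => -[[[e i] j]|]; rewrite fg //=.
  exact: (dmx_homog dP Th).
have [_ _ _ gd gd'] := Omega_GL_gida_full htheta b.
have fd x : f (gdif x) = d (f x).
  apply: (alg_hom_dif gen (gida_dga gP) dP fP) => [y|]; first by apply: fh (gen_homog gen y).
  have e0 i j : f (gO false i j) = T i j by rewrite fg.
  have e1 i j : f (gdif (gO false i j)) = d (T i j) by rewrite (gd (i, j)) fg.
  have gO_dmx e a : dmx (@gdif C OGL) T0 e a = gO e a.1 a.2.
    by case: e => //; apply: gd.
  case=> [[[[] i] j]|].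
  - by rewrite (gd' (i, j)) fg (dga2 dP) (lin0 (ah_linear fP)).
  - by rewrite e1 e0.
  apply: (@hom_dif_detV C I L r OGL B (@gdif C OGL) (gida_dga gP) d dP T0 (gh false) f fP).
  - by move=> i j; rewrite e0.
  - by move=> i j; rewrite e1 e0.
  - by move=> e e' a c; rewrite !gO_dmx; apply: gOc.
  - exact: genOmega_det_detV.
  by move=> e a; apply: genOmega_detV_central.
have fJ : forall x, J x -> f x = 0.
  apply: (@closed_ideal_ker C OGL gP CGL (@C_GL_homog R n theta b) incl iP ih
    (@rel_group R n theta b G) B f d fP dP fd).
  apply/(rel_groupP htheta G (alg_hom_comp iP fP)).
  rewrite (_ : (fun i j => (f \o incl) (tGL theta i j)) = T) //.
  by apply/funext => i; apply/funext => j; rewrite /= it fg.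
have [f'E f'P] := quot_lift fP fJ.
exists (fun y => f (qrepr y)); split=> //.
- by move=> i j; rewrite f'E fg.
- by rewrite f'E fg.
- by move=> p y hy; have [x hx ->] := qproj_homog_surj hy; rewrite f'E; apply: fh.
move=> y; have [x ->] := qproj_surj y; have [_ _ h] := Omega_G_gida_full.
by rewrite [X in f (qrepr X)]h !f'E fd.
Qed.

End OmegaG.

(** * Hopf algebras generated by a matrix *)

(* The image of x e (i, s) under the coaction x_i |-> sum_j t_ij ⊗ x_j and its *)
(* differential.                                                              *)
Section MatrixCoaction.
Context (C : comNzRingType) (I : finType) (S : Type).
Context (A B : gradedAlg C) (t : bool -> I * I -> A) (x : bool -> I * S -> B).

Definition mtens (e f : bool) (i : I) (s : S) : gtens A B :=
  \sum_j tn (t e (i, j)) (x f (j, s)).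

Definition mcoact (e : bool) (a : I * S) : gtens A B :=
  if e then mtens true false a.1 a.2 + mtens false true a.1 a.2
  else mtens false false a.1 a.2.

Lemma mcoact_homog : (forall (e : bool) k, homog e (t e k)) ->
  (forall (e : bool) k, homog e (x e k)) -> forall (e : bool) a, homog e (mcoact e a).
Proof. by move=> th xh e a; apply: homog_gcolor_tensor. Qed.

Lemma mcoact_counit (eps : A -> C) : scalar eps -> (forall i j, eps (t false (i, j)) = (i == j)%:R) ->
    (forall a, eps (t true a) = 0) ->
  forall (e : bool) a, tens_lift idfun (fun (c : A) (w : B) => eps c *: w) (mcoact e a) = x e a.
Proof.
move=> el e0 e1 e [i s].
have fb : bilin (fun (c : A) (w : B) => eps c *: w) by apply: contract_l_bilin.
have l := gtl_linear fb.
have h0 f : tens_lift idfun (fun (c : A) (w : B) => eps c *: w) (mtens false f i s) = x f (i, s).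
  rewrite (lin_sum l) (bigD1 i) //= (gtlE fb) e0 eqxx scale1r big1 ?addr0 // => j ji.
  by rewrite (gtlE fb) e0 eq_sym (negbTE ji) scale0r.
have h1 f : tens_lift idfun (fun (c : A) (w : B) => eps c *: w) (mtens true f i s) = 0.
  by rewrite (lin_sum l) big1 // => j _; rewrite (gtlE fb) e1 scale0r.
by case: e; rewrite /mcoact ?(linD l) ?h0 ?h1 ?add0r.
Qed.

End MatrixCoaction.

Section MatrixCoassoc.
Context (C : comNzRingType) (I : finType) (S : Type).
Context (A B : gradedAlg C) (t : bool -> I * I -> A) (x : bool -> I * S -> B).
Context (D : A -> gtens A A) (DP : alg_hom D) (K : B -> gtens A B) (KP : alg_hom K).
Hypothesis Dh : forall p y, homog p y -> homog p (D y).
Hypothesis Kh : forall p y, homog p y -> homog p (K y).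
Hypothesis DE : forall e a, D (t e a) = mcoact t t e a.
Hypothesis KE : forall e a, K (x e a) = mcoact t x e a.

Let m3 (e f g : bool) i s : gtens A (gtens A B) :=
  \sum_k tn (t e (i, k)) (mtens t x f g k s).

Let assoc_l e f g i s :
  gassoc (\sum_j tn (mtens t t e f i j) (x g (j, s))) = m3 e f g i s.
Proof.
rewrite (lin_sum (@gassoc_linear _ _ _ _)).
under eq_bigr => j _ do rewrite tn_suml (lin_sum (@gassoc_linear _ _ _ _)).
rewrite exchange_big; apply: eq_bigr => k _; rewrite tn_sumr.
by apply: eq_bigr => j _; rewrite gassocE.
Qed.

(** In degree 1 both sides are the sum of the three ways of placing d on one factor of t ⊗ t ⊗ x. *)
Lemma mcoact_assoc e a :
  gassoc (tens_map D id (mcoact t x e a) : gtens (gtens A A) B) =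
  (tens_map id K (mcoact t x e a) : gtens A (gtens A B)).
Proof.
have lD := ah_linear (tens_map_hom DP (alg_hom_id B) Dh (fun _ _ h => h)).
have lK := ah_linear (tens_map_hom (alg_hom_id A) KP (fun _ _ h => h) Kh).
have al := @gassoc_linear C A A B.
case: a => i s.
have hD f g : (tens_map D id (mtens t x f g i s) : gtens (gtens A A) B) =
    \sum_j tn (mcoact t t f (i, j)) (x g (j, s)).
  rewrite (lin_sum lD); apply: eq_bigr => j _.
  by rewrite (tens_mapE DP (alg_hom_id B)) DE.
have hK f g : (tens_map id K (mtens t x f g i s) : gtens A (gtens A B)) =
    \sum_j tn (t f (i, j)) (mcoact t x g (j, s)).
  rewrite (lin_sum lK); apply: eq_bigr => j _.
  by rewrite (tens_mapE (alg_hom_id A) KP) KE.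
case: e; rewrite /mcoact /=; last first.
  by rewrite hD hK /mcoact /= assoc_l.
rewrite (linD lD) (linD lK) !hD !hK /mcoact /=.
under [in LHS]eq_bigr => j _ do rewrite tnDl.
under [X in _ = _ + X]eq_bigr => j _ do rewrite tnDr.
by rewrite !big_split /= !(linD al) !assoc_l addrA.
Qed.

End MatrixCoassoc.

Section MatrixCoactionGida.
Context (C : numClosedFieldType) (I : finType) (S : Type).
Context (A B : gida_data C) (AP : is_gida A) (BP : is_gida B).
Context (t : bool -> I * I -> A) (x : bool -> I * S -> B).
Hypothesis th : forall (e : bool) a, homog e (t e a).
Hypothesis dt : forall a, gdif (t false a) = t true a.
Hypothesis dx : forall a, gdif (x false a) = x true a.

Lemma mcoact_dif a :
  gdif (mcoact t x false a : gida_tens A B) = mcoact t x true a.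
Proof.
rewrite (lin_sum (tens_dif_linear AP BP)) /mcoact /mtens -big_split; apply: eq_bigr => j _ /=.
apply: etrans (tens_difE AP BP _ (th false _)) _; by rewrite expr0 scale1r dt dx.
Qed.

Context (br : I -> I) (brK : involutive br) (bs : S -> S).
Hypothesis bt : forall i j, gbar (t false (i, j)) = t false (br i, br j).
Hypothesis bx : forall i s, gbar (x false (i, s)) = x false (br i, bs s).

Lemma mcoact_bar0 i s :
  gbar (mcoact t x false (i, s) : gida_tens A B) = mcoact t x false (br i, bs s).
Proof.
rewrite (sl_sum (tens_bar_semilin AP BP)) [RHS](reindex_inj (inv_inj brK)) /=.
by apply: eq_bigr => j _; apply: etrans (tens_barE AP BP _ _) _; rewrite bt bx.
Qed.

Lemma mcoact_bar e i s :
  gbar (mcoact t x e (i, s) : gida_tens A B) = mcoact t x e (br i, bs s).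
Proof.
case: e; last exact: mcoact_bar0.
rewrite -!mcoact_dif -(gdif_bar (gida_tensP AP BP)); congr gdif; exact: mcoact_bar0.
Qed.

End MatrixCoactionGida.

Section Scalars.
Context (C : numClosedFieldType).

Definition scalar_alg : pzAlg C :=
  @PzAlg C C^o 1 *%R (@mulrA C) (@mul1r C) (@mulr1 C) (@mulrDl C) (@mulrDr C)
    (fun a x y => mulrA a x y) (fun a x y => mulrCA a x y).

Definition scalar_comp (p : nat) (x : scalar_alg) : scalar_alg :=
  if p == 0%N then x else 0.

Fact scalar_comp_linear p : linear (scalar_comp p).
Proof. by move=> a x y; rewrite /scalar_comp; case: eqP; rewrite ?scaler0 ?addr0. Qed.
Fact scalar_compK p q x :
  scalar_comp p (scalar_comp q x) = if p == q then scalar_comp q x else 0.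
Proof. by rewrite /scalar_comp; case: p => [|p]; case: q => [|q] //=; case: eqP. Qed.
Fact scalar_comp_sum x : exists N, x = \sum_(p < N) scalar_comp p x.
Proof. by exists 1%N; rewrite big_ord_recl big_ord0 addr0. Qed.
Fact scalar_comp1 : scalar_comp 0 1 = 1. Proof. by []. Qed.
Fact scalar_compM p q (x y : scalar_alg) :
  scalar_comp (p + q) (scalar_comp p x * scalar_comp q y) = scalar_comp p x * scalar_comp q y.
Proof.
by rewrite /scalar_comp; case: p => [|p]; case: q => [|q] //=; rewrite ?mul0r ?mulr0.
Qed.

Definition scalar_galg : gradedAlg C :=
  GradedAlg scalar_comp_linear scalar_compK scalar_comp_sum scalar_comp1 scalar_compM.

Lemma scalar_dga : is_dga (fun _ : scalar_galg => 0).
Proof.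
split=> // [a x y|p x y _]; first by rewrite scaler0 addr0.
by rewrite mul0r mulr0 scaler0 addr0.
Qed.

End Scalars.

Lemma tn_hom_l (C : comNzRingType) (A B : gradedAlg C) :
  alg_hom (fun a : A => tn a (1 : B)).
Proof.
split; first by move=> a x y; rewrite tnDl tnZl.
by split=> [|x y]; rewrite ?tn1 // tnM0l ?mulr1 //; apply: homog1.
Qed.

Lemma tn_hom_r (C : comNzRingType) (A B : gradedAlg C) :
  alg_hom (fun b : B => tn (1 : A) b).
Proof.
split; first by move=> a x y; rewrite tnDr tnZr.
by split=> [|x y]; rewrite ?tn1 // tnM0r ?mulr1 //; apply: homog1.
Qed.

(** The matrix is the product of T ⊗ 1 and 1 ⊗ U, whose entries commute because U has degree 0, so
    multiplicativity of the determinant applies. *)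
Lemma color_det_tens (C : numClosedFieldType) (I : finType) (L : I -> I -> C) (r : seq I)
    (A B : gradedAlg C) (T : I -> I -> A) (U : I -> I -> B) :
    (forall i, L i i = 1) -> (forall i j, L i j * L j i = 1) ->
    (forall i, i \in r) -> uniq r -> (forall i j, homog 0 (U i j)) -> color_mx L U ->
  color_det L r (fun i j => \sum_k tn (T i k) (U k j)) =
  tn (color_det L r T) (color_det L r U).
Proof.
move=> Lii LV rI ru Uh UU; have hl := tn_hom_l A B; have hr := tn_hom_r A B.
have e i j : \sum_k tn (T i k) (U k j) = \sum_k tn (T i k) 1 * tn 1 (U k j).
  by apply: eq_bigr => k _; rewrite tnM0l ?mulr1 ?mul1r //; apply: homog1.
rewrite (eq_color_det _ _ e) (color_det_mul Lii LV rI ru).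
- rewrite -(color_det_hom _ _ _ hl) -(color_det_hom _ _ _ hr).
  by rewrite tnM0l ?mulr1 ?mul1r //; apply: homog1.
- by move=> i j k l; rewrite !tnM0l ?mulr1 ?mul1r //; apply: homog1.
exact: color_mx_hom hr UU.
Qed.

(** Shows that twisting by (-1)^(p(p-1)/2) introduces precisely the sign (-1)^(pq) into products. *)
Lemma bin_sum2 p q : ('C(p + q, 2) = 'C(p, 2) + 'C(q, 2) + p * q)%N.
Proof.
elim: p => [|p IH]; first by rewrite add0n addn0.
by rewrite addSn !binS !bin1 IH mulSn; lia.
Qed.

(** * Coproduct, counit, antipode and coaction from the universal property *)

Section MatrixHopf.
Context (C : numClosedFieldType) (I : finType) (L : I -> I -> C) (r : seq I).
Hypothesis Lii : forall i, L i i = 1.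
Hypothesis LV : forall i j, L i j * L j i = 1.
Hypothesis Lc : forall i j, (L i j)^* = L j i.
Hypothesis rI : forall i, i \in r.
Hypothesis ru : uniq r.
Context (br : I -> I) (brK : involutive br).
Context (rel : forall B : pzAlg C, (I -> I -> B) -> Prop).
Hypothesis rel_id : forall B : pzAlg C, rel (fun i j => (i == j)%:R : B).
Hypothesis rel_mul : forall (A B : gradedAlg C) (T : I -> I -> A) (U : I -> I -> B),
  (forall i j, homog 0 (T i j)) -> (forall i j, homog 0 (U i j)) ->
  color_mx L U -> rel T -> rel U ->
  rel (fun i j => \sum_k tn (T i k) (U k j) : gtens A B).
Hypothesis rel_inv : forall (A : gradedAlg C) (T S : I -> I -> A),
  (forall i j, \sum_k T i k * S k j = (i == j)%:R) ->
  (forall i j, \sum_k S i k * T k j = (i == j)%:R) ->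
  color_mx L (fun i j => toop (S i j) : gop A) -> rel T ->
  rel (fun i j => toop (S i j) : gop A).

Context (A : gida_data C) (AP : is_gida A) (T : I -> I -> A) (V : A).
Local Notation t := (dmx (@gdif C A) T).
Local Notation deg := (gen_map (fun (e : bool) _ => nat_of_bool e) 0%N).
Local Notation det := (color_det L r T).
Hypothesis Ag : generated deg (gen_map t V).
Hypothesis Tc : gcolor (mcolor L) t.
Hypothesis detV : det * V = 1.
Hypothesis VC : forall x, V * x = x * V.
Hypothesis barT : forall i j, gbar (T i j) = T (br i) (br j).
Hypothesis barV : gbar V = V.
Hypothesis relT : rel T.
Hypothesis lift : forall (B : gradedAlg C) (d : B -> B) (U : I -> I -> B) (v : B),
  is_dga d -> (forall i j, homog 0 (U i j)) -> homog 0 v -> gcolor (mcolor L) (dmx d U) ->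
  color_det L r U * v = 1 -> (forall e a, v * dmx d U e a = dmx d U e a * v) -> rel U ->
  exists f : A -> B, [/\ alg_hom f, forall i j, f (T i j) = U i j,
    f V = v, forall p x, homog p x -> homog p (f x) & forall x, f (gdif x) = d (f x)].

Let dP := gida_dga AP.
Let TP := gida_tensP AP AP.
Let Th i j : homog 0 (T i j) := gen_homog Ag (Some (false, i, j)).
Let Vh : homog 0 V := gen_homog Ag None.
Let th (e : bool) a : homog e (t e a) := dmx_homog dP Th e a.
Let VT e a : V * t e a = t e a * V := VC _.
Let Vdet1 : V * det = 1 := Vdet detV VT.
Let TT : color_mx L T := dmx_color_mx Tc.
Let deth : homog 0 det := color_det_homog L r Th.
Let dt a : gdif (t false a) = t true a. Proof. by []. Qed.

Let T2 i j : gtens A A := mcoact t t false (i, j).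

Let T2_dmx e a : dmx (@gdif C (gida_tens A A)) T2 e a = mcoact t t e a.
Proof. by case: e a => -[i j] //; rewrite /dmx (mcoact_dif AP AP th dt dt). Qed.

Let T2_color : gcolor (mcolor L) (dmx (@gdif C (gida_tens A A)) T2).
Proof.
have h := gcolor_tensor (E := fun s s' => L s' s) LV th th Tc Tc.
by move=> e e' a c; rewrite !T2_dmx; apply: h.
Qed.

Let det2 : color_det L r T2 = tn det det := color_det_tens T Lii LV rI ru Th TT.

Let VV (x : gtens A A) : tn V V * x = x * tn V V.
Proof.
move: x; apply: gtens_ind => [|x y hx hy|a c]; first by rewrite mulr0 mul0r.
  by rewrite mulrDl mulrDr hx hy.
by rewrite (tnM0l _ _ _ Vh) (tnM0r _ _ _ Vh) !VC.
Qed.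

Lemma exists_comul : exists D : A -> gtens A A, [/\ is_gida_hom (D : A -> gida_tens A A),
  forall e a, D (t e a) = mcoact t t e a & D V = tn V V].
Proof.
have [|||||D [DP DT DV Dh Dd]] := @lift _ _ T2 (tn V V) (gida_dga TP) _ _ T2_color.
- by move=> i j; apply: (mcoact_homog th th false).
- exact: homog_tn00.
- by rewrite det2 tnM0l // detV tn1.
- by move=> e a; apply: VV.
- exact: (@rel_mul A A T T Th Th TT relT relT).
have Dt e a : D (t e a) = mcoact t t e a.
  case: a => i j; rewrite -T2_dmx; case: e; last exact: DT.
  by rewrite -[RHS]/(gdif (T2 i j : gida_tens A A)) -DT -Dd.
exists D; split=> //.
apply: (gida_hom_gen Ag AP TP DP) => [[[[e i] j]|]|[[[e i] j]|]|y].
- by rewrite Dt; apply: mcoact_homog.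
- by rewrite DV; apply: homog_tn00.
- rewrite /= Dt; apply: etrans _ (esym (mcoact_bar AP AP th dt dt brK barT barT e i j)).
  by rewrite -Dt; congr D; case: (e); rewrite /dmx -?(gdif_bar AP) barT.
- by rewrite /= barV DV; apply: esym; rewrite -[in RHS]barV; exact: (tens_barE AP AP).
exact: Dd.
Qed.

Lemma exists_counit : exists eps : A -> C, [/\ scalar eps, monoid_morphism eps,
  forall i j, eps (T i j) = (i == j)%:R, eps V = 1 & 
  [/\ forall x, eps (gdif x) = 0, forall x, eps (gbar x) = (eps x)^* &
  forall p x, homog p.+1 x -> eps x = 0]].
Proof.
have [||||||eps [eP eT eV eh ed]] := @lift (scalar_galg C) _ (fun i j => (i == j)%:R) 1 (scalar_dga C).
- by [].
- by [].
- move=> [] [] a c; rewrite /dmx ?mul0r ?mulr0 ?scaler0 //.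
  case: a c => i j [k l]; rewrite /mcolor expr0 mul1r /=.
  (* A product of entries of the unit matrix is nonzero only for i = j and k = l, where the weight L
     i k L k i is 1. *)
  by case: (i =P j) => [<-|_]; case: (k =P l) => [<-|_];
    rewrite ?mul0r ?mulr0 ?scaler0 ?LV ?scale1r.
- by rewrite (color_det_id L ru) mulr1.
- by move=> e a; rewrite mul1r mulr1.
- exact: rel_id.
have e0 p x : homog p.+1 x -> eps x = 0 by move=> /eh <-.
exists eps; split=> //; [exact: ah_linear eP|exact: ah_mul eP|split=> //].
have eM (x y : A) : eps (x * y) = (eps x : C) * (eps y : C) := ahM eP x y.
have eZ a (x : A) : eps (a *: x) = a * (eps x : C) := linZ (ah_linear eP) a x.
apply: (gen_ind Ag) => [|a x y hx hy|y p x hx IH].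
- by rewrite (gbar1 AP) (ah1 eP) rmorph1.
- by rewrite (gbar_antilinear AP) !(ah_linear eP) hx hy rmorphD rmorphM.
rewrite (gbarM AP (gen_homog Ag y) hx) eZ !eM IH rmorphM.
have -> : eps (gbar (gen_map t V y)) = (eps (gen_map t V y))^*.
  case: y => [[[[] i] j]|] /=; first by rewrite /dmx -(gdif_bar AP) !ed rmorph0.
    by rewrite /dmx barT !eT (inj_eq (inv_inj brK)) rmorph_nat.
  by rewrite barV eV rmorph1.
case: y => [[[[] i] j]|]; first by rewrite /= /dmx /= ed rmorph0 mulr0 mul0r mulr0.
  by rewrite mul0n expr0 mul1r mulrC.
by rewrite mul0n expr0 mul1r mulrC.
Qed.

Let detC x : det * x = x * det.
Proof.
by rewrite -[LHS]mulr1 -Vdet1 -!mulrA (mulrA x) -VC -(mulrA V) mulrA detV mul1r.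
Qed.

(* The antipode reverses products with the sign (-1)^(pq); multiplying it by    *)
(* (-1)^(p(p-1)/2) in degree p makes it a homomorphism to the plain opposite    *)
(* algebra, which the universal property provides.                              *)
Lemma exists_antipode : exists S : I -> I -> A, exists s : A -> A,
  [/\ forall i j, \sum_k T i k * S k j = (i == j)%:R,
      forall i j, \sum_k S i k * T k j = (i == j)%:R,
      forall i j, homog 0 (S i j) &
  [/\ linear s, s 1 = 1,
      forall p q x y, homog p x -> homog q y -> s (x * y) = (-1) ^+ (p * q) *: (s y * s x),
      forall e a, s (t e a) = dmx (@gdif C A) S e a & s V = det]].
Proof.
have [S [TS ST]] := color_mx_inverse Lii LV Lc rI ru Tc detV VT.
have Sh := inverse_homog Th TS ST.
have Sc := inverse_gcolor LV dP Th Tc TS ST.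
have oE e a : dmx (op_dif (@gdif C A)) (fun i j => toop (S i j) : gop A) e a =
    toop (dmx (@gdif C A) S e a).
  case: e => //; rewrite /dmx (op_difE dP (homog_toop (Sh _ _))) expr0 scale1r.
  by [].
have [||||||s [sP sT sV sh sd]] := @lift (gop A) _ (fun i j => toop (S i j)) (toop det) (op_dga dP).
- by move=> i j; apply/homog_toop/Sh.
- exact/homog_toop.
- by move=> e e' a c; rewrite !oE; apply: Sc.
- have h := det_inverse Lii LV rI ru dP Th Tc detV VT TS ST.
  by rewrite -[LHS]/(toop (det * ofop (color_det L r (fun i j => toop (S i j) : gop A)))) h detV.
- move=> e a; rewrite oE; exact: (congr1 (@toop C A) (esym (detC _))).
- exact: (rel_inv TS ST (inverse_color_op LV dP Th Tc TS ST) relT).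
exists S; pose w p : C := (-1) ^+ 'C(p, 2).
exists (fun x => ofop (s (gweight w x))).
have sE p x : homog p x -> ofop (s (gweight w x)) = w p *: ofop (s x).
  by move=> hx; rewrite (gweightE _ hx) (linZ (ah_linear sP)).
have sl : linear (fun x => ofop (s (gweight w x))).
  by move=> a x y; rewrite gweight_linear (ah_linear sP).
split=> //; split=> //.
- by rewrite (sE _ _ (homog1 A)) /w expr0 scale1r (ah1 sP).
- move=> p q x y hx hy; rewrite (sE _ _ (homogM hx hy)) (sE _ _ hx) (sE _ _ hy).
  rewrite (ahM sP) ofopM pzmulZl pzmulZr !scalerA; congr (_ *: _).
  rewrite /w -!exprD; apply: sign_parity.
  rewrite !oddD; have := bin_sum2 p q => /(congr1 odd); rewrite !oddD => ->.
  by case: odd; case: odd; case: odd.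
- move=> e a; rewrite (sE _ _ (th e a)) /w.
  (* The twist is 1 in degrees 0 and 1, so it does not affect the values on generators. *)
  have -> : 'C(e, 2) = 0%N by case: e.
  rewrite expr0 scale1r -[RHS]/(ofop (toop (dmx (@gdif C A) S e a))) -oE; congr ofop.
  case: e => /=; rewrite /dmx ?sd ?sT //.
by rewrite (sE _ _ Vh) /w expr0 scale1r sV.
Qed.

Context (M : gida_data C) (MP : is_gida M) (x : bool -> I -> M).
Hypothesis Mg : generated (fun y : bool * I => nat_of_bool y.1) (fun y => x y.1 y.2).
Hypothesis xc : gcolor L x.
Hypothesis dx : forall i, gdif (x false i) = x true i.
Hypothesis barx : forall i, gbar (x false i) = x false (br i).
Hypothesis Mlift : forall (B : pzAlg C) (y : bool -> I -> B), gcolor L y ->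
  exists f : M -> B, alg_hom f /\ forall e i, f (x e i) = y e i.

Let xs (e : bool) (a : I * unit) : M := x e a.1.
Let xh (e : bool) a : homog e (xs e a) := gen_homog Mg (e, a.1).
Let dxs a : gdif (xs false a) = xs true a. Proof. exact: dx. Qed.
Let TM := gida_tensP AP MP.

Lemma exists_coaction : exists K : M -> gtens A M,
  is_gida_hom (K : M -> gida_tens A M) /\
  forall e a, K (xs e a) = mcoact t xs e a.
Proof.
have yc : gcolor L (fun e i => mcoact t xs e (i, tt)).
  have xsc : gcolor (fun a c : I * unit => L a.1 c.1 * (fun _ _ : unit => 1 : C) a.2 c.2) xs.
    by move=> e e' k l; rewrite /= mulr1; apply: xc.
  have h := gcolor_tensor (E := fun _ _ : unit => 1 : C) LV th xh Tc xsc.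
  by move=> e e' i k; have := h e e' (i, tt) (k, tt); rewrite /= mulr1; apply.
have [K [KP KE']] := Mlift yc.
have KE e a : K (xs e a) = mcoact t xs e a by case: a => i []; apply: KE'.
have kE e i : K (x e i) = mcoact t xs e (i, tt) := KE e (i, tt).
have kd i : gdif (mcoact t xs false (i, tt) : gida_tens A M) = mcoact t xs true (i, tt).
  exact: (mcoact_dif AP MP th dt dxs).
exists K; split=> //.
apply: (gida_hom_gen Mg MP TM KP) => [[e i]|[e i]|[[] i]] /=.
- by rewrite kE; apply: (mcoact_homog th xh).
- rewrite kE; apply: etrans _ (esym (mcoact_bar AP MP th dt dxs brK (bs := id) barT
    (fun i _ => barx i) e i tt)).
  by rewrite -kE; congr K; case: (e); rewrite -?dx -?(gdif_bar MP) barx.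
- by rewrite kE -kd -dx (gdif2 MP) (lin0 (ah_linear KP)); apply/esym/(gdif2 TM).
by rewrite dx !kE; apply/esym/kd.
Qed.

(** Coassociativity, the counit laws and the comodule laws equate algebra homomorphisms and are
    compared on generators. The antipode laws reduce to generators through [conv_l_gen] and
    [conv_r_gen], where they become S T = 1 = T S, the derivatives of these identities, and det V =
    1 = V det. *)
Theorem matrix_hopf : exists H : gid_hopf A,
  [/\ forall i j, comul H (T i j) = \sum_k (T i k ⊗ T k j), comul H V = V ⊗ V,
      forall i j, counit H (T i j) = (i == j)%:R, counit H V = 1 &
      exists K : gid_comodule H M,
        forall i, coaction K (x false i) = \sum_j (T i j ⊗ x false j)].
Proof.
have [D [Dg Dt DV]] := exists_comul.
have [eps [el eM eT eV [ed eb e0]]] := exists_counit.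
have [S [s [TS ST Sh [sl s1 sM sT sV]]]] := exists_antipode.
have [K [Kg KE]] := exists_coaction.
have DP := gida_hom_alg Dg; have Dh := gida_hom_homog Dg.
have KP := gida_hom_alg Kg; have Kh := gida_hom_homog Kg.
have et a : eps (t true a) = 0 by apply: ed.
have Dassoc y : tens_assoc (tens_map D id (D y)) = tens_map id D (D y).
  have h1 := alg_hom_comp DP (alg_hom_comp (tens_map_hom DP (alg_hom_id A) Dh (fun _ _ h => h))
    (gassoc_hom A A A)).
  have h2 := alg_hom_comp DP (tens_map_hom (alg_hom_id A) DP (fun _ _ h => h) Dh).
  move: y; apply: (alg_hom_ext Ag h1 h2) => -[[[e i] j]|] /=.
    rewrite Dt; exact: (mcoact_assoc DP DP Dh Dh Dt Dt e (i, j)).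
  rewrite DV (tens_mapE DP (alg_hom_id A)) (tens_mapE (alg_hom_id A) DP) DV gassocE //.
have Kassoc y : tens_assoc (tens_map D id (K y)) = tens_map id K (K y).
  have h1 := alg_hom_comp KP (alg_hom_comp (tens_map_hom DP (alg_hom_id M) Dh (fun _ _ h => h))
    (gassoc_hom A A M)).
  have h2 := alg_hom_comp KP (tens_map_hom (alg_hom_id A) KP (fun _ _ h => h) Kh).
  move: y; apply: (alg_hom_ext Mg h1 h2) => -[e i] /=.
  have := KE e (i, tt); rewrite /xs /= => ->.
  exact: (mcoact_assoc DP KP Dh Kh Dt KE e (i, tt)).
have cl := contract_l_hom el eM e0; have cr := contract_r_hom el eM e0.
have Kcounit y : tens_lift idfun (fun (a : A) (m : M) => eps a *: m) (K y) = y.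
  move: y; apply: (alg_hom_ext Mg (alg_hom_comp KP (cl M)) (alg_hom_id M)) => -[e i] /=.
  have := KE e (i, tt); rewrite /xs /= => ->.
  exact: (@mcoact_counit C I unit A M t xs eps el eT et e (i, tt)).
have Dcounitl y : tens_lift idfun (fun a b : A => eps a *: b) (D y) = y.
  move: y; apply: (alg_hom_ext Ag (alg_hom_comp DP (cl A)) (alg_hom_id A)) => -[[[e i] j]|] /=.
    by rewrite Dt; apply: (@mcoact_counit C I I A A t t eps el eT et e (i, j)).
  by rewrite DV (gtlE (contract_l_bilin el A)) eV scale1r.
have lift_m (f : A -> A -> A) (fb : bilin f) e1 e2 i j :
    tens_lift idfun f (mtens t t e1 e2 i j) = \sum_k f (t e1 (i, k)) (t e2 (k, j)).
  by rewrite (lin_sum (gtl_linear fb)); apply: eq_bigr => k _; rewrite (gtlE fb).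
have lift0 (f : A -> A -> A) (fb : bilin f) i j :
    tens_lift idfun f (D (t false (i, j))) = \sum_k f (t false (i, k)) (t false (k, j)).
  by rewrite Dt /mcoact lift_m.
have lift1 (f : A -> A -> A) (fb : bilin f) i j : tens_lift idfun f (D (t true (i, j))) =
    \sum_k (f (t true (i, k)) (t false (k, j)) + f (t false (i, k)) (t true (k, j))).
  by rewrite Dt /mcoact (linD (gtl_linear fb)) !lift_m // big_split.
have d_delta (c : bool) : gdif (c%:R : A) = 0.
  by case: c; [apply: (dga1 dP)|apply: (lin0 (dga_linear dP))].
have delta_scale (c : bool) : (c%:R : A) = c%:R *: (1 : A).
  by case: c; rewrite ?scale1r ?scale0r.
have Dcounitr y : tens_lift idfun (fun a b : A => eps b *: a) (D y) = y.
  move: y; apply: (alg_hom_ext Ag (alg_hom_comp DP (cr A)) (alg_hom_id A)) => -[[[e i] j]|] /=.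
    have h (F : I -> A) : \sum_k eps (T k j) *: F k = F j.
      rewrite (bigD1 j) //= eT eqxx scale1r big1 ?addr0 // => k /negbTE kj.
      by rewrite eT kj scale0r.
    have fb := contract_r_bilin el A.
    case: e; last by rewrite (lift0 _ fb); exact: (h (fun k => T i k)).
    rewrite (lift1 _ fb) -[RHS](h (fun k => t true (i, k))); apply: eq_bigr => k _.
    by rewrite et scale0r addr0.
  by rewrite DV (gtlE (contract_r_bilin el A)) eV scale1r.
have sl_anti y : tens_lift idfun (fun a b : A => s a * b) (D y) = eps y *: (1 : A).
  move: y; apply: (conv_l_gen sl sM Ag DP Dh el eM e0 s1) => -[[[e i] j]|] /=.
    have fb := conv_l_bilin sl; case: e.
      (* As the antipode maps dT to dS, the law on dT is the derivative of S T = 1. *)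
      rewrite (lift1 _ fb) et scale0r -[RHS](d_delta (i == j)) -ST (lin_sum (dga_linear dP)).
      by apply: eq_bigr => k _; rewrite (dgaM dP _ (Sh i k)) expr0 scale1r !sT.
    rewrite (lift0 _ fb) eT -(delta_scale (i == j)) -ST; apply: eq_bigr => k _; by rewrite sT.
  by rewrite DV (gtlE (conv_l_bilin sl)) eV scale1r sV detV.
have sr_anti y : tens_lift idfun (fun a b : A => a * s b) (D y) = eps y *: (1 : A).
  move: y; apply: (conv_r_gen sl sM Ag DP Dh el eM e0 s1) => -[[[e i] j]|] /=.
    have fb := conv_r_bilin sl; case: e.
      rewrite (lift1 _ fb) et scale0r -[RHS](d_delta (i == j)) -TS (lin_sum (dga_linear dP)).
      by apply: eq_bigr => k _; rewrite (dgaM dP _ (Th i k)) expr0 scale1r !sT.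
    rewrite (lift0 _ fb) eT -(delta_scale (i == j)) -TS; apply: eq_bigr => k _; by rewrite sT.
  by rewrite DV (gtlE (conv_r_bilin sl)) eV scale1r sV Vdet1.
pose H := GidHopf AP Dg Dassoc el eM eb ed Dcounitl Dcounitr sl sl_anti sr_anti.
exists H; split=> //.
- by move=> i j; apply: (Dt false (i, j)).
exists (@GidComodule C A H M MP K Kg Kassoc Kcounit) => i.
exact: (KE false (i, tt)).
Qed.

End MatrixHopf.

Lemma eq_generated (C : comNzRingType) (A : gradedAlg C) (X : Type) (deg deg' : X -> nat)
    (g g' : X -> A) : deg =1 deg' -> g =1 g' -> generated deg g -> generated deg' g'.
Proof. by move=> /funext -> /funext ->. Qed.

(** * The group relations for the unit matrix, products and inverses *)

Section GroupRelClosure.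
Context (R : realType) (n : nat) (theta : 'M[R]_n) (htheta : theta^T = - theta).
Context (b : bool) (G : qgroup b).
Local Notation C := (R[i]).
Local Notation I := (idx n b).
Local Notation L := (@Lam R n theta b).
Local Notation r := (ref_word n b).
Local Notation br := (@ibar n b).
Local Notation rel := (group_rel theta G).

Let LV : forall i j : I, L i j * L j i = 1 := LamV htheta (b:=b).
Let Lii : forall i : I, L i i = 1 := Lam_diag htheta (b:=b).
Let rI : forall i : I, i \in r := @ref_word_mem n b.
Let ru : uniq r := ref_word_uniq n b.
Let brK : involutive br := @ibarK n b.

Lemma group_rel_id (B : pzAlg C) : rel (fun i j => (i == j)%:R : B).
Proof.
split=> [_|_|hb mu nu]; first exact: orth_id.
  exact: color_det_id.
by rewrite /ix /ixb.
Qed.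

Lemma sum_idx_even (hb : b = false) (V : nmodType) (F : I -> V) :
  \sum_i F i = \sum_mu F (ix b mu) + \sum_mu F (ixb b mu).
Proof.
rewrite big_sumType /= big_sumType /= [X in _ + X]big1 ?addr0 // => o.
by case: o => o ho; exfalso; move: ho; rewrite hb.
Qed.

Lemma group_rel_mul (A B : gradedAlg C) (T : I -> I -> A) (U : I -> I -> B) :
    (forall i j, homog 0 (T i j)) -> (forall i j, homog 0 (U i j)) ->
    color_mx L U -> rel T -> rel U ->
  rel (fun i j => \sum_k tn (T i k) (U k j) : gtens A B).
Proof.
move=> Th Uh UU [TQ Td Tb] [UQ Ud Ub]; split=> h.
- exact: (orth_mul brK Th Uh (TQ h) (UQ h)).
- by rewrite (color_det_tens T Lii LV rI ru Uh UU) (Td h) (Ud h) tn1.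
have hb := has_b_even h; move=> mu nu; rewrite !(sum_idx_even hb); split.
  rewrite !big1 ?addr0 // => k _; first by rewrite (Tb h _ _).1 tn0l.
  by rewrite (Ub h _ _).1 tn0r.
rewrite !big1 ?addr0 // => k _; first by rewrite (Ub h _ _).2 tn0r.
by rewrite (Tb h _ _).2 tn0l.
Qed.

Lemma left_inverse_eq0 (J : finType) (B : pzAlg C) (P Q : J -> J -> B) (y : J -> B) :
    (forall i l, \sum_m P i m * Q m l = (i == l)%:R) ->
  (forall m, \sum_l Q m l * y l = 0) -> forall i, y i = 0.
Proof.
move=> PQ Qy i; have : \sum_m P i m * (\sum_l Q m l * y l) = y i.
  under eq_bigr => m _ do rewrite mulr_sumr.
  rewrite exchange_big (bigD1 i) //= [X in _ + X]big1 ?addr0 => [|l li].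
    by under eq_bigr => m _ do rewrite mulrA; rewrite -mulr_suml PQ eqxx mul1r.
  by under eq_bigr => m _ do rewrite mulrA; rewrite -mulr_suml PQ eq_sym (negbTE li) mul0r.
by move=> <-; apply: big1 => m _; rewrite Qy mulr0.
Qed.

(** For T block diagonal, S T = 1 makes each diagonal block of S a left inverse of that of T, while
    the off-diagonal part of T S = 1 says that a diagonal block of T annihilates the off-diagonal
    block of S. *)
Lemma block_inverse (hb : b = false) (B : pzAlg C) (T S : I -> I -> B) :
    (forall i j, \sum_k T i k * S k j = (i == j)%:R) ->
    (forall i j, \sum_k S i k * T k j = (i == j)%:R) ->
  block T -> block S.
Proof.
move=> TS ST Tb mu nu; split.
  apply: (@left_inverse_eq0 _ _ (fun i m => S (ix b i) (ix b m))
    (fun m l => T (ix b m) (ix b l)) (fun l => S (ix b l) (ixb b nu))) => [i l|m].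
    have := ST (ix b i) (ix b l); rewrite (sum_idx_even hb) [X in _ + X]big1 ?addr0 // => k _.
    by rewrite (Tb _ _).2 mulr0.
  have := TS (ix b m) (ixb b nu); rewrite (sum_idx_even hb) [X in _ + X]big1 ?addr0 // => k _.
  by rewrite (Tb _ _).1 mul0r.
apply: (@left_inverse_eq0 _ _ (fun i m => S (ixb b i) (ixb b m))
  (fun m l => T (ixb b m) (ixb b l)) (fun l => S (ixb b l) (ix b nu))) => [i l|m].
  have := ST (ixb b i) (ixb b l); rewrite (sum_idx_even hb) [X in X + _]big1 ?add0r // => k _.
  by rewrite (Tb _ _).1 mulr0.
have := TS (ixb b m) (ix b nu); rewrite (sum_idx_even hb) [X in X + _]big1 ?add0r // => k _.
by rewrite (Tb _ _).2 mul0r.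
Qed.

Lemma group_rel_inv (A : gradedAlg C) (T S : I -> I -> A) :
    (forall i j, \sum_k T i k * S k j = (i == j)%:R) ->
    (forall i j, \sum_k S i k * T k j = (i == j)%:R) ->
    color_mx L (fun i j => toop (S i j) : gop A) -> rel T ->
  rel (fun i j => toop (S i j) : gop A).
Proof.
move=> TS ST SS [TQ Td Tb]; split=> h.
- exact: (orth_inverse brK TS (TQ h)).
- have := color_det_inv Lii LV rI ru TS SS; rewrite (Td h) mul1r; exact.
have Sb := block_inverse (has_b_even h) TS ST (Tb h).
move=> mu nu; have [e1 e2] := Sb mu nu.
by split; [exact e1|exact e2].
Qed.

End GroupRelClosure.

Theorem corollary2 (R : realType) (n : nat) (hn : (2 <= n)%N)
    (theta : 'M[R]_n) (htheta : theta^T = - theta)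
    (b : bool) (G : qgroup b) :
  exists H : gid_hopf (Omega_alg theta G),
    [/\ forall i j, comul H (tG theta G i j) =
          \sum_k (tG theta G i k ⊗ tG theta G k j),
        comul H (detVG theta G) = detVG theta G ⊗ detVG theta G,
        forall i j, counit H (tG theta G i j) = (i == j)%:R,
        counit H (detVG theta G) = 1 &
        exists K : gid_comodule H (Omega_R theta b),
          forall i, coaction K (xi theta i) =
            \sum_j (tG theta G i j ⊗ xi theta j)].
Proof.
have [gP _ _] := Omega_G_gida_full htheta G.
have [MP Mb Md _] := Omega_R_gida_full htheta b.
pose t := dmx (@gdif _ (Omega_alg theta G)) (tG theta G).
pose x (e : bool) i := genR theta (e, i) : Omega_R theta b.
have Ag : generated (gen_map (fun (e : bool) _ => nat_of_bool e) 0%N) (gen_map t (detVG theta G)).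
  apply: (eq_generated _ _ (genG_generated theta G)) => -[[[e i] j]|] //.
  exact: esym (genG_dmx htheta G e (i, j)).
have barT i j : gbar (tG theta G i j) = tG theta G (ibar i) (ibar j) := genG_bar htheta G _.
have barV : gbar (detVG theta G) = detVG theta G := genG_bar htheta G None.
have Mg : generated (fun y : bool * idx n b => nat_of_bool y.1) (fun y => x y.1 y.2).
  by apply: (eq_generated _ _ (genR_generated theta b)) => -[].
have Mlift (B : pzAlg R[i]) (y : bool -> idx n b -> B) : gcolor (@Lam R n theta b) y ->
    exists f : Omega_R theta b -> B, alg_hom f /\ forall e i, f (x e i) = y e i.
  by move=> yc; have [fP fE] := Omega_R_lift yc; exists (plift (fun z => y z.1 z.2)).
exact (@matrix_hopf _ (idx n b) (@Lam R n theta b) (ref_word n b)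
  (Lam_diag htheta (b := b)) (LamV htheta (b := b)) (Lam_conj htheta (b := b))
  (@ref_word_mem n b) (ref_word_uniq n b) (@ibar n b) (@ibarK n b)
  (group_rel theta G) (group_rel_id theta G) (group_rel_mul htheta (G := G)) (group_rel_inv htheta (G := G))
  (Omega_alg theta G) gP (tG theta G) (detVG theta G) Ag (genG_color htheta G)
  (genG_det htheta G) (@genG_detV_central R n theta b G) barT barV (genG_rel htheta G)
  (Omega_G_lift htheta (G := G))
  (Omega_R theta b) MP x Mg (genR_color htheta (b := b)) Md (Mb false) Mlift).
Qed.
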